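(* Let $\mathcal H$ be a separable Hilbert space, $H$ a self-adjoint operator on $\mathcal H$ with domain $D(H)$, $T>0$, $I=(0,T)$, $(B(t))_{t\in\overline I}$ a strongly continuous family of bounded self-adjoint operators on $\mathcal H$, $u_0\in\mathcal H$ and $f\in L^2(I,\mathcal H)$. Then the weak solution $u^*$ to $$(i\partial_t-H-B(t))u^*(t)=f(t),\ t\in I,\qquad u^*(0)=u_0,$$ belongs to $\mathcal X_H$, and it is characterized as the unique minimizer over $\mathcal X_H$ of $$E(u)=|u(0)-u_0|^2+T\,\|(i\partial_t-H-B(t))u-f\|_{L^2(I,\mathcal H)}^2,\qquad u\in\mathcal X_H.$$
   Context: $|\cdot|$ is the norm of $\mathcal H$; $L^2(I,\mathcal H)$ is the Bochner space with inner product $(u|v)=\int_I\langle u(t),v(t)\rangle dt$. For $u,g\in L^2(I,\mathcal H)$, $(i\partial_t-H)u=g$ means $(u|(i\partial_t-H)\varphi)=(g|\varphi)$ for all $\varphi\in C_c^0(I,D(H))\cap C_c^1(I,\mathcal H)$ ($D(H)$ with graph norm); such $u$ is in $C^0(\overline I,\mathcal H)$, so $u(0)$ makes sense. $u^*\in L^2(I,\mathcal H)$ is a weak solution of the evolution problem if $(u^*|(i\partial_t-H-B(t))\varphi)=(f|\varphi)$ for all such $\varphi$ and $u^*(0)=u_0$. $\mathcal X_H$ is the set of $u\in L^2(I,\mathcal H)$ for which there exists $g\in L^2(I,\mathcal H)$ with $(i\partial_t-H)u=g$; $(i\partial_t-H-B(t))u$ means $(i\partial_t-H)u-B(\cdot)u$.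 *)

(* Defs.v *)
From HB Require Import structures.
From mathcomp Require Import all_boot all_order all_algebra.
From mathcomp Require Import sesquilinear complex.
From mathcomp Require Import all_classical all_reals all_analysis.

Set Implicit Arguments.
Unset Strict Implicit.
Unset Printing Implicit Defensive.

Import Order.TTheory GRing.Theory Num.Theory.
Import numFieldNormedType.Exports.

Local Open Scope classical_set_scope.
Local Open Scope ring_scope.
Local Open Scope complex_scope.

(* Complex Hilbert spaces, with scalars in R[i]. The inner product is linear in the first argument
   and conjugate-linear in the second. *)
HB.mixin Record CompleteNormedModule_isHilbert (R : realType) V
    of CompleteNormedModule R[i] V := {
  inner : {dot V for Num.conj};
  inner_normE : forall x : V, inner x x = `|x| ^+ 2
}.

#[short(type="hilbertType")]
HB.structure Definition Hilbert (R : realType) :=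
  {V of CompleteNormedModule R[i] V & CompleteNormedModule_isHilbert R V}.

Section HilbertSpace.
Context {R : realType} {V : hilbertType R}.
Implicit Types (D : set V) (H A : V -> V) (x y z : V).

(* The norm of V is a nonnegative real element of R[i]; this is that real. *)
Definition hnorm x : R := complex.Re `|x|.

Definition separable_hilbert : Prop :=
  exists2 S : set V, countable S & dense S.

(* An operator H with domain D is a total function whose values outside D are
   irrelevant. *)
Definition densely_defined_linear D H : Prop :=
  [/\ dense D, D 0,
      forall (a : R[i]) x y, D x -> D y -> D (a *: x + y) &
      forall (a : R[i]) x y, D x -> D y -> H (a *: x + y) = a *: H x + H y].

(* Graph of the adjoint operator: y is in D(H^* ) and H^* y = z. *)
Definition adjoint_graph D H y z : Prop :=
  forall x, D x -> inner (H x) y = inner x z.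

(* H^* = H, domains included. *)
Definition selfadjoint D H : Prop :=
  densely_defined_linear D H /\
  forall y z, adjoint_graph D H y z <-> D y /\ z = H y.

Definition bounded_operator A : Prop :=
  linear A /\ exists M : R, forall x, hnorm (A x) <= M * hnorm x.

Definition graph_norm H x : R := hnorm x + hnorm (H x).

End HilbertSpace.

Arguments separable_hilbert {R} V.

Section Evolution.
Context {R : realType} {V : hilbertType R}.
Variable T : R.
Implicit Types (u v w g f : R -> V).

Local Notation mu := (@lebesgue_measure R).
Local Notation I := (`]0, T[%classic : set R).

(* Elements of L^2(I, V) are represented by functions R -> V, of which only the
   values on I matter, up to equality almost everywhere on I. *)

Definition simple_fun (s : R -> V) : Prop :=
  finite_set (range s) /\ forall x, measurable (s @^-1` [set x]).

(* The limit is required at every t of I: every class of a.e. limits of simple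
   functions has such a representative. *)
Definition strongly_measurable u : Prop :=
  exists s : nat -> R -> V,
    (forall n, simple_fun (s n)) /\
    forall t, I t -> s n t @[n --> \oo] --> u t.

Definition L2 : set (R -> V) :=
  [set u | strongly_measurable u /\
           (\int[mu]_(t in I) ((hnorm (u t)) ^+ 2)%:E < +oo)%E].

Definition L2eq u v : Prop := ae_eq mu I u v.

Definition L2inner u v : R[i] :=
  (\int[mu]_(t in I) complex.Re (inner (u t) (v t))) +i*
  (\int[mu]_(t in I) complex.Im (inner (u t) (v t))).

Definition L2norm u : R := Num.sqrt (complex.Re (L2inner u u)).

(* Derivative of a V-valued function of a real variable; the derivative of the
   library would need V to be a normed module over R itself. *)
Definition tquotient (phi : R -> V) (t h : R) : V :=
  (h^-1)%:C *: (phi (t + h) - phi t).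

Definition tderivable (phi : R -> V) (t : R) : Prop :=
  cvg (tquotient phi t h @[h --> 0^']).

Definition tderive (phi : R -> V) (t : R) : V :=
  lim (tquotient phi t h @[h --> 0^']).

Variables (D : set V) (H : V -> V).

(* C_c^0(I, D(H)) and C_c^1(I, V), functions on I being extended by 0 to R. *)
Definition Cc (phi : R -> V) : Prop :=
  let S := closure [set t | phi t != 0] in compact S /\ S `<=` I.

Definition Cc0_dom (phi : R -> V) : Prop :=
  [/\ Cc phi, forall t, D (phi t) &
      forall t, graph_norm H (phi s - phi t) @[s --> t] --> (0 : R)].

Definition Cc1 (phi : R -> V) : Prop :=
  [/\ Cc phi, forall t, tderivable phi t & continuous (tderive phi)].

Definition test_fun (phi : R -> V) : Prop := Cc0_dom phi /\ Cc1 phi.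

Definition schrodinger (phi : R -> V) (t : R) : V :=
  'i *: tderive phi t - H (phi t).

(* (i d/dt - H) u = g in the weak sense. *)
Definition weak_schrodinger u g : Prop :=
  forall phi, test_fun phi -> L2inner u (schrodinger phi) = L2inner g phi.

Definition XH : set (R -> V) :=
  [set u | L2 u /\ exists2 g, L2 g & weak_schrodinger u g].

(* The function (i d/dt - H) u for u in XH, unique up to L2eq. *)
Definition schrodinger_op u : R -> V :=
  xget (fun=> 0) [set g | L2 g /\ weak_schrodinger u g].

(* u(0) = x, for the representative of u that is continuous on [0, T]. *)
Definition initial_value u (x : V) : Prop :=
  exists w, [/\ {within `[0, T], continuous w}, L2eq w u & w 0 = x].

Definition at0 u : V := xget 0 (initial_value u).

Variables (B : R -> V -> V) (u0 : V) (f : R -> V).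

Definition weak_solution u : Prop :=
  [/\ L2 u,
      forall phi, test_fun phi ->
        L2inner u (fun t => schrodinger phi t - B t (phi t)) = L2inner f phi &
      initial_value u u0].

Definition energy u : R :=
  hnorm (at0 u - u0) ^+ 2 +
  T * L2norm (fun t => schrodinger_op u t - B t (u t) - f t) ^+ 2.

End Evolution.

Definition minimizer (R : realType) (U : Type) (X : set U) (E : U -> R) (u : U)
    : Prop :=
  X u /\ forall v, X v -> E u <= E v.

(* Main.v *)
Require Import Defs.
From HB Require Import structures.
From mathcomp Require Import all_boot all_order all_algebra.
From mathcomp Require Import sesquilinear complex.
From mathcomp Require Import all_classical all_reals all_analysis.
From mathcomp Require Import measurable_realfun ring lra.

Set Implicit Arguments.
Unset Strict Implicit.
Unset Printing Implicit Defensive.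

Import Order.TTheory GRing.Theory Num.Theory.
Import numFieldNormedType.Exports.

Local Open Scope classical_set_scope.
Local Open Scope ring_scope.

(* On X_H the energy E is nonnegative and vanishes exactly at the weak solutions, so everything
   reduces to existence and uniqueness for the weak evolution problem.

   Regularity.  The resolvents [J n = (1 - i H / n)^-1] are contractions tending strongly to 1, and
   the regularisation [J n u] of a weak solution has an L2 time derivative, hence is a primitive.
   Integrating by parts [<J n u, J n u>] and letting n tend to infinity gives a continuous
   representative with |u(t)|^2 - |u(s)|^2 = - 2 Re (int_s^t <i g, u>), and the energy bound
   |u(t)| <= |u(0)| + 2 int_0^t |g|.

   Existence.  Bounded operators are a perturbation of 0, handled by Picard iteration on the energy
   bound; the Yosida approximations of H give the case B = 0 in the limit; a second Picard iteration
   adds B, which is uniformly bounded by the Banach-Steinhaus theorem.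

   Uniqueness.  For the difference d of two solutions the source is B d, and Re <i B d, d> = 0, so
   |d| is constant. *)

(** * The real inner product *)

(** Vector-valued integrals are only defined weakly, by Riesz representation of [x |-> int <k, x>],
    and a primitive is known through its increments, never through differentiability almost
    everywhere. The product rule for such primitives therefore comes from their 1/2-Hölder
    continuity and a bisection argument. Conversely, information is drawn from weak equations by
    testing with [eta(t) x], where [eta] is a scalar C^1 bump: evaluation at Lebesgue points makes
    it pointwise, and separability reduces the vectors [x] to countably many, so that the
    exceptional null sets can be united. The unbounded term never has to be estimated in the energy
    identity: [Re <i H v, v>] vanishes, also when [v] is a difference of two regularisations, so
    these are uniformly Cauchy in time. For the Yosida solutions the obstacle is that [Y n - H] is
    small only on the domain of [H^2], where the data need not lie. Two resolvents push a solution
    into that domain at a fixed cost, commute with the equation and change the solutions little,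
    uniformly in the approximation. *)

Section RealHilbert.
Local Open Scope complex_scope.
Context {R : realType} {V : hilbertType R}.
Implicit Types (x y z : V) (a : R).

(* Every scalar integral is taken of the real inner product; the imaginary part of [inner x y]
   is recovered as [rinner x ('i *: y)]. *)
Definition rinner x y : R := complex.Re (inner x y).

Lemma rinnerC x y : rinner x y = rinner y x.
Proof.
rewrite /rinner [inner x y]hermC expr0 mul1r.
have h (z : R[i]) : complex.Re (Num.conj z) = complex.Re z by case: z.
exact: h.
Qed.

Lemma rinnerDl x y z : rinner (x + y) z = rinner x z + rinner y z.
Proof. by rewrite /rinner linearDl raddfD. Qed.

Lemma rinnerNl x z : rinner (- x) z = - rinner x z.
Proof. by rewrite /rinner linearNl raddfN. Qed.

Lemma rinnerZl a x z : rinner (a%:C *: x) z = a * rinner x z.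
Proof.
rewrite /rinner linearZl_LR /=; case: (inner x z) => u v /=.
by rewrite mul0r subr0.
Qed.

(** Multiplication by ['i] is skew for the real pairing; hence [rinner ('i *: A x) x] vanishes
    whenever [A] is symmetric for it and commutes with ['i]. *)
Lemma rinner_il x y : rinner ('i *: x) y = - rinner x ('i *: y).
Proof.
rewrite /rinner linearZl_LR linearZr_LR /=; case: (inner x y) => u v /=.
lra.
Qed.

Lemma Im_inner x y : complex.Im (inner x y) = rinner x ('i *: y).
Proof.
rewrite /rinner linearZr_LR /=; case: (inner x y) => u v /=; lra.
Qed.

Lemma innerE x y : inner x y = rinner x y +i* rinner x ('i *: y).
Proof. by rewrite -Im_inner /rinner; case: (inner x y). Qed.

Lemma rinnerDr x y z : rinner x (y + z) = rinner x y + rinner x z.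
Proof. by rewrite rinnerC rinnerDl !(rinnerC x). Qed.

Lemma rinnerNr x z : rinner x (- z) = - rinner x z.
Proof. by rewrite rinnerC rinnerNl (rinnerC x). Qed.

Lemma rinnerZr a x z : rinner x (a%:C *: z) = a * rinner x z.
Proof. by rewrite rinnerC rinnerZl (rinnerC x). Qed.

Lemma rinner_ii x y : rinner ('i *: x) ('i *: y) = rinner x y.
Proof.
rewrite rinner_il scalerA; have -> : 'i * 'i = (- 1)%:C :> R[i] by simpc; congr Complex; ring.
by rewrite rinnerZr; ring.
Qed.

Lemma rinner0l x : rinner 0 x = 0.
Proof. by have := rinnerZl 0 0 x; rewrite scaler0 mul0r. Qed.

Lemma rinner0r x : rinner x 0 = 0.
Proof. by rewrite rinnerC rinner0l. Qed.

Definition rinnerE := (rinnerDl, rinnerDr, rinnerNl, rinnerNr, rinnerZl, rinnerZr,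
  rinner0l, rinner0r).

Lemma hnormE x : `|x| = (hnorm x)%:C.
Proof.
rewrite /hnorm; have : `|x| \is Num.real by exact: normr_real.
by move=> /RRe_real.
Qed.

Lemma hnorm_ge0 x : 0 <= hnorm x.
Proof. by rewrite -ler0c -hnormE. Qed.

Lemma hnorm_sq x : hnorm x ^+ 2 = rinner x x.
Proof.
by rewrite /rinner inner_normE hnormE -rmorphXn.
Qed.

Lemma hnorm0 : hnorm (0 : V) = 0.
Proof. by rewrite /hnorm normr0. Qed.

Lemma hnorm_eq0 x : hnorm x = 0 -> x = 0.
Proof. by move=> h; apply/normr0_eq0; rewrite hnormE h. Qed.

Lemma hnormD x y : hnorm (x + y) <= hnorm x + hnorm y.
Proof. by rewrite -lecR rmorphD /= -!hnormE ler_normD. Qed.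

Lemma hnormN x : hnorm (- x) = hnorm x.
Proof. by rewrite /hnorm normrN. Qed.

Lemma hnormBC x y : hnorm (x - y) = hnorm (y - x).
Proof. by rewrite -hnormN opprB. Qed.

Lemma hnormB x y : hnorm (x - y) <= hnorm x + hnorm y.
Proof. by rewrite -(hnormN y) hnormD. Qed.

Lemma hnorm_dist z x y : hnorm (x - y) <= hnorm (x - z) + hnorm (z - y).
Proof. by apply: le_trans (hnormD _ _); rewrite subrKA. Qed.

Lemma hnormZ a x : hnorm (a%:C *: x) = `|a| * hnorm x.
Proof.
by apply/complexI; rewrite -hnormE normrZ normc_def /= expr0n addr0 sqrtr_sqr hnormE rmorphM.
Qed.

Lemma hnormI x : hnorm ('i *: x) = hnorm x.
Proof.
by apply/complexI; rewrite -hnormE normrZ normc_def /= expr0n add0r expr1n sqrtr1 mul1r hnormE.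
Qed.

Lemma rinner_ge0 x : 0 <= rinner x x.
Proof. by rewrite -hnorm_sq exprn_ge0// hnorm_ge0. Qed.

Lemma rinner_eq0 x : rinner x x = 0 -> x = 0.
Proof. by rewrite -hnorm_sq => /eqP; rewrite sqrf_eq0 => /eqP /hnorm_eq0. Qed.

Lemma rinner_ext x y : (forall z, rinner x z = rinner y z) -> x = y.
Proof.
move=> h; apply/eqP; rewrite -subr_eq0; apply/eqP/rinner_eq0.
by rewrite {1}rinnerDl rinnerNl h subrr.
Qed.

Lemma rinner_le x y : `|rinner x y| <= hnorm x * hnorm y.
Proof.
rewrite -(ler_pXn2r (_ : 0 < 2)%N)// ?nnegrE ?mulr_ge0 ?hnorm_ge0//.
rewrite real_normK ?num_real// exprMn !hnorm_sq.
have [->|y0] := eqVneq y 0; first by rewrite !rinnerE; lra.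
have y1 : 0 < rinner y y.
  by rewrite lt_def rinner_ge0 andbT; apply: contra y0 => /eqP/rinner_eq0 ->.
(* The squared norm of this vector is [rinner y y] times the Cauchy-Schwarz defect. *)
have := rinner_ge0 ((rinner y y)%:C *: x - (rinner x y)%:C *: y).
rewrite !rinnerE (rinnerC y x).
move=> h; rewrite -subr_ge0 -(pmulr_rge0 _ y1); apply: le_trans h _.
by rewrite le_eqVlt; apply/orP; left; apply/eqP; ring.
Qed.

Lemma rinner_le2 x y : `|rinner x y| <= hnorm x ^+ 2 + hnorm y ^+ 2.
Proof.
apply: le_trans (rinner_le x y) _.
have := sqr_ge0 (hnorm x - hnorm y); have := sqr_ge0 (hnorm x + hnorm y).
by rewrite sqrrB sqrrD => h1 h2; nra.
Qed.

Lemma hnorm_le_rinner x a : 0 <= a -> (forall y, rinner x y <= a * hnorm y) -> hnorm x <= a.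
Proof.
move=> a0 /(_ x); rewrite -hnorm_sq expr2.
have := hnorm_ge0 x; rewrite le_eqVlt => /orP[/eqP <-//|x0].
by rewrite ler_pM2r.
Qed.

Lemma parallelogram x y :
  hnorm (x + y) ^+ 2 + hnorm (x - y) ^+ 2 = 2 * (hnorm x ^+ 2 + hnorm y ^+ 2).
Proof. by rewrite !hnorm_sq !rinnerE (rinnerC y x); ring. Qed.

Lemma hnorm_distr x y : `|hnorm x - hnorm y| <= hnorm (x - y).
Proof.
rewrite ler_norml; have := hnormD (x - y) y; have := hnormD (y - x) x.
by rewrite !subrK (hnormBC y x) => h1 h2; apply/andP; split; lra.
Qed.

End RealHilbert.

(** * Convergence measured by the real-valued norm *)

Lemma invS_lt {R : archiRealFieldType} (e : R) : 0 < e ->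
  exists N, forall n, (N <= n)%N -> n.+1%:R^-1 < e.
Proof.
move=> e0; exists (Num.truncn e^-1) => n Nn.
rewrite -[ltRHS]invrK ltf_pV2 ?posrE ?invr_gt0//.
by apply: lt_le_trans (truncnS_gt _) _; rewrite ler_nat.
Qed.

Section Convergence.
Context {R : realType} {V : hilbertType R}.
Implicit Types (x y z l : V) (a e : R).

(** The norm of [V] takes values in [R[i]], and so do the radii of its balls; a positive element of
    [R[i]] is real, so real radii are enough. *)
Lemma hnorm_cvgP (X : Type) (F : set_system X) {FF : Filter F} (u : X -> V) l :
  u @ F --> l <-> forall e, 0 < e -> \forall t \near F, hnorm (u t - l) < e.
Proof.
split => [/cvgrPdist_lt h e e0|h].
  have /h : 0 < (e%:C)%C by rewrite ltcR.
  by apply: filterS => t; rewrite hnormE ltcR hnormBC.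
apply/cvgrPdist_lt => e e0.
have er : e = ((complex.Re e)%:C)%C by rewrite RRe_real// ger0_real// ltW.
have /h : 0 < complex.Re e by rewrite -ltcR -er.
by apply: filterS => t; rewrite hnormE er ltcR hnormBC.
Qed.

Lemma hnorm_cvg0P (X : Type) (F : set_system X) {FF : Filter F} (u : X -> V) l :
  u @ F --> l <-> hnorm (u t - l) @[t --> F] --> (0 : R).
Proof.
rewrite hnorm_cvgP; split=> [h|/cvgrPdist_lt h e e0].
  apply/cvgrPdist_lt => e e0; apply: filterS (h _ e0) => t.
  by rewrite sub0r normrN ger0_norm ?hnorm_ge0.
by apply: filterS (h _ e0) => t; rewrite sub0r normrN ger0_norm ?hnorm_ge0.
Qed.

Lemma hnorm_cauchy (u : nat -> V) :
  (forall e, 0 < e -> exists N, forall m n, (N <= m)%N -> (N <= n)%N ->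
     hnorm (u m - u n) < e) -> exists l, u @ \oo --> l.
Proof.
move=> h; suff : cvg (u @ \oo) by move=> /cvg_ex.
apply: cauchy_cvg; apply: cauchy_exP => e e0.
have er : e = ((complex.Re e)%:C)%C by rewrite RRe_real// ger0_real// ltW.
have /h[N hN] : 0 < complex.Re e by rewrite -ltcR -er.
exists (u N), N => // n /= Nn.
by rewrite -ball_normE /ball_/= hnormE er ltcR hN.
Qed.

Lemma cvg_rinner (X : Type) (F : set_system X) {FF : Filter F} (u v : X -> V) x y :
  u @ F --> x -> v @ F --> y -> rinner (u t) (v t) @[t --> F] --> rinner x y.
Proof.
move=> /hnorm_cvg0P ux /hnorm_cvg0P vy; apply/cvgrPdist_le => /= e e0.
have h := cvgD (cvgM ux vy) (cvgD (cvgMr_tmp (b := hnorm y) ux) (cvgMl_tmp (a := hnorm x) vy)).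
move: (h FF FF FF FF FF); rewrite !mul0r mulr0 !addr0 => /cvgrPdist_le /(_ e e0); apply: filterS => t /=.
rewrite !fctE sub0r normrN ger0_norm; last by rewrite ?addr_ge0 ?mulr_ge0 ?hnorm_ge0.
apply: le_trans; rewrite distrC.
have -> : rinner (u t) (v t) - rinner x y = rinner (u t - x) (v t - y)
   + (rinner (u t - x) y + rinner x (v t - y)).
  by rewrite !rinnerE; ring.
apply: le_trans (ler_normD _ _) _; apply: lerD; first exact: rinner_le.
by apply: le_trans (ler_normD _ _) _; apply: lerD; exact: rinner_le.
Qed.

Lemma cvg_hnorm (X : Type) (F : set_system X) {FF : Filter F} (u : X -> V) x :
  u @ F --> x -> hnorm (u t) @[t --> F] --> hnorm x.
Proof.
move=> /hnorm_cvgP h; apply/cvgrPdist_lt => e /h; apply: filterS => t.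
by rewrite distrC; apply: le_lt_trans; exact: hnorm_distr.
Qed.

Lemma cvgr_ub (X : Type) (F : set_system X) {FF : ProperFilter F} (g : X -> R) a b :
  g @ F --> a -> (\forall t \near F, g t <= b) -> a <= b.
Proof.
by move=> ga gb; rewrite -(cvg_lim (@Rhausdorff R) ga); apply: limr_le => //; apply: cvgP ga.
Qed.

Lemma cvg_lipschitz (X : Type) (F : set_system X) {FF : Filter F} (u : X -> V) x
    (A : V -> V) a :
  (forall y z, hnorm (A y - A z) <= a * hnorm (y - z)) ->
  u @ F --> x -> A (u t) @[t --> F] --> A x.
Proof.
move=> hA /hnorm_cvgP h; apply/hnorm_cvgP => e e0.
have a0 : 0 < `|a| + 1 by rewrite ltr_wpDl.
have /h : 0 < e / (`|a| + 1) by rewrite divr_gt0.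
apply: filterS => t; rewrite ltr_pdivlMr// => h1; apply: le_lt_trans (hA _ _) _.
apply: le_lt_trans h1; rewrite mulrC ler_wpM2l ?hnorm_ge0//.
by apply: le_trans (ler_norm a) _; rewrite lerDl.
Qed.

Lemma hilbert_cvg_unique (u : nat -> V) x y : u @ \oo --> x -> u @ \oo --> y -> x = y.
Proof. by move=> ux uy; apply: (cvg_unique _ ux uy). Qed.

Lemma hnorm_small x : (forall e, 0 < e -> hnorm x <= e) -> x = 0.
Proof.
move=> h; apply: hnorm_eq0; apply/eqP; rewrite eq_le hnorm_ge0 andbT.
by apply/ler_addgt0Pl => e e0; rewrite addr0 h.
Qed.

Lemma dense_hnorm (D : set V) : dense D -> forall x e, 0 < e ->
  exists2 y, D y & hnorm (x - y) < e.
Proof.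
move=> dD x e e0; have e1 : 0 < (e%:C)%C by rewrite ltcR.
have [||y [yb Dy]] := dD (ball x (e%:C)%C).
- by exists x; exact: ballxx.
- exact: ball_open.
- by exists y => //; move: yb; rewrite -ball_normE /ball_/= hnormE ltcR.
Qed.

Lemma dense_rinner0 (D : set V) x : dense D -> (forall y, D y -> rinner x y = 0) -> x = 0.
Proof.
move=> /dense_hnorm dD h; apply: hnorm_small => e e0.
apply: hnorm_le_rinner; first exact: ltW.
move=> z; have [z0|z0] := eqVneq (hnorm z) 0.
  by rewrite (hnorm_eq0 z0) rinner0r hnorm0 mulr0.
have z1 : 0 < hnorm z by rewrite lt_def z0 hnorm_ge0.
have x1 : 0 < hnorm x + 1 by rewrite ltr_wpDl// hnorm_ge0.
have [|y Dy yz] := dD z (e * hnorm z / (hnorm x + 1)).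
  by rewrite divr_gt0// mulr_gt0.
have -> : rinner x z = rinner x (z - y) by rewrite !rinnerE (h y Dy); ring.
apply: le_trans (ler_norm _) _; apply: le_trans (rinner_le _ _) _.
move: yz; rewrite ltr_pdivlMr// => yz; have := hnorm_ge0 x; have := hnorm_ge0 (z - y); nra.
Qed.

End Convergence.

(** * Minimisation over a closed subspace *)

Section Riesz.
Context {R : realType} {V : hilbertType R}.
Implicit Types (x y z l : V) (a e : R).

(* [p] minimises [|x|^2 - 2 ell x] over the closed subspace [M].  With [M] the whole space this is
   the Riesz theorem, with [ell = rinner y] it is the orthogonal projection of [y] on [M]. *)
Lemma riesz_subspace (M : set V) (ell : V -> R) a :
  M 0 -> (forall c x y, M x -> M y -> M ((c%:C)%C *: x + y)) ->
  (forall (u : nat -> V) x, (forall n, M (u n)) -> u @ \oo --> x -> M x) ->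
  (forall c x y, ell ((c%:C)%C *: x + y) = c * ell x + ell y) ->
  (forall x, ell x <= a * hnorm x) ->
  exists2 p, M p & forall x, M x -> rinner p x = ell x.
Proof.
move=> M0 ML Mc ellL ella.
pose F x := hnorm x ^+ 2 - 2 * ell x.
have ell0 : ell 0 = 0.
  by have := ellL (-1) 0 0; rewrite scaler0 addr0 => h; lra.
have Flb x : - a ^+ 2 <= F x.
  rewrite /F; have := ella x; have := sqr_ge0 (hnorm x - a); rewrite sqrrB => h1 h2; nra.
pose S := [set F x | x in M].
have hS : has_inf S.
  split; first by exists (F 0), 0.
  by exists (- a ^+ 2) => _ [x _ <-].
pose d := inf S.
have dF x : M x -> d <= F x by move=> Mx; apply: ge_inf; [case: hS|exists x].
have ex n : exists x, M x /\ F x < d + n.+1%:R^-1.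
  have n1 : 0 < n.+1%:R^-1 :> R by rewrite invr_gt0.
  have [_ [x Mx <-] h] := inf_adherent n1 hS.
  by exists x.
have [u hu] := choice ex.
have M2 x y : M x -> M y -> M (((2^-1)%:C)%C *: (x + y)).
  move=> Mx My; have -> : ((2^-1)%:C)%C *: (x + y)
     = ((2^-1)%:C)%C *: x + (((2^-1)%:C)%C *: y + 0) by rewrite addr0 scalerDr.
  by apply: (ML) => //; apply: ML.
(* The midpoint of [x] and [y] is in [M], so [F] is at least [d] there; the parallelogram law then
   makes a minimising sequence Cauchy. *)
have par x y : M x -> M y -> hnorm (x - y) ^+ 2 <= 2 * (F x - d) + 2 * (F y - d).
  move=> Mx My; have := dF _ (M2 _ _ Mx My); have := parallelogram x y.
  have e1 : ell (((2^-1)%:C)%C *: (x + y)) = 2^-1 * (ell x + ell y).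
    by have := ellL (2^-1) (x + y) 0; have := ellL 1 x y;
       rewrite addr0 ell0 rmorph1 scale1r => -> ->; ring.
  rewrite /F hnormZ e1 exprMn; have -> : `|2^-1 : R| ^+ 2 = 4^-1 by rewrite real_normK ?num_real//; field.
  by move=> h1 h2; lra.
have [|p hp] := @hnorm_cauchy R V u.
  move=> e e0; have e2 : 0 < e ^+ 2 / 4 by rewrite divr_gt0// exprn_gt0.
  have [N hN] := invS_lt e2; exists N => m n Nm Nn.
  have hb k : (N <= k)%N -> F (u k) - d < e ^+ 2 / 4.
    by move=> Nk; have [_] := hu k; rewrite -ltrBlDl => /lt_trans; apply; exact: hN.
  rewrite -(ltr_pXn2r (_ : 0 < 2)%N) ?nnegrE ?hnorm_ge0 ?ltW//.
  apply: le_lt_trans (par _ _ (hu m).1 (hu n).1) _.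
  by have := hb m Nm; have := hb n Nn; move=> h1 h2; lra.
have Mp : M p by apply: Mc hp => n; case: (hu n).
have lipell x y : `|ell x - ell y| <= a * hnorm (x - y).
  have e x' y' : ell (x' - y') = ell x' - ell y'.
    by have := ellL (-1) y' x'; rewrite rmorphN1 scaleN1r addrC => ->; ring.
  rewrite ler_norml -e ella andbT; have := ella (y - x).
  by rewrite hnormBC !e => h; lra.
have Fp : F p <= d.
  apply/ler_addgt0Pl => e e0.
  have cF : F (u n) @[n --> \oo] --> F p.
    apply: cvgB; first by rewrite expr2; apply: cvgM; exact: cvg_hnorm.
    apply: cvgMr; apply/cvgrPdist_le => e' e'0.
    have a1 : 0 < `|a| + 1 by rewrite ltr_wpDl.
    move/hnorm_cvgP: hp => /(_ (e' / (`|a| + 1))); rewrite divr_gt0// => /(_ isT).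
    apply: filterS => n; rewrite ltr_pdivlMr// => h; apply: le_trans (lipell _ _) _.
    rewrite hnormBC; have := hnorm_ge0 (u n - p); have := ler_norm a; nra.
  apply: cvgr_ub cF _; have [N hN] := invS_lt e0; exists N => // n /= Nn.
  by have [_ /ltW/le_trans] := hu n; apply; rewrite addrC lerD2r ltW// hN.
exists p => // x Mx.
(* First variation: [p + t x] cannot do better than [p]. The parameter chosen below is the minimiser
   of this quadratic in [t], with [rinner x x + 1] in place of [rinner x x] so that [x = 0] needs no
   separate case. *)
have key t : 0 <= 2 * t * (rinner p x - ell x) + t ^+ 2 * rinner x x.
  have := dF _ (ML t _ _ Mx Mp); move/(le_trans Fp).
  by rewrite /F ellL !hnorm_sq !rinnerE (rinnerC x p) => h; lra.
have x0 := rinner_ge0 x.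
have := key (- (rinner p x - ell x) / (rinner x x + 1)).
set b := rinner p x - ell x; set c := rinner x x.
have c0 : 0 < c + 1 by rewrite ltr_wpDl.
have -> : 2 * (- b / (c + 1)) * b + (- b / (c + 1)) ^+ 2 * c = - (b ^+ 2 * ((c + 2) / (c + 1) ^+ 2)).
  by field; rewrite gt_eqF.
rewrite oppr_ge0 => h.
have {}h : b ^+ 2 <= 0.
  by rewrite -(pmulr_lle0 _ (_ : 0 < (c + 2) / (c + 1) ^+ 2))// divr_gt0 ?exprn_gt0//; lra.
apply/eqP; rewrite -subr_eq0 -/b -sqrf_eq0 eq_le h sqr_ge0//.
Qed.

End Riesz.

(** * Resolvents and Yosida approximations *)

Section Operators.
Local Open Scope complex_scope.
Context {R : realType} {V : hilbertType R}.
Implicit Types (x y z : V) (a s t : R) (A : V -> V).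

Lemma scale_ii x : 'i *: ('i *: x) = - x :> V.
Proof.
rewrite scalerA -[RHS]scaleN1r; congr (_ *: _).
by apply/eqP; rewrite eq_complex /=; apply/andP; split; apply/eqP; ring.
Qed.

(** Pairing with an arbitrary vector turns an identity between vectors into one between reals,
    within reach of [ring] or [field]. *)
Ltac vec := apply: rinner_ext => ?; rewrite ?(rinner_il, scale_ii, rinnerE).

Lemma scale_iC a x : 'i *: (a%:C *: x) = a%:C *: ('i *: x) :> V.
Proof. by rewrite !scalerA mulrC. Qed.

Lemma linearP_i A : linear A -> forall x, A ('i *: x) = 'i *: A x.
Proof.
move=> lA x; have A0 : A 0 = 0 by have := lA (-1) 0 0; rewrite scaleN1r addNr scaleN1r addNr.
by have := lA 'i x 0; rewrite A0 !addr0.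
Qed.

Lemma linear_op0 A : linear A -> A 0 = 0.
Proof. by move=> lA; have := lA (-1) 0 0; rewrite scaleN1r addNr scaleN1r addNr. Qed.

Lemma linear_opZ A : linear A -> forall (a : R[i]) x, A (a *: x) = a *: A x.
Proof. by move=> lA a x; have := lA a x 0; rewrite (linear_op0 lA) !addr0. Qed.

Lemma linear_opD A : linear A -> forall x y, A (x + y) = A x + A y.
Proof. by move=> lA x y; have := lA 1 x y; rewrite !scale1r. Qed.

Lemma linear_opN A : linear A -> forall x, A (- x) = - A x.
Proof. by move=> lA x; rewrite -scaleN1r linear_opZ// scaleN1r. Qed.

Lemma linear_opB A : linear A -> forall x y, A (x - y) = A x - A y.
Proof. by move=> lA x y; rewrite linear_opD// linear_opN. Qed.

Lemma bounded_cvg A a (X : Type) (F : set_system X) {FF : Filter F} (u : X -> V) x :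
  linear A -> (forall y, hnorm (A y) <= a * hnorm y) ->
  u @ F --> x -> A (u t) @[t --> F] --> A x.
Proof.
by move=> lA bA; apply: cvg_lipschitz => y z; rewrite -linear_opB//; exact: bA.
Qed.

Section Resolvent.
Variables (D : set V) (H : V -> V).
Hypothesis selfH : selfadjoint D H.

Lemma sa_dense : dense D. Proof. by case: selfH => -[]. Qed.
Lemma sa_D0 : D 0. Proof. by case: selfH => -[]. Qed.
Lemma sa_DZD (c : R[i]) x y : D x -> D y -> D (c *: x + y).
Proof. by case: selfH => -[? ? h _ _]; exact: h. Qed.
Lemma sa_HZD (c : R[i]) x y : D x -> D y -> H (c *: x + y) = c *: H x + H y.
Proof. by case: selfH => -[? ? _ h _]; exact: h. Qed.

Lemma sa_H0 : H 0 = 0.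
Proof.
by have := sa_HZD (-1) sa_D0 sa_D0; rewrite scaleN1r addNr scaleN1r addNr.
Qed.

Lemma sa_DZ (c : R[i]) x : D x -> D (c *: x).
Proof. by move=> Dx; rewrite -[X in D X]addr0; exact: sa_DZD sa_D0. Qed.

Lemma sa_HZ (c : R[i]) x : D x -> H (c *: x) = c *: H x.
Proof. by move=> Dx; rewrite -[c *: x]addr0 sa_HZD ?sa_H0 ?addr0//; exact: sa_D0. Qed.

Lemma sa_DD x y : D x -> D y -> D (x + y).
Proof. by move=> Dx Dy; rewrite -[x]scale1r; exact: sa_DZD. Qed.

Lemma sa_HD x y : D x -> D y -> H (x + y) = H x + H y.
Proof. by move=> Dx Dy; rewrite -[x]scale1r sa_HZD// !scale1r. Qed.

Lemma sa_DB x y : D x -> D y -> D (x - y).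
Proof. by move=> Dx Dy; apply: sa_DD => //; rewrite -scaleN1r; exact: sa_DZ. Qed.

Lemma sa_HB x y : D x -> D y -> H (x - y) = H x - H y.
Proof. by move=> Dx Dy; rewrite -(scaleN1r y) sa_HD ?sa_HZ//; [rewrite scaleN1r|exact: sa_DZ]. Qed.

Lemma sa_sym x y : D x -> D y -> rinner (H x) y = rinner x (H y).
Proof.
move=> Dx Dy; have [_ /(_ y (H y))[_ h]] := selfH.
by rewrite /rinner h.
Qed.

(** This is the imaginary part of [inner (H x) x], which is real by symmetry. The same cancellation
    is behind the resolvent bounds and the energy identity. *)
Lemma sa_im x : D x -> rinner (H x) ('i *: x) = 0.
Proof.
move=> Dx; have := sa_sym Dx (sa_DZ 'i Dx); rewrite sa_HZ// => h.
have : rinner x ('i *: H x) = - rinner (H x) ('i *: x) by rewrite rinnerC rinner_il.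
by move=> h1; lra.
Qed.

(** Membership in the domain of the adjoint concerns the complex pairing; applying the real
    hypothesis to ['i *: x] as well supplies the imaginary part. *)
Lemma sa_adjoint y z : (forall x, D x -> rinner (H x) y = rinner x z) -> D y /\ H y = z.
Proof.
move=> h; have [_ /(_ y z)[+ _]] := selfH.
case=> [x Dx|Dy ->//]; rewrite !innerE h//; congr Complex.
have := h _ (sa_DZ 'i Dx); rewrite sa_HZ// !rinner_il; lra.
Qed.

Lemma sa_closed (u : nat -> V) x z : (forall n, D (u n)) ->
  u @ \oo --> x -> H (u n) @[n --> \oo] --> z -> D x /\ H x = z.
Proof.
move=> Du ux Hz; apply: sa_adjoint => y Dy.
have h1 : rinner (H y) (u n) @[n --> \oo] --> rinner (H y) x.
  by apply: cvg_rinner => //; exact: cvg_cst.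
have h2 : rinner (H y) (u n) @[n --> \oo] --> rinner y z.
  under eq_fun do rewrite sa_sym//.
  by apply: cvg_rinner => //; exact: cvg_cst.
exact: (cvg_unique (@Rhausdorff R) h1 h2).
Qed.

Definition shifted s x := x - (s^-1)%:C *: ('i *: H x).

Lemma shiftedB s x y : D x -> D y -> shifted s (x - y) = shifted s x - shifted s y.
Proof. by move=> Dx Dy; rewrite /shifted sa_HB//; vec; ring. Qed.

(** Pythagoras: the cross term is a multiple of the quantity killed by [sa_im]. Both [x] and [H x]
    are thereby controlled by [shifted s x], which gives injectivity and, with [sa_closed], a closed
    range. *)
Lemma hnorm_shifted s x : D x -> s != 0 ->
  hnorm (shifted s x) ^+ 2 = hnorm x ^+ 2 + s^-1 ^+ 2 * hnorm (H x) ^+ 2.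
Proof.
move=> Dx s0; have h := sa_im Dx.
rewrite /shifted !hnorm_sq !rinnerE rinner_ii (rinnerC x) rinner_il h; ring.
Qed.

Lemma hnorm_le_shifted s x : D x -> s != 0 -> hnorm x <= hnorm (shifted s x).
Proof.
move=> Dx s0; rewrite -(ler_pXn2r (_ : 0 < 2)%N) ?nnegrE ?hnorm_ge0//.
by rewrite hnorm_shifted// lerDl mulr_ge0 ?sqr_ge0.
Qed.

Lemma hnorm_H_le_shifted s x : D x -> s != 0 -> hnorm (H x) <= `|s| * hnorm (shifted s x).
Proof.
move=> Dx s0; rewrite -(ler_pXn2r (_ : 0 < 2)%N) ?nnegrE ?mulr_ge0 ?hnorm_ge0//.
rewrite exprMn hnorm_shifted// mulrDr real_normK ?num_real//.
by rewrite (mulrA (s ^+ 2) (s^-1 ^+ 2)) exprVn divff ?sqrf_eq0// mul1r lerDr mulr_ge0 ?sqr_ge0.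
Qed.

(** The range is a closed subspace, so [y] has a projection [p] on it; the remainder [q] is
    orthogonal to the range and turns out to be 0. *)
Lemma shifted_surj s y : s != 0 -> exists2 x, D x & shifted s x = y.
Proof.
move=> s0; pose M := [set shifted s x | x in D].
have [|||||p [x Dx xp] hp] := @riesz_subspace R V M (rinner y) (hnorm y).
- by exists 0; [exact: sa_D0|rewrite /shifted sa_H0 !scaler0 subr0].
- move=> c _ _ [x Dx <-] [z Dz <-]; exists (c%:C *: x + z); first exact: sa_DZD.
  by rewrite /shifted sa_HZD//; vec; ring.
- move=> u z uM uz.
  have /choice[w hw] : forall n, exists x, D x /\ shifted s x = u n.
    by move=> n; have [x Dx xn] := uM n; exists x.
  have wc n m : hnorm (w n - w m) <= hnorm (u n - u m).
    rewrite -(hw n).2 -(hw m).2 -shiftedB; [|by case: (hw n)|by case: (hw m)].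
    by apply: hnorm_le_shifted => //; apply: sa_DB; [case: (hw n)|case: (hw m)].
  have Hc n m : hnorm (H (w n) - H (w m)) <= `|s| * hnorm (u n - u m).
    rewrite -(hw n).2 -(hw m).2 -shiftedB; [|by case: (hw n)|by case: (hw m)].
    rewrite -sa_HB; [|by case: (hw n)|by case: (hw m)].
    by apply: hnorm_H_le_shifted => //; apply: sa_DB; [case: (hw n)|case: (hw m)].
  have uc e : 0 < e -> exists N, forall m n, (N <= m)%N -> (N <= n)%N -> hnorm (u m - u n) < e.
    move=> e0; have e2 : 0 < e / 2 by rewrite divr_gt0.
    move/hnorm_cvgP: uz => /(_ _ e2)[N _ hN]; exists N => m n Nm Nn.
    have := hN _ Nm; have := hN _ Nn; have := hnorm_dist z (u m) (u n).
    by rewrite /= (hnormBC z) => h1 h2 h3; lra.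
  have [e e0|x wx] := @hnorm_cauchy R V w.
    by have [N hN] := uc e e0; exists N => m n Nm Nn; apply: le_lt_trans (wc _ _) (hN _ _ Nm Nn).
  have [e e0|v Hv] := @hnorm_cauchy R V (H \o w).
    have s1 : 0 < `|s| by rewrite normr_gt0.
    have [|N hN] := uc (e / `|s|); first by rewrite divr_gt0.
    exists N => m n Nm Nn; apply: le_lt_trans (Hc _ _) _.
    by rewrite mulrC -ltr_pdivlMr// hN.
  have [Dx Hx] := @sa_closed w x v (fun n => (hw n).1) wx Hv.
  exists x => //; apply: (hilbert_cvg_unique _ uz).
  have -> : u = (fun n => shifted s (w n)) by apply/funext => n; case: (hw n).
  by rewrite /shifted; apply: cvgB => //; rewrite Hx; do 2 apply: cvgZl_tmp.
- by move=> c x z; rewrite !rinnerE.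
- by move=> x; apply: le_trans (ler_norm _) (rinner_le _ _).
have [q [qE qM]] : exists q, q = y - p /\ forall z, D z -> rinner (shifted s z) q = 0.
  exists (y - p); split=> // z Dz.
  by rewrite rinnerC rinnerDl rinnerNl hp ?subrr//; exists z.
(* Orthogonality to the range says that ['i *: q] is in the domain of the adjoint, hence of [H], and
   satisfies the eigenvalue equation for the nonreal number [i s]; [sa_im] then forces [q = 0]. *)
have [|Dq Hq] := @sa_adjoint ('i *: q) ((- s)%:C *: q).
  move=> z Dz; have := qM z Dz; rewrite /shifted !rinnerE rinner_il => h.
  by have -> : rinner z q = - (s^-1 * rinner (H z) ('i *: q)); [lra|field].
have := sa_im Dq; rewrite Hq scale_ii !rinnerE => h.
have /rinner_eq0 q0 : rinner q q = 0.
  by apply: (mulfI s0); lra.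
by exists x => //; rewrite xp; apply/esym/eqP; rewrite -subr_eq0 -qE q0.
Qed.

(* [(1 - i H / s)^-1], for a nonzero real [s] of either sign. *)
Definition resolvent s y := xget 0 [set x | D x /\ shifted s x = y].

Local Notation J := resolvent.

Lemma resolventP s y : s != 0 -> D (J s y) /\ shifted s (J s y) = y.
Proof.
move=> s0; rewrite /J; case: xgetP => [x -> //|h].
by have [x Dx xy] := shifted_surj y s0; case: (h x).
Qed.

Lemma resolvent_D s y : s != 0 -> D (J s y).
Proof. by move=> s0; have [] := resolventP y s0. Qed.

Lemma resolvent_uniq s x : s != 0 -> D x -> J s (shifted s x) = x.
Proof.
move=> s0 Dx; have [Dj hj] := resolventP (shifted s x) s0.
apply/eqP; rewrite -subr_eq0; apply/eqP/hnorm_eq0/eqP; rewrite eq_le hnorm_ge0 andbT.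
apply: le_trans (hnorm_le_shifted (sa_DB Dj Dx) s0) _.
by rewrite shiftedB// hj subrr hnorm0.
Qed.

Lemma resolvent_linear s : s != 0 -> linear (J s).
Proof.
move=> s0 c x y; have [Dx hx] := resolventP x s0; have [Dy hy] := resolventP y s0.
rewrite -{1}hx -{1}hy.
have -> : c *: shifted s (J s x) + shifted s (J s y) = shifted s (c *: J s x + J s y).
  rewrite /shifted sa_HZD// !scalerDr !scalerN !scalerA !opprD.
  rewrite addrACA; congr (_ + (- (_ *: _) + _)); ring.
by rewrite resolvent_uniq//; exact: sa_DZD.
Qed.

Lemma resolvent_le s y : s != 0 -> hnorm (J s y) <= hnorm y.
Proof.
move=> s0; have [Dx hx] := resolventP y s0; rewrite -{2}hx.
exact: hnorm_le_shifted.
Qed.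

Lemma H_resolvent s y : s != 0 -> H (J s y) = s%:C *: ('i *: (y - J s y)).
Proof.
move=> s0; have [Dx hx] := resolventP y s0; rewrite -{2}hx /shifted.
by vec; field.
Qed.

Lemma resolvent_H s x : s != 0 -> D x -> J s (H x) = H (J s x).
Proof.
move=> s0 Dx; have Dj := resolvent_D x s0.
have DH : D (H (J s x)) by rewrite H_resolvent//; do 2 apply: sa_DZ; exact: sa_DB.
rewrite -[RHS](resolvent_uniq s0)//; congr (J s _).
rewrite /shifted {2}H_resolvent// !sa_HZ ?sa_HB//; last 2 first.
- exact: sa_DB.
- by apply: sa_DZ; exact: sa_DB.
by vec; field.
Qed.

Lemma resolventC s t y : s != 0 -> t != 0 -> J s (J t y) = J t (J s y).
Proof.
move=> s0 t0; have [Dx hx] := resolventP y s0.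
have DJ := resolvent_D (J s y) t0.
rewrite -[RHS](resolvent_uniq s0)//; congr (J s _).
rewrite /shifted -resolvent_H// -{1}hx /shifted linear_opB ?(linear_opZ (resolvent_linear t0))//.
exact: resolvent_linear.
Qed.

(** The adjoint of [(1 - i H / s)^-1] is [(1 + i H / s)^-1]; this is one reason to admit negative
    [s]. *)
Lemma resolvent_adj s x y : s != 0 -> rinner (J s x) y = rinner x (J (- s) y).
Proof.
move=> s0; have ns0 : - s != 0 by rewrite oppr_eq0.
have [Dx hx] := resolventP x s0; have [Dy hy] := resolventP y ns0.
rewrite -{2}hx -{1}hy /shifted invrN.
set a := J s x; set b := J (- s) y; rewrite !rinnerE rinner_il.
have -> : rinner a ('i *: H b) = rinner (H a) ('i *: b); last by ring.
apply: oppr_inj; rewrite -!rinner_il -sa_HZ//; apply/esym/sa_sym => //.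
exact: sa_DZ.
Qed.

Lemma resolvent_dist s x : s != 0 -> D x -> hnorm (J s x - x) <= `|s|^-1 * hnorm (H x).
Proof.
move=> s0 Dx; have -> : J s x - x = (s^-1)%:C *: ('i *: J s (H x)).
  by rewrite resolvent_H// H_resolvent//; vec; field.
by rewrite hnormZ hnormI normfV ler_wpM2l ?invr_ge0 ?resolvent_le.
Qed.

(** Contractivity plus density: on [D] the error is at most [hnorm (H y) / (n + 1)]. The sign of
    [r n] is left free because the Yosida approximation uses resolvents of both signs. *)
Lemma resolvent_cvg (r : nat -> R) x : (forall n, `|r n| = n.+1%:R) ->
  J (r n) x @[n --> \oo] --> x.
Proof.
move=> hr; have r0 n : r n != 0 by rewrite -normr_eq0 hr.
apply/hnorm_cvgP => e e0; have e3 : 0 < e / 3 by rewrite divr_gt0.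
have [y Dy xy] := dense_hnorm sa_dense x e3.
have [|N hN] := @invS_lt R ((e / 3) / (hnorm (H y) + 1)).
  by rewrite divr_gt0// ltr_wpDl// hnorm_ge0.
exists N => // n /= Nn.
have h1 := resolvent_dist (r0 n) Dy; rewrite hr in h1.
have := hN n Nn; rewrite ltr_pdivlMr; last by rewrite ltr_wpDl// hnorm_ge0.
have h2 := resolvent_le (x - y) (r0 n).
rewrite linear_opB in h2; last exact: resolvent_linear.
have := hnorm_dist (J (r n) y) (J (r n) x) x.
have := hnorm_dist y (J (r n) y) x; rewrite (hnormBC y x).
have i0 : 0 < n.+1%:R^-1 :> R by rewrite invr_gt0.
move: h1 h2 i0; set i := n.+1%:R^-1 => h1 h2 i0 h3 h4 h5; have := hnorm_ge0 (H y); nra.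
Qed.

(** This is [H (1 + H^2 / s^2)^-1], written with bounded operators only. Taking both signs of [s]
    makes it symmetric, which [H] composed with a single resolvent need not be. *)
Definition yosida s x := (s / 2)%:C *: ('i *: (J (- s) x - J s x)).

Local Notation Y := yosida.

Lemma yosida_linear s : s != 0 -> linear (Y s).
Proof.
move=> s0 c x y; rewrite /Y !resolvent_linear ?oppr_eq0// opprD addrACA -scalerBr.
move: (J (- s) x - J s x) (J (- s) y - J s y) => v w.
rewrite [in LHS]scalerDr [in LHS]scalerDr; congr (_ + _).
by rewrite !scalerA; congr (_ *: _); ring.
Qed.

Lemma yosida_le s x : s != 0 -> hnorm (Y s x) <= `|s| * hnorm x.
Proof.
move=> s0; rewrite hnormZ hnormI.
have := resolvent_le x s0; have := resolvent_le x (s := - s); rewrite oppr_eq0 => /(_ s0) h1 h2.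
have := hnormB (J (- s) x) (J s x); rewrite normrM (ger0_norm (_ : 0 <= 2^-1))// => h3.
by have := normr_ge0 s; nra.
Qed.

Lemma yosida_sym s x y : s != 0 -> rinner (Y s x) y = rinner x (Y s y).
Proof.
move=> s0; rewrite /Y !rinnerE rinner_il !rinnerE.
rewrite !resolvent_adj ?oppr_eq0// opprK.
rewrite !linear_opZ//; try exact: resolvent_linear.
by rewrite scalerDr scalerN rinnerDr rinnerNr; ring.
by apply: resolvent_linear; rewrite oppr_eq0.
Qed.

Lemma yosida_resolvent s t x : s != 0 -> t != 0 -> Y s (J t x) = J t (Y s x).
Proof.
move=> s0 t0; have lt := resolvent_linear t0.
by rewrite /Y !(linear_opZ lt) (linear_opB lt) !(resolventC _ _ t0) ?oppr_eq0.
Qed.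

Lemma yosida_H s x : s != 0 -> D x ->
  Y s x = (2^-1)%:C *: (J s (H x) + J (- s) (H x)).
Proof.
move=> s0 Dx; have ns0 : - s != 0 by rewrite oppr_eq0.
rewrite !resolvent_H// !H_resolvent// /Y; by vec; field.
Qed.

Lemma yosida_le_H s x : s != 0 -> D x -> hnorm (Y s x) <= hnorm (H x).
Proof.
move=> s0 Dx; have ns0 : - s != 0 by rewrite oppr_eq0.
rewrite yosida_H// hnormZ ger0_norm//.
have := resolvent_le (H x) s0; have := resolvent_le (H x) ns0.
have := hnormD (J s (H x)) (J (- s) (H x)); lra.
Qed.

Lemma yosida_cvg x : D x -> Y n.+1%:R x @[n --> \oo] --> H x.
Proof.
move=> Dx; under eq_fun do rewrite yosida_H//.
have e : H x = (2^-1)%:C *: (H x + H x) by vec; field.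
rewrite {1}e.
apply: cvgZl_tmp; apply: cvgD; apply: resolvent_cvg => n; rewrite ?normrN ger0_norm//.
Qed.

Lemma yosida_dist s x : s != 0 -> D x -> D (H x) ->
  hnorm (Y s x - H x) <= `|s|^-1 * hnorm (H (H x)).
Proof.
move=> s0 Dx DHx; have ns0 : - s != 0 by rewrite oppr_eq0.
have := resolvent_dist s0 DHx; have := resolvent_dist ns0 DHx; rewrite normrN.
have -> : Y s x - H x = (2^-1)%:C *: ((J s (H x) - H x) + (J (- s) (H x) - H x)).
  by rewrite yosida_H//; vec; field.
rewrite hnormZ (ger0_norm (_ : 0 <= 2^-1))// => h1 h2.
by have := hnormD (J s (H x) - H x) (J (- s) (H x) - H x); lra.
Qed.

Lemma H_resolvent_le s y : s != 0 -> hnorm (H (J s y)) <= (2 * `|s|) * hnorm y.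
Proof.
move=> s0; rewrite H_resolvent// hnormZ hnormI.
have := hnormB y (J s y); have := resolvent_le y s0; have := normr_ge0 s; nra.
Qed.

(** Two resolvents put [y] in the domain of [H^2], where [yosida s] approaches [H] at rate
    [1 / |s|]; each of the two applications of [H] costs a factor [2 |t|]. Comparing both
    approximations with [H] adds the two rates. *)
Lemma yosida_diff s s' t y : s != 0 -> s' != 0 -> t != 0 ->
  hnorm (Y s (J t (J t y)) - Y s' (J t (J t y)))
    <= (`|s|^-1 + `|s'|^-1) * ((2 * `|t|) ^+ 2 * hnorm y).
Proof.
move=> s0 s'0 t0; set x := J t (J t y).
have Dx : D x by exact: resolvent_D.
have Hx : H x = J t (H (J t y)) by rewrite /x resolvent_H//; exact: resolvent_D.
have DHx : D (H x) by rewrite Hx; exact: resolvent_D.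
have HH : hnorm (H (H x)) <= (2 * `|t|) ^+ 2 * hnorm y.
  rewrite Hx; apply: le_trans (H_resolvent_le _ t0) _.
  rewrite expr2 -[leRHS]mulrA; apply: ler_wpM2l; first by rewrite mulr_ge0.
  exact: H_resolvent_le.
apply: le_trans (hnorm_dist (H x) _ _) _; rewrite (hnormBC (H x)) mulrDl.
apply: lerD; apply: le_trans (yosida_dist _ Dx DHx) _ => //;
  by rewrite ler_wpM2l ?invr_ge0.
Qed.

End Resolvent.

Lemma symmetric_selfadjoint A : linear A -> (forall x y, rinner (A x) y = rinner x (A y)) ->
  selfadjoint [set: V] A.
Proof.
move=> lA sA; split.
  split => //; first by move=> O [x Ox] _; exists x.
  by move=> *; exact: lA.
have iA x y : inner (A x) y = inner x (A y).
  by rewrite !innerE sA sA (linear_opZ lA).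
move=> y z; split => [h|[_ ->] x _]; last exact: iA.
split=> //; apply: rinner_ext => x; rewrite rinnerC /rinner -h// iA -/(rinner _ _) rinnerC.
by [].
Qed.

End Operators.

(** * Measurability and L2 *)

Section FinitelyValued.
Context {R : realType}.

(** [simple_fun] with an arbitrary target, so that time grids, [nat] indices and real integrands can
    be combined with simple functions into [V]. *)
Definition finitely_valued (X : Type) (s : R -> X) : Prop :=
  finite_set (range s) /\ forall x, measurable (s @^-1` [set x]).

Lemma finitely_valued2 (X Y Z : Type) (F : X -> Y -> Z) s1 s2 :
  finitely_valued s1 -> finitely_valued s2 -> finitely_valued (fun t => F (s1 t) (s2 t)).
Proof.
move=> [f1 m1] [f2 m2]; split.
  by apply: sub_finite_set (finite_image2 F f1 f2) => _ [t _ <-]; exists (s1 t) => //; exists (s2 t).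
move=> z.
have -> : (fun t => F (s1 t) (s2 t)) @^-1` [set z] =
   \bigcup_(p in (range s1 `*` range s2) `&` [set p | F p.1 p.2 = z])
      (s1 @^-1` [set p.1] `&` s2 @^-1` [set p.2]).
  apply/seteqP; split=> [t /= tz|t [[a b] [_ /= <-]] /= [-> ->]//].
  by exists (s1 t, s2 t) => //; split => //; split; exists t.
apply: fin_bigcup_measurable => [|p _]; last exact: measurableI.
by apply: sub_finite_set (finite_setX f1 f2) => p [].
Qed.

Lemma finitely_valued_cst (X : Type) (x : X) : finitely_valued (fun=> x).
Proof.
split; first by apply: sub_finite_set (finite_set1 x) => _ [t _ <-].
move=> y; have [->|xy] := pselect (x = y).
  by rewrite (_ : _ @^-1` _ = setT)//; apply/seteqP; split.
by rewrite (_ : _ @^-1` _ = set0)//; apply/seteqP; split.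
Qed.

Lemma finitely_valued1 (X Y : Type) (F : X -> Y) s :
  finitely_valued s -> finitely_valued (F \o s).
Proof. by move=> fs; apply: (finitely_valued2 (fun x (_ : X) => F x) fs fs). Qed.

Lemma finitely_valued_measurable (s : R -> R) D : finitely_valued s -> measurable_fun D s.
Proof.
move=> [fs ms]; apply: measurable_funTS => _ Y mY; rewrite setTI.
have -> : s @^-1` Y = \bigcup_(x in range s `&` Y) s @^-1` [set x].
  apply/seteqP; split=> [t Yt|t [x [_ Yx] /= ->//]].
  by exists (s t) => //; split=> //; exists t.
apply: fin_bigcup_measurable => [|p _]; last exact: ms.
by apply: sub_finite_set fs => p [].
Qed.

End FinitelyValued.

Section AlmostEverywhere.
Context {R : realType}.
Local Notation mu := (@lebesgue_measure R).

Lemma ae_imp (P Q : R -> Prop) : (forall t, P t -> Q t) ->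
  {ae mu, forall t, P t} -> {ae mu, forall t, Q t}.
Proof. exact: (@filterS _ _ (ae_filter_ringOfSetsType mu)). Qed.

Lemma ae_and (P Q : R -> Prop) : {ae mu, forall t, P t} -> {ae mu, forall t, Q t} ->
  {ae mu, forall t, P t /\ Q t}.
Proof. exact: (@filterI _ _ (ae_filter_ringOfSetsType mu)). Qed.

Lemma ae_all (P : R -> Prop) : (forall t, P t) -> {ae mu, forall t, P t}.
Proof.
move=> h; apply: (@filterS _ _ (ae_filter_ringOfSetsType mu) setT) => [t _|]; first exact: h.
exact: (@filterT _ _ (ae_filter_ringOfSetsType mu)).
Qed.

End AlmostEverywhere.

Section Measurability.
Context {R : realType} {V : hilbertType R}.
Variable T : R.
Hypothesis T_gt0 : 0 < T.
Local Notation mu := (@lebesgue_measure R).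
Local Notation I := (`]0, T[%classic : set R).
Local Notation sm := (strongly_measurable T).
Implicit Types (u v w : R -> V).

Definition grid_index (n : nat) (t : R) : nat := minn (Num.truncn (n.+1%:R * t / T)) n.

(** Step functions approximating the identity on [I]. The values [T (k + 1) / (n + 2)] with [k <= n]
    lie strictly inside [I], because a family of operators may be arbitrary elsewhere; the cap at
    [n] in [grid_index] keeps the range finite over all of [R]. *)
Definition grid (n : nat) (t : R) : R := T * (grid_index n t).+1%:R / n.+2%:R.

Lemma grid_I n t : I (grid n t).
Proof.
rewrite /= in_itv/= /grid divr_gt0 ?mulr_gt0 ?ltr0n//= ltr_pdivrMr ?ltr0n// ltr_pM2l// ltr_nat.
by rewrite !ltnS geq_minr.
Qed.

Lemma grid_finitely_valued n : finitely_valued (grid n).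
Proof.
have -> : grid n = (fun k : nat => T * k.+1%:R / n.+2%:R) \o grid_index n by [].
apply: finitely_valued1.
have mle m : measurable [set t | (grid_index n t <= m)%N].
  have -> : [set t | (grid_index n t <= m)%N] =
      `]-oo, T * m.+1%:R / n.+1%:R[ `|` (if (n <= m)%N then setT else set0).
    apply/seteqP; split=> t /=; rewrite in_itv /= /grid_index geq_min truncn_le_nat.
      rewrite ltr_pdivrMr// ltr_pdivlMr ?ltr0n// (mulrC t) (mulrC T).
      by case: (n <= m)%N; rewrite ?orbT ?orbF; [right|left].
    rewrite ltr_pdivrMr// ltr_pdivlMr ?ltr0n// (mulrC t) (mulrC T).
    by case: (n <= m)%N => -[->|] //; rewrite orbT.
  by apply: measurableU; [exact: measurable_itv|case: ifP].
split.
  apply: sub_finite_set (finite_II n.+1) => _ [t _ <-] /=.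
  by rewrite ltnS geq_minr.
move=> k; have -> : grid_index n @^-1` [set k] =
    [set t | (grid_index n t <= k)%N] `\` (if k is k'.+1 then [set t | (grid_index n t <= k')%N] else set0).
  apply/seteqP; split=> [t /= <-|t /= [gk]].
    by split=> //; case E: (grid_index n t) => [|m] //=; rewrite E ltnn.
  case: k gk => [|k] /= gk h; apply/eqP; first by rewrite -leqn0.
  by rewrite eqn_leq gk ltnNge; apply/negP.
by apply: measurableD => //; case: k.
Qed.

Lemma grid_cvg t : I t -> grid n t @[n --> \oo] --> t.
Proof.
rewrite /= in_itv/= => /andP[t0 tT]; apply/cvgrPdist_lt => e e0.
have [|N hN] := @invS_lt R (e / T); first by rewrite divr_gt0.
exists N => // n /= Nn; have := hN n Nn; rewrite ltr_pdivlMr// mulrC.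
have n1 : 0 < n.+1%:R :> R by rewrite ltr0n.
have n2 : 0 < n.+2%:R :> R by rewrite ltr0n.
apply: le_lt_trans.
have h0 : 0 <= n.+1%:R * t / T by rewrite divr_ge0 ?mulr_ge0// ltW.
have /andP[] := truncn_itv h0.
have -> : Num.truncn (n.+1%:R * t / T) = grid_index n t.
  rewrite /grid_index; apply/esym/minn_idPl; rewrite truncn_le_nat.
  by rewrite ltr_pdivrMr// ltr_pM2l// ltr0n.
have : (grid_index n t <= n)%N by exact: geq_minr.
rewrite /grid -(ler_nat R) -!natr1; rewrite -!natr1 in n1 n2.
set k := (grid_index n t)%:R; set m := n%:R + 1; have mE : m = n%:R + 1 :> R by [].
have k0 : 0 <= k :> R by rewrite ler0n.
have m0 : 0 < m by [].
rewrite ler_pdivlMr// ltr_pdivrMr// => kn h1 h2.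
have m10 : 0 < m + 1 by rewrite addr_gt0.
rewrite ler_norml lerNl opprB; apply/andP; split.
  rewrite lerBlDr ler_pdivrMr// mulrDl -(ler_pM2l m0).
  have -> : m * (T / m * (m + 1) + t * (m + 1)) = (T + m * t) * (m + 1) by field; rewrite gt_eqF.
  nra.
rewrite -(ler_pM2l m0) -(ler_pM2l m10).
have -> : (m + 1) * (m * (T / m)) = T * (m + 1) by field; rewrite gt_eqF.
have -> : (m + 1) * (m * (t - T * (k + 1) / (m + 1))) = (m + 1) * (m * t) - m * T * (k + 1).
  by field; rewrite gt_eqF.
nra.
Qed.

Lemma sm_comp2 (F : V -> V -> V) u v : sm u -> sm v ->
  (forall (x y : nat -> V) a b, x @ \oo --> a -> y @ \oo --> b ->
     F (x n) (y n) @[n --> \oo] --> F a b) ->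
  sm (fun t => F (u t) (v t)).
Proof.
move=> [s [fs su]] [r [fr rv]] cF; exists (fun n t => F (s n t) (r n t)); split.
  by move=> n; apply: (finitely_valued2 F (fs n) (fr n)).
by move=> t It; apply: cF; [exact: su|exact: rv].
Qed.

Lemma measurable_sm2 (F : V -> V -> R) u v D : sm u -> sm v -> D `<=` I ->
  (forall (x y : nat -> V) a b, x @ \oo --> a -> y @ \oo --> b ->
     F (x n) (y n) @[n --> \oo] --> F a b) ->
  measurable_fun D (fun t => F (u t) (v t)).
Proof.
move=> [s [fs su]] [r [fr rv]] DI cF.
apply: (@measurable_fun_cvg _ _ _ D (fun n t => F (s n t) (r n t))).
  by move=> n; apply: finitely_valued_measurable; apply: (finitely_valued2 F (fs n) (fr n)).
by move=> t /DI It; apply: cF; [exact: su|exact: rv].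
Qed.

(** Sampling time on the grid and [u] through its simple approximants gives finitely valued
    functions whatever [G] is; sequential continuity yields the limit. This covers [t |-> B t (u t)]
    for a strongly continuous family. *)
Lemma sm_caratheodory (G : R -> V -> V) u : sm u ->
  (forall t x (r : nat -> R) (y : nat -> V), I t -> (forall n, I (r n)) ->
     r @ \oo --> t -> y @ \oo --> x -> G (r n) (y n) @[n --> \oo] --> G t x) ->
  sm (fun t => G t (u t)).
Proof.
move=> [s [fs su]] cG; exists (fun n t => G (grid n t) (s n t)); split.
  by move=> n; apply: (finitely_valued2 G (grid_finitely_valued n) (fs n)).
move=> t It; apply: cG => //; [by move=> n; exact: grid_I|exact: grid_cvg|exact: su].
Qed.

Lemma sm_cst (x : V) : sm (fun=> x).
Proof.
exists (fun _ _ => x); split=> [n|t _]; last exact: cvg_cst.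
exact: finitely_valued_cst.
Qed.

Lemma smD u v : sm u -> sm v -> sm (fun t => u t + v t).
Proof. by move=> su sv; apply: (sm_comp2 su sv) => x y a b; exact: cvgD. Qed.

Lemma sm_op (A : V -> V) u a : linear A -> (forall y, hnorm (A y) <= a * hnorm y) ->
  sm u -> sm (fun t => A (u t)).
Proof.
move=> lA bA su; apply: (@sm_comp2 (fun x _ => A x) u u) => // x y b c xb _.
exact: bounded_cvg bA xb.
Qed.

Lemma smZ c u : sm u -> sm (fun t => c *: u t).
Proof.
by move=> su; apply: (@sm_comp2 (fun x _ => c *: x) u u) => // x y b d xb _; exact: cvgZl_tmp.
Qed.

Lemma measurable_rinner u v D : D `<=` I -> sm u -> sm v -> measurable_fun D (fun t => rinner (u t) (v t)).
Proof. by move=> DI su sv; apply: measurable_sm2 => // x y a b; exact: cvg_rinner. Qed.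

Lemma measurable_hnorm u D : D `<=` I -> sm u -> measurable_fun D (fun t => hnorm (u t)).
Proof.
move=> DI su; apply: (@measurable_sm2 (fun x _ => hnorm x) u u) => // x y a b xa _.
exact: cvg_hnorm.
Qed.

Lemma measurable_I : measurable I. Proof. exact: measurable_itv. Qed.

Lemma integrable_cst_I (a : R) : mu.-integrable I (EFin \o cst a).
Proof.
apply/integrableP; split; first exact/measurable_EFinP.
have -> : (\int[mu]_(x in I) `|(EFin \o cst a) x| = `|a|%:E * mu I)%E.
  by rewrite -(integral_cst mu measurable_I `|a|%:E).
by rewrite lebesgue_measure_itv /= lte_fin T_gt0 -EFinB -EFinM ltry.
Qed.

Lemma integrable_le (h g : R -> R) A : measurable A -> A `<=` I -> measurable_fun A h ->
  mu.-integrable I (EFin \o g) -> (forall t, A t -> `|h t| <= g t) ->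
  mu.-integrable A (EFin \o h).
Proof.
move=> mA AI mh ig hg; apply: (@le_integrable _ _ R mu A mA _ (EFin \o g)).
- exact/measurable_EFinP.
- move=> t At /=; rewrite lee_fin; apply: le_trans (hg _ At) (ler_norm _).
- by apply: integrableS ig => //; exact: measurable_I.
Qed.

Lemma integrable_sum (h g : R -> R) A : measurable A ->
  mu.-integrable A (EFin \o h) -> mu.-integrable A (EFin \o g) ->
  mu.-integrable A (EFin \o (fun t => h t + g t)).
Proof. by move=> mA ih ig; have := integrableD mA ih ig; apply: eq_integrable. Qed.

Lemma integrable_scale (h : R -> R) a A : measurable A ->
  mu.-integrable A (EFin \o h) -> mu.-integrable A (EFin \o (fun t => a * h t)).
Proof. by move=> mA ih; have := integrableZl mA a ih; apply: eq_integrable. Qed.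

Lemma L2P u : L2 T u <-> sm u /\ mu.-integrable I (EFin \o (fun t => hnorm (u t) ^+ 2)).
Proof.
split=> -[su h]; split=> //.
  apply/integrableP; split.
    by apply/measurable_EFinP; apply: measurable_funX; exact: measurable_hnorm.
  apply: le_lt_trans h; rewrite le_eqVlt; apply/orP; left; apply/eqP.
  by apply: eq_integral => t _ /=; rewrite ger0_norm ?sqr_ge0.
move/integrableP : h => [_]; apply: le_lt_trans.
rewrite le_eqVlt; apply/orP; left; apply/eqP.
by apply: eq_integral => t _ /=; rewrite ger0_norm ?sqr_ge0.
Qed.

Lemma L2_sm u : L2 T u -> sm u. Proof. by case. Qed.

Lemma L2_integrable u : L2 T u -> mu.-integrable I (EFin \o (fun t => hnorm (u t) ^+ 2)).
Proof. by move/L2P => []. Qed.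

Lemma L2_le u (g : R -> R) : sm u -> mu.-integrable I (EFin \o g) ->
  (forall t, I t -> hnorm (u t) ^+ 2 <= g t) -> L2 T u.
Proof.
move=> su ig ug; apply/L2P; split=> //; apply: (integrable_le measurable_I _ _ ig) => //.
  by apply: measurable_funX; exact: measurable_hnorm.
by move=> t It; rewrite ger0_norm ?sqr_ge0// ug.
Qed.

Lemma L2_bounded u a : sm u -> (forall t, I t -> hnorm (u t) <= a) -> L2 T u.
Proof.
move=> su ua; apply: (L2_le su (integrable_cst_I (a ^+ 2))) => t It /=.
by rewrite lerXn2r ?nnegrE ?hnorm_ge0 ?ua//; apply: le_trans (ua _ It); exact: hnorm_ge0.
Qed.

Lemma L2_dom u v a : sm u -> L2 T v -> (forall t, I t -> hnorm (u t) <= a * hnorm (v t)) -> L2 T u.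
Proof.
move=> su /L2_integrable lv uv.
apply: (L2_le su (integrable_scale (a ^+ 2) measurable_I lv)) => t It /=.
rewrite -exprMn lerXn2r ?nnegrE ?hnorm_ge0 ?uv//.
by apply: le_trans (uv _ It); exact: hnorm_ge0.
Qed.

Lemma L2D u v : L2 T u -> L2 T v -> L2 T (fun t => u t + v t).
Proof.
move=> lu lv; have h := integrable_scale 2 measurable_I
  (integrable_sum measurable_I (L2_integrable lu) (L2_integrable lv)).
apply: (L2_le _ h) => [|t _ /=]; first by apply: smD; exact: L2_sm.
by rewrite -parallelogram lerDl sqr_ge0.
Qed.

Lemma L2Z c u : L2 T u -> L2 T (fun t => c *: u t).
Proof.
move=> lu; apply: (@L2_dom _ u (complex.Re `|c|) _ lu); first by apply: smZ; exact: L2_sm.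
move=> t _; rewrite {1}/hnorm normrZ hnormE; case: `|c| => a b /=.
by rewrite mulr0 subr0.
Qed.

Lemma L2N u : L2 T u -> L2 T (fun t => - u t).
Proof. by move=> su; under eq_fun do rewrite -scaleN1r; exact: L2Z. Qed.

Lemma L2B u v : L2 T u -> L2 T v -> L2 T (fun t => u t - v t).
Proof. by move=> su sv; apply: L2D => //; exact: L2N. Qed.

Lemma L2_op (A : V -> V) u a : linear A -> (forall y, hnorm (A y) <= a * hnorm y) ->
  L2 T u -> L2 T (fun t => A (u t)).
Proof.
move=> lA bA lu; apply: (@L2_dom _ u a _ lu) => //.
by apply: sm_op bA _ => //; exact: L2_sm.
Qed.

Lemma L2_cst (x : V) : L2 T (fun=> x).
Proof. by apply: (@L2_bounded _ (hnorm x)) => //; exact: sm_cst. Qed.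

Lemma integrable_rinner u v A : measurable A -> A `<=` I -> L2 T u -> L2 T v ->
  mu.-integrable A (EFin \o (fun t => rinner (u t) (v t))).
Proof.
move=> mA AI lu lv.
apply: (integrable_le mA AI _
  (integrable_sum measurable_I (L2_integrable lu) (L2_integrable lv))) => [|t _].
  by apply: measurable_rinner => //; exact: L2_sm.
exact: rinner_le2.
Qed.

Lemma integrable_hnormM u v A : measurable A -> A `<=` I -> L2 T u -> L2 T v ->
  mu.-integrable A (EFin \o (fun t => hnorm (u t) * hnorm (v t))).
Proof.
move=> mA AI lu lv.
apply: (integrable_le mA AI _
  (integrable_sum measurable_I (L2_integrable lu) (L2_integrable lv))) => [|t _].
  by apply: measurable_funM; apply: measurable_hnorm => //; exact: L2_sm.
rewrite ger0_norm ?mulr_ge0 ?hnorm_ge0//.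
have := sqr_ge0 (hnorm (u t) - hnorm (v t)); have := sqr_ge0 (hnorm (u t) + hnorm (v t)).
by rewrite sqrrB sqrrD => h1 h2; lra.
Qed.

Lemma integrable_hnorm u A : measurable A -> A `<=` I -> L2 T u ->
  mu.-integrable A (EFin \o (fun t => hnorm (u t))).
Proof.
move=> mA AI lu.
apply: (integrable_le mA AI _
  (integrable_sum measurable_I (L2_integrable lu) (integrable_cst_I 1))) => [|t _].
  by apply: measurable_hnorm => //; exact: L2_sm.
rewrite /= ger0_norm ?hnorm_ge0//.
by have := sqr_ge0 (hnorm (u t) - 1); have := hnorm_ge0 (u t); nra.
Qed.

Lemma Rint_dominated (h : nat -> R -> R) (h' g : R -> R) A : measurable A ->
  (forall n, measurable_fun A (h n)) -> mu.-integrable A (EFin \o g) ->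
  (forall t, A t -> h n t @[n --> \oo] --> h' t) ->
  (forall n t, A t -> `|h n t| <= g t) ->
  \int[mu]_(t in A) h n t @[n --> \oo] --> \int[mu]_(t in A) h' t.
Proof.
move=> mA mh ig hh hg.
have mh' : measurable_fun A h' by apply: measurable_fun_cvg hh.
have ih' : mu.-integrable A (EFin \o h').
  apply: (@le_integrable _ _ R mu A mA _ (EFin \o g)) => //.
    exact/measurable_EFinP.
  move=> t At /=; rewrite lee_fin; apply: le_trans (ler_norm _).
  have ht : `|h n t| @[n --> \oo] --> `|h' t| by apply: cvg_norm; exact: hh.
  by apply: cvgr_ub ht _; apply: nearW => n; exact: hg.
have mE n : measurable_fun A (EFin \o h n) by exact/measurable_EFinP.
apply: fine_cvg; rewrite fineK; last exact: integrable_fin_num.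
apply: (@dominated_cvg _ _ _ mu A mA (fun n => EFin \o h n) (EFin \o h') (EFin \o g)) => //.
- by move=> t At; apply: cvg_EFin; [apply: nearW|exact: hh].
Qed.

Lemma ae_Rintegral (h g : R -> R) A : measurable A -> measurable_fun A h -> measurable_fun A g ->
  ae_eq mu A h g -> \int[mu]_(t in A) h t = \int[mu]_(t in A) g t.
Proof.
move=> mA mh mg hg; congr fine; apply: ae_eq_integral => //; try exact/measurable_EFinP.
by apply: filterS hg => t h1 /h1 /= ->.
Qed.

End Measurability.

(** * Weak integrals and integration by parts *)

(* Bisecting [s, t] n times and telescoping divides the bound by 2^(n/2). *)
Lemma sqrt_telescope {R : realType} (T C : R) (d K : R -> R) :
  (forall s t : R, 0 <= s -> s <= t -> t <= T -> `|d t - d s| <= C * Num.sqrt (t - s) * (K t - K s)) ->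
  forall s t, 0 <= s -> s <= t -> t <= T -> d t = d s.
Proof.
move=> h.
have P n : forall s t, 0 <= s -> s <= t -> t <= T ->
    `|d t - d s| <= C * Num.sqrt ((t - s) / 2 ^+ n) * (K t - K s).
  elim: n => [|n IH] s t s0 st tT; first by rewrite expr0 divr1 h.
  pose m := (s + t) / 2.
  have sm : s <= m by rewrite /m; lra.
  have mt : m <= t by rewrite /m; lra.
  have h1 := IH s m s0 sm (le_trans mt tT); have h2 := IH m t (le_trans s0 sm) mt tT.
  have e1 : (m - s) / 2 ^+ n = (t - s) / 2 ^+ n.+1.
    by rewrite exprS /m; field; rewrite expf_neq0.
  have e2 : (t - m) / 2 ^+ n = (t - s) / 2 ^+ n.+1.
    by rewrite exprS /m; field; rewrite expf_neq0.
  rewrite e1 in h1; rewrite e2 in h2.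
  rewrite (_ : d t - d s = (d t - d m) + (d m - d s)); last by ring.
  by apply: le_trans (ler_normD _ _) _; lra.
move=> s t s0 st tT; apply/eqP; rewrite -subr_eq0 -normr_le0.
apply/ler_addgt0Pl => e e0; rewrite addr0.
have ts : 0 <= t - s by rewrite subr_ge0.
pose M := `|C * (K t - K s)| + 1; have M0 : 0 < M by rewrite ltr_wpDl.
have [|N hN] := @invS_lt R ((e / M) ^+ 2 / (t - s + 1)).
  by rewrite divr_gt0 ?exprn_gt0 ?divr_gt0//; lra.
apply: le_trans (P N s t s0 st tT) _.
rewrite mulrAC; apply: le_trans (_ : M * Num.sqrt ((t - s) / 2 ^+ N) <= _).
  by rewrite ler_wpM2r ?sqrtr_ge0// /M; apply: le_trans (ler_norm _) _; rewrite lerDl.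
rewrite mulrC -ler_pdivlMr// -[leRHS]ger0_norm; last by rewrite ltW// divr_gt0.
rewrite -sqrtr_sqr; apply: ler_wsqrtr.
have h2 : (2 ^+ N)^-1 <= N.+1%:R^-1 :> R.
  by rewrite lef_pV2 ?posrE ?exprn_gt0 ?ltr0n// -natrX ler_nat ltn_expl.
have := hN N (leqnn N); rewrite ltr_pdivlMr; last by lra.
move=> h3; apply: le_trans (ltW h3).
have h4 : 0 < (2 ^+ N)^-1 :> R by rewrite invr_gt0 exprn_gt0.
by move: h2 h4; set a := (2 ^+ N)^-1; set b := N.+1%:R^-1; nra.
Qed.

Section WeakIntegral.
Context {R : realType} {V : hilbertType R}.
Variable T : R.
Hypothesis T_gt0 : 0 < T.
Local Notation mu := (@lebesgue_measure R).
Local Notation I := (`]0, T[%classic : set R).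
Local Notation sm := (strongly_measurable T).
Implicit Types (u v w k : R -> V) (A : set R).

Lemma within_cvg_seq w t (r : nat -> R) : {within `[0, T], continuous w} ->
  `[0, T]%classic t -> (forall n, `[0, T]%classic (r n)) -> r @ \oo --> t ->
  w (r n) @[n --> \oo] --> w t.
Proof.
move=> /subspace_continuousP wc tT rT rt; apply: cvg_trans (wc t tT).
move=> P /= hP; have [N _ hN] := rt _ hP; exists N => // n Nn.
by apply: hN => //; exact: rT.
Qed.

Lemma sm_within w : {within `[0, T], continuous w} -> sm w.
Proof.
move=> wc; apply: (@sm_caratheodory R V T T_gt0 (fun t _ => w t) (fun=> 0)).
  exact: sm_cst.
have IT t : I t -> `[0, T]%classic t.
  by rewrite /= !in_itv/= => /andP[/ltW -> /ltW ->].
by move=> t x r y It Ir rt _; apply: within_cvg_seq => //; [exact: IT|move=> n; exact: IT].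
Qed.

Lemma within_bounded w : {within `[0, T], continuous w} ->
  exists2 c, `[0, T]%classic c & forall t, `[0, T]%classic t -> hnorm (w t) <= hnorm (w c).
Proof.
move=> wc; have [|c cT hc] := @EVT_max R (fun t => hnorm (w t)) 0 T (ltW T_gt0).
  apply/subspace_continuousP => t tT; apply: cvg_hnorm.
  by move/subspace_continuousP : wc; apply.
by exists c.
Qed.

Lemma L2_within w : {within `[0, T], continuous w} -> L2 T w.
Proof.
move=> wc; have [c _ hc] := within_bounded wc.
apply: (L2_bounded T_gt0 (sm_within wc)) => t It; apply: hc.
by move: It; rewrite /= !in_itv/= => /andP[/ltW -> /ltW ->].
Qed.

Lemma integrable_rinner_cst k A (x : V) : measurable A -> A `<=` I -> L2 T k ->
  mu.-integrable A (EFin \o (fun t => rinner (k t) x)).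
Proof. by move=> mA AI lk; exact: (integrable_rinner mA AI lk (L2_cst T_gt0 x)). Qed.

(** Riesz representation on the whole space; the functional is bounded by the integral of
    [hnorm (k t)]. *)
Lemma weak_integral_exists k A : measurable A -> A `<=` I -> L2 T k ->
  exists v : V, forall x, rinner v x = \int[mu]_(t in A) rinner (k t) x.
Proof.
move=> mA AI lk.
have ik x : mu.-integrable A (EFin \o (fun t => rinner (k t) x)).
  exact: integrable_rinner_cst.
have [|||||v _ hv] := @riesz_subspace R V setT (fun x => \int[mu]_(t in A) rinner (k t) x)
  (\int[mu]_(t in A) hnorm (k t)) => //.
- move=> c x y; rewrite -RintegralZl// -RintegralD//; last exact: integrable_scale.
  by apply: eq_Rintegral => t _; rewrite !rinnerE.
- move=> x; have ih := integrable_hnorm T_gt0 mA AI lk.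
  rewrite mulrC -RintegralZl//; apply: le_Rintegral => //; first exact: integrable_scale.
  by move=> t _; rewrite mulrC; apply: le_trans (ler_norm _) (rinner_le _ _).
by exists v => x; apply: hv.
Qed.

Definition weak_integral k A : V :=
  xget 0 [set v : V | forall x, rinner v x = \int[mu]_(t in A) rinner (k t) x].

Lemma rinner_weak_integral k A x : measurable A -> A `<=` I -> L2 T k ->
  rinner (weak_integral k A) x = \int[mu]_(t in A) rinner (k t) x.
Proof.
move=> mA AI lk; rewrite /weak_integral; case: xgetP => [v -> //|h].
by have [v hv] := weak_integral_exists mA AI lk; case: (h v).
Qed.

Lemma hnorm_weak_integral k A : measurable A -> A `<=` I -> L2 T k ->
  hnorm (weak_integral k A) <= \int[mu]_(t in A) hnorm (k t).
Proof.
move=> mA AI lk; apply: hnorm_le_rinner.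
  by apply: Rintegral_ge0 => t _; exact: hnorm_ge0.
have ih := integrable_hnorm T_gt0 mA AI lk.
move=> x; rewrite rinner_weak_integral// mulrC -RintegralZl//; apply: le_Rintegral => //.
- exact: integrable_rinner_cst.
- exact: integrable_scale.
by move=> t _; rewrite mulrC; apply: le_trans (ler_norm _) (rinner_le _ _).
Qed.

(* [slice s t] is [s, t[ deprived of 0, so that it stays inside I for all 0 <= s <= t <= T. *)
Definition slice (s t : R) : set R := `]0, t[ `\` `]0, s[.

Lemma measurable_slice s t : measurable (slice s t).
Proof. by apply: measurableD; exact: measurable_itv. Qed.

Lemma slice_sub s t : t <= T -> slice s t `<=` I.
Proof.
move=> tT r [] /=; rewrite !in_itv/= => /andP[-> rt] _.
exact: lt_le_trans rt tT.
Qed.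

Lemma sliceP s t r : slice s t r -> s <= r < t.
Proof.
move=> [] /=; rewrite !in_itv/= => /andP[r0 ->] h; rewrite andbT leNgt.
by apply/negP => rs; apply: h; rewrite r0.
Qed.

Lemma initial_sub t : t <= T -> `]0, t[%classic `<=` I.
Proof. by move=> tT r /=; rewrite !in_itv/= => /andP[-> rt]; apply: lt_le_trans tT. Qed.

Lemma Rint_slice (h : R -> R) s t : s <= t -> t <= T -> mu.-integrable I (EFin \o h) ->
  \int[mu]_(r in `]0, t[) h r = \int[mu]_(r in `]0, s[) h r + \int[mu]_(r in slice s t) h r.
Proof.
move=> st tT ih; have e : `]0, t[%classic = `]0, s[%classic `|` slice s t.
  rewrite setDUK// => r /=; rewrite !in_itv/= => /andP[-> rs].
  exact: lt_le_trans st.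
rewrite {1}e Rintegral_setU//; first exact: measurable_slice.
- rewrite -e; apply: integrableS ih => //; exact: initial_sub.
- by apply/disj_setPS => r [rs [_ nrs]]; exact: nrs.
Qed.

Lemma Rint_slice_cst (a : R) s t : 0 <= a -> 0 <= s -> s <= t ->
  \int[mu]_(r in slice s t) a <= a * (t - s).
Proof.
move=> a0 s0 st; rewrite Rintegral_cst; last exact: measurable_slice.
apply: ler_wpM2l => //.
have le : (mu (slice s t) <= (t - s)%:E)%E.
  have -> : (t - s)%:E = mu `[s, t[%classic.
    rewrite lebesgue_measure_itv/= lte_fin; case: ltP => // ts.
    have /eqP -> : t == s by rewrite eq_le ts st.
    by rewrite subrr.
  apply: le_measure; rewrite ?inE; [exact: measurable_slice|exact: measurable_itv|].
  by move=> r /sliceP; rewrite /= in_itv.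
rewrite -lee_fin fineK// ge0_fin_numE//; exact: le_lt_trans le (ltry _).
Qed.

Definition primitive k (t : R) : V := weak_integral k `]0, t[.

Lemma rinner_primitive k t x : t <= T -> L2 T k ->
  rinner (primitive k t) x = \int[mu]_(r in `]0, t[) rinner (k r) x.
Proof.
by move=> tT lk; rewrite rinner_weak_integral//; exact: initial_sub.
Qed.

Lemma primitiveB k s t : s <= t -> t <= T -> L2 T k ->
  primitive k t - primitive k s = weak_integral k (slice s t).
Proof.
move=> st tT lk; apply: rinner_ext => x.
rewrite rinnerDl rinnerNl !rinner_primitive//; last exact: le_trans tT.
rewrite rinner_weak_integral//; [|exact: measurable_slice|exact: slice_sub].
rewrite (Rint_slice st tT); first by ring.
by apply: integrable_rinner_cst => //; exact: measurable_I.
Qed.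

Lemma primitive0 k : primitive k 0 = 0.
Proof.
have e : `]0, 0[%classic = set0 :> set R by apply/seteqP; split => r //=; rewrite in_itv/= lt_asym.
rewrite /primitive e; apply: rinner_ext => x; rewrite rinner0l /weak_integral.
case: xgetP => [v _ -> |]; first by rewrite Rintegral_set0.
by rewrite rinner0l.
Qed.

Definition sqnorm k : R := \int[mu]_(r in I) (hnorm (k r) ^+ 2).

Lemma sqnorm_ge0 k : 0 <= sqnorm k.
Proof. by apply: Rintegral_ge0 => t _; exact: sqr_ge0. Qed.

Lemma Rint_subset (h : R -> R) A : measurable A -> A `<=` I -> (forall t, I t -> 0 <= h t) ->
  mu.-integrable I (EFin \o h) -> \int[mu]_(t in A) h t <= \int[mu]_(t in I) h t.
Proof.
move=> mA AI h0 ih.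
rewrite fine_le//.
- by apply: integrable_fin_num => //; apply: integrableS ih.
- exact: integrable_fin_num.
- by apply: ge0_subset_integral => //; exact: (measurable_int mu).
Qed.

(** A form of Cauchy-Schwarz without products of integrals: with [a = sqrt (t - s)], integrate
    [|k| <= a |k|^2 / 2 + 1 / (2 a)] over a set of measure at most [a^2]. The exponent 1/2 is what
    later arguments rely on, not the constant. *)
Lemma Rint_hnorm_slice k s t : 0 <= s -> s <= t -> t <= T -> L2 T k ->
  \int[mu]_(r in slice s t) hnorm (k r) <= (sqnorm k + 1) / 2 * Num.sqrt (t - s).
Proof.
move=> s0 st tT lk; set a := Num.sqrt (t - s).
have ms := measurable_slice s t; have ss := @slice_sub s t tT.
have a2 : a ^+ 2 = t - s by rewrite sqr_sqrtr// subr_ge0.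
have := st; rewrite le_eqVlt => /orP[/eqP ts|ts].
  have e0 : slice s t = set0.
    by apply/seteqP; split => // r /sliceP/andP[]; rewrite ts => h1 /(le_lt_trans h1); rewrite ltxx.
  by rewrite e0 Rintegral_set0 mulr_ge0 ?sqrtr_ge0 ?divr_ge0 ?addr_ge0 ?sqnorm_ge0.
have a0 : 0 < a by rewrite sqrtr_gt0 subr_gt0.
have ik : mu.-integrable (slice s t) (EFin \o (fun r => hnorm (k r) ^+ 2)).
  by apply: integrableS (L2_integrable lk) => //; exact: measurable_I.
have ic : mu.-integrable (slice s t) (EFin \o (fun=> a^-1 / 2)).
  by apply: integrableS (integrable_cst_I T_gt0 (a^-1 / 2)) => //; exact: measurable_I.
have ik2 := integrable_scale (a / 2) ms ik.
apply: le_trans (_ : \int[mu]_(r in slice s t) (a / 2 * hnorm (k r) ^+ 2 + a^-1 / 2) <= _).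
  apply: le_Rintegral => //; first exact: (integrable_hnorm T_gt0).
    exact: integrable_sum.
  move=> r _; have := sqr_ge0 (a * hnorm (k r) - 1).
  rewrite sqrrB mulr1 expr1n exprMn => h.
  rewrite -(ler_pM2l a0); have -> : a * (a / 2 * hnorm (k r) ^+ 2 + a^-1 / 2)
    = (a ^+ 2 * hnorm (k r) ^+ 2 + 1) / 2 by field; rewrite gt_eqF.
  lra.
rewrite RintegralD// RintegralZl//.
have h1 : \int[mu]_(r in slice s t) (hnorm (k r) ^+ 2) <= sqnorm k.
  by apply: Rint_subset => //; [move=> *; exact: sqr_ge0|exact: L2_integrable].
have h2 : \int[mu]_(r in slice s t) (a^-1 / 2) <= a / 2.
  apply: le_trans (Rint_slice_cst _ s0 st) _; first by rewrite divr_ge0 ?invr_ge0 ?ltW.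
  by rewrite -a2 le_eqVlt; apply/orP; left; apply/eqP; field; rewrite gt_eqF.
by nra.
Qed.

Lemma primitive_holder k s t : 0 <= s -> s <= t -> t <= T -> L2 T k ->
  hnorm (primitive k t - primitive k s) <= (sqnorm k + 1) / 2 * Num.sqrt (t - s).
Proof.
move=> s0 st tT lk; rewrite primitiveB//.
apply: le_trans (hnorm_weak_integral _ _ lk) _; [exact: measurable_slice|exact: slice_sub|].
exact: Rint_hnorm_slice.
Qed.

Lemma primitive_within k : L2 T k -> {within `[0, T], continuous (primitive k)}.
Proof.
move=> lk; apply/subspace_continuousP => t /=; rewrite in_itv/= => /andP[t0 tT].
apply/hnorm_cvgP => e e0; pose C := (sqnorm k + 1) / 2.
have C0 : 0 < C by rewrite divr_gt0// ltr_wpDl// sqnorm_ge0.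
have d0 : 0 < (e / C) ^+ 2 by apply/exprn_gt0/divr_gt0.
move: (nbhsx_ballx (t : R) _ d0).
apply: filterS => s; rewrite -ball_normE /= => hs; rewrite in_itv/= => /andP[s0 sT].
have key : C * Num.sqrt `|t - s| < e.
  rewrite mulrC -ltr_pdivlMr// -[ltRHS]ger0_norm; last by rewrite ltW// divr_gt0.
  by rewrite -(sqrtr_sqr (e / C)) ltr_sqrt.
apply: le_lt_trans key; case: (leP s t) => st.
  by rewrite hnormBC ger0_norm ?subr_ge0//; exact: primitive_holder.
by rewrite distrC gtr0_norm ?subr_gt0//; apply: primitive_holder => //; exact: ltW.
Qed.

Lemma primitive_shift_within k (c : V) : L2 T k ->
  {within `[0, T], continuous (fun t => c + primitive k t)}.
Proof.
move=> lk; apply/subspace_continuousP => t tT; apply: cvgD; first exact: cvg_cst.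
by move/subspace_continuousP : (primitive_within lk); apply.
Qed.

(** Absolute continuity with derivative [k], expressed through increments so that no pointwise
    derivative is involved. *)
Definition primitive_of k w : Prop :=
  forall s t, 0 <= s -> s <= t -> t <= T -> w t - w s = weak_integral k (slice s t).

Lemma primitive_of_shift k (c : V) : L2 T k -> primitive_of k (fun t => c + primitive k t).
Proof. by move=> lk s t s0 st tT; rewrite opprD addrACA subrr add0r primitiveB. Qed.

Lemma primitive_of_holder k w s t : L2 T k -> primitive_of k w -> 0 <= s -> s <= t -> t <= T ->
  hnorm (w t - w s) <= (sqnorm k + 1) / 2 * Num.sqrt (t - s).
Proof.
move=> lk kw s0 st tT; rewrite kw//.
apply: le_trans (hnorm_weak_integral _ _ lk) _; [exact: measurable_slice|exact: slice_sub|].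
exact: Rint_hnorm_slice.
Qed.

(** Let [d] be the product minus the integral expected from the product rule. Its increment over
    [[s, t]] is of second order: a 1/2-Hölder factor times an increment of [K]. By [sqrt_telescope]
    such a [d] is constant. *)
Lemma primitive_of_by_parts k1 k2 w1 w2 s t : L2 T k1 -> L2 T k2 -> L2 T w1 -> L2 T w2 ->
  primitive_of k1 w1 -> primitive_of k2 w2 -> 0 <= s -> s <= t -> t <= T ->
  rinner (w1 t) (w2 t) - rinner (w1 s) (w2 s) =
  \int[mu]_(r in slice s t) (rinner (k1 r) (w2 r) + rinner (w1 r) (k2 r)).
Proof.
move=> lk1 lk2 lw1 lw2 p1 p2 s0 st tT.
pose h r := rinner (k1 r) (w2 r) + rinner (w1 r) (k2 r).
have ih A : measurable A -> A `<=` I -> mu.-integrable A (EFin \o h).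
  move=> mA AI.
  exact: (integrable_sum mA (integrable_rinner mA AI lk1 lw2) (integrable_rinner mA AI lw1 lk2)).
pose d t := rinner (w1 t) (w2 t) - \int[mu]_(r in `]0, t[) h r.
(* [hnorm (k1 r)] is counted twice: once against the variation of [w2] under the integral, once for
   the product of the two total increments. *)
pose g r := hnorm (k1 r) + (hnorm (k1 r) + hnorm (k2 r)).
have ig A : measurable A -> A `<=` I -> mu.-integrable A (EFin \o g).
  move=> mA AI; have i1 := integrable_hnorm T_gt0 mA AI lk1.
  exact: (integrable_sum mA i1 (integrable_sum mA i1 (integrable_hnorm T_gt0 mA AI lk2))).
pose K t := \int[mu]_(r in `]0, t[) g r.
pose C := (sqnorm k1 + 1) / 2 + (sqnorm k2 + 1) / 2.
have mI := @measurable_I R T.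
suff : d t = d s.
  rewrite /d (Rint_slice st tT) ?ih// -/h.
  by set a := \int[mu]_(r in slice s t) h r; set b := \int[mu]_(r in _) h r => e; lra.
apply: (@sqrt_telescope R T C d K) => // {s t s0 st tT} s t s0 st tT.
have ms := measurable_slice s t; have ss := @slice_sub s t tT.
rewrite /d /K !(Rint_slice st tT) ?ih ?ig//.
set X := \int[mu]_(r in `]0, s[) h r; set Y := \int[mu]_(r in `]0, s[) g r.
rewrite (addrAC Y) subrr add0r.
have dist1 r : s <= r -> r <= t -> hnorm (w1 r - w1 s) <= C * Num.sqrt (t - s).
  move=> sr rt; apply: le_trans (primitive_of_holder lk1 p1 s0 sr (le_trans rt tT)) _.
  apply: ler_pM; rewrite ?sqrtr_ge0 ?divr_ge0 ?addr_ge0 ?sqnorm_ge0//.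
    by rewrite /C lerDl divr_ge0 ?addr_ge0 ?sqnorm_ge0.
  by apply: ler_wsqrtr; rewrite lerD2r.
have dist2 r : s <= r -> r <= t -> hnorm (w2 r - w2 s) <= C * Num.sqrt (t - s).
  move=> sr rt; apply: le_trans (primitive_of_holder lk2 p2 s0 sr (le_trans rt tT)) _.
  apply: ler_pM; rewrite ?sqrtr_ge0 ?divr_ge0 ?addr_ge0 ?sqnorm_ge0//.
    by rewrite /C lerDr divr_ge0 ?addr_ge0 ?sqnorm_ge0.
  by apply: ler_wsqrtr; rewrite lerD2r.
have D1 := p1 _ _ s0 st tT; have D2 := p2 _ _ s0 st tT.
have lc (x : V) : L2 T (fun=> x) by exact: (L2_cst T_gt0).
have i1 := integrable_rinner ms ss lk1 (L2B (lc (w2 s)) lw2).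
have i2 := integrable_rinner ms ss (L2B (lc (w1 s)) lw1) lk2.
have E1 : \int[mu]_(r in slice s t) (rinner (k1 r) (w2 s - w2 r) + rinner (w1 s - w1 r) (k2 r))
     = rinner (w1 t - w1 s) (w2 s) + rinner (w2 t - w2 s) (w1 s) - \int[mu]_(r in slice s t) h r.
  rewrite D1 D2 !rinner_weak_integral//.
  have j1 := integrable_rinner ms ss lk1 (lc (w2 s)).
  have j2 := integrable_rinner ms ss lk2 (lc (w1 s)).
  rewrite -RintegralD// -RintegralB//; [|exact: integrable_sum|exact: ih].
  by apply: eq_Rintegral => r _; rewrite /h !rinnerE !(rinnerC _ (k2 r)); ring.
(* Freezing [w1] and [w2] at time [s] under the integral leaves these error terms, each with a
   factor that is a difference of [w1] or [w2] over a time at most [t - s]. *)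
have E : rinner (w1 t) (w2 t) - (X + \int[mu]_(r in slice s t) h r) - (rinner (w1 s) (w2 s) - X)
   = \int[mu]_(r in slice s t) (rinner (k1 r) (w2 s - w2 r) + rinner (w1 s - w1 r) (k2 r))
     + rinner (w1 t - w1 s) (w2 t - w2 s).
  rewrite E1; move: (\int[mu]_(r in slice s t) h r) => J.
  by rewrite !rinnerE (rinnerC (w2 t)) (rinnerC (w2 s) (w1 s)); ring.
rewrite E; apply: le_trans (ler_normD _ _) _.
set c := C * Num.sqrt (t - s).
have -> : \int[mu]_(r in slice s t) g r = \int[mu]_(r in slice s t) hnorm (k1 r)
    + \int[mu]_(r in slice s t) (hnorm (k1 r) + hnorm (k2 r)).
  by rewrite -RintegralD//; [exact: (integrable_hnorm T_gt0)|apply: integrable_sum => //; exact: (integrable_hnorm T_gt0)].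
rewrite mulrDr addrC; apply: lerD.
  apply: le_trans (rinner_le _ _) _; rewrite mulrC; apply: ler_pM; rewrite ?hnorm_ge0//.
    exact: dist2.
  by rewrite D1; exact: hnorm_weak_integral.
apply: le_trans (le_normr_Rintegral _ _ ) _ => //; first exact: integrable_sum.
have jk : mu.-integrable (slice s t) (EFin \o (fun r => hnorm (k1 r) + hnorm (k2 r))).
  by apply: integrable_sum => //; exact: (integrable_hnorm T_gt0).
rewrite -RintegralZl//; apply: le_Rintegral => //.
- have := integrable_norm (integrable_sum ms i1 i2); exact: eq_integrable.
- exact: integrable_scale.
move=> r /sliceP/andP[sr /ltW rt]; apply: le_trans (ler_normD _ _) _.
rewrite mulrDr; apply: lerD; apply: le_trans (rinner_le _ _) _.
  by rewrite mulrC ler_wpM2r ?hnorm_ge0// hnormBC dist2.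
by rewrite ler_wpM2r ?hnorm_ge0// hnormBC dist1.
Qed.

End WeakIntegral.

(** * Spline kernels *)

Section RealDerivative.
Context {R : realType}.
Implicit Types (f g : R -> R) (t a : R).

Definition has_deriv f t a : Prop := h^-1 * (f (t + h) - f t) @[h --> 0^'] --> a.

Lemma has_derivP f t a : has_deriv f t a <-> is_derive t 1 f a.
Proof.
have e : (fun h : R => h^-1 *: ((f \o shift t) (h *: 1) - f t)) = (fun h => h^-1 * (f (t + h) - f t)).
  apply/funext => h; rewrite /= -[h *: 1]/(h * 1) mulr1 (addrC h t).
  by [].
rewrite /has_deriv; split=> [h|[d v]].
  apply: DeriveDef; first by rewrite /derivable e; apply/cvg_ex; exists a.
  by rewrite /derive e; apply: cvg_lim.
by move: d v; rewrite /derivable /derive e => d <-.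
Qed.

Lemma has_deriv_quadratic f t a c :
  (forall h, `|f (t + h) - f t - a * h| <= c * h ^+ 2) -> has_deriv f t a.
Proof.
move=> hf; apply/cvgrPdist_le => e e0.
have c1 : 0 < `|c| + 1 by rewrite ltr_wpDl.
have d0 : 0 < e / (`|c| + 1) by rewrite divr_gt0.
have : \forall h \near (0 : R)^', `|h| < e / (`|c| + 1) by exact: dnbhs0_lt.
have : \forall h \near (0 : R)^', h != 0 by exact: nbhs_dnbhs_neq.
apply: filterS2 => h h0; rewrite ltr_pdivlMr// => he.
have -> : a - h^-1 * (f (t + h) - f t) = - (h^-1 * (f (t + h) - f t - a * h)) by field.
rewrite normrN normrM normfV ler_pdivrMl ?normr_gt0//.
apply: le_trans (hf h) _; rewrite -[h ^+ 2]real_normK ?num_real// expr2.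
have := ler_norm c; have h1 : 0 <= `|h| by []; have c0 : 0 <= `|c| by [].
by move: he h1 c0; set x := `|h|; set y := `|c|; nra.
Qed.

Definition pos t : R := Num.max 0 t.

Lemma has_deriv_pos2 t : has_deriv (fun t => pos t ^+ 2) t (2 * pos t).
Proof.
apply: (@has_deriv_quadratic _ _ _ 1) => h; rewrite /pos ler_norml.
by case: (lerP 0 t) => ht; case: (lerP 0 (t + h)) => hh; apply/andP; split; nra.
Qed.

Lemma has_deriv_pos3 t : has_deriv (fun t => pos t ^+ 3) t (3 * pos t ^+ 2).
Proof.
apply/has_derivP.
(* The factorisation [pos t ^+ 3 = pos t ^+ 2 * t] holds for negative [t] too, so the product rule
   with [id] avoids differentiating [pos], which has a corner at 0. *)
have e : (fun t => pos t ^+ 3) = (fun t => pos t ^+ 2) * id.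
  apply/funext => s; rewrite /pos !fctE; case: (lerP 0 s) => hs; rewrite ?expr0n//=; ring.
rewrite e; have h2 := (has_derivP _ _ _).1 (@has_deriv_pos2 t).
apply: is_derive_eq; rewrite /pos -![_ *: _]/(_ * _).
by case: (lerP 0 t) => hs; ring.
Qed.

Lemma has_deriv_affine f f' a e t : e != 0 -> (forall s, has_deriv f s (f' s)) ->
  has_deriv (fun t => f ((t - a) / e)) t (e^-1 * f' ((t - a) / e)).
Proof.
move=> e0 hf; apply/has_derivP.
have hg : is_derive t 1 (fun t : R => (t - a) / e) e^-1.
  apply/has_derivP/(@has_deriv_quadratic _ _ _ 0) => h.
  have -> : (t + h - a) / e - (t - a) / e - e^-1 * h = 0 by field.
  by rewrite normr0 mul0r.
have := @is_derive1_comp R f (fun t => (t - a) / e) t _ _ ((has_derivP _ _ _).1 (hf _)) hg.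
by rewrite mulrC; apply.
Qed.

Lemma has_derivZ f t a c : has_deriv f t a -> has_deriv (fun s => c * f s) t (c * a).
Proof.
move=> hf; rewrite /has_deriv; under eq_fun do rewrite -mulrBr mulrCA.
exact: cvgMl_tmp.
Qed.

Lemma has_derivB f g t a c : has_deriv f t a -> has_deriv g t c ->
  has_deriv (fun s => f s - g s) t (a - c).
Proof.
move=> hf hg; rewrite /has_deriv.
have -> : (fun h => h^-1 * (f (t + h) - g (t + h) - (f t - g t))) =
  (fun h => h^-1 * (f (t + h) - f t) - h^-1 * (g (t + h) - g t)).
  by apply/funext => h; ring.
exact: cvgB.
Qed.

(* Third difference: [step], [bump] and [bump'] are the cubic B-spline transition on the knots
   0, 1, 2, 3 and its first two derivatives. *)
Definition spline (g : R -> R) t : R :=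
  g t - 3 * g (t - 1) + 3 * g (t - 2) - g (t - 3).

Lemma has_deriv_shift f f' a t : (forall s, has_deriv f s (f' s)) ->
  has_deriv (fun s => f (s - a)) t (f' (t - a)).
Proof.
move=> hf; have := @has_deriv_affine f f' a 1 t (oner_neq0 _) hf.
have -> : (fun s => f ((s - a) / 1)) = (fun s => f (s - a)).
  by apply/funext => s; rewrite divr1.
by rewrite invr1 mul1r mulr1.
Qed.

Lemma has_deriv_spline f f' t : (forall s, has_deriv f s (f' s)) ->
  has_deriv (spline f) t (spline f' t).
Proof.
move=> hf; have sh a := @has_deriv_shift f f' a t hf.
have h1 := has_derivB (hf t) (has_derivZ (c := 3) (sh 1)).
have h2 := has_derivB h1 (has_derivZ (c := - 3) (sh 2)).
have h3 := has_derivB h2 (sh 3); rewrite /has_deriv.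
have -> : spline f' t = f' t - 3 * f' (t - 1) - -3 * f' (t - 2) - f' (t - 3).
  by rewrite /spline; ring.
apply: cvg_trans h3; apply: near_eq_cvg; apply: nearW => h /=; rewrite /spline; ring.
Qed.

Lemma spline_continuous f : continuous f -> continuous (spline f).
Proof.
move=> cf t; have sh (a : R) : {for t, continuous (fun s => f (s - a))}.
  by apply: continuous_comp; [apply: cvgB; [exact: cvg_id|exact: cvg_cst]|exact: cf].
apply: cvgB; last exact: sh.
apply: cvgD; last by apply: cvgMl_tmp; exact: sh.
by apply: cvgB; [exact: cf|apply: cvgMl_tmp; exact: sh].
Qed.

Lemma pos_continuous : continuous pos.
Proof. by move=> t; apply: continuous_max; [exact: cvg_cst|exact: cvg_id]. Qed.

Lemma has_deriv_continuous f f' : (forall t, has_deriv f t (f' t)) -> continuous f.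
Proof.
move=> hf t; apply: differentiable_continuous; apply/derivable1_diffP.
by have /has_derivP [] := hf t.
Qed.

Definition step t : R := 6^-1 * spline (fun s => pos s ^+ 3) t.
Definition bump t : R := 2^-1 * spline (fun s => pos s ^+ 2) t.
Definition bump' t : R := spline pos t.

Lemma has_deriv_step t : has_deriv step t (bump t).
Proof.
have h := has_derivZ (c := 6^-1) (@has_deriv_spline _ _ t (@has_deriv_pos3)).
rewrite /bump; suff <- : 6^-1 * spline (fun s => 3 * pos s ^+ 2) t = 2^-1 * spline (fun s => pos s ^+ 2) t by [].
by rewrite /spline; field.
Qed.

Lemma has_deriv_bump t : has_deriv bump t (bump' t).
Proof.
have h := has_derivZ (c := 2^-1) (@has_deriv_spline _ _ t (@has_deriv_pos2)).
rewrite /bump'; suff <- : 2^-1 * spline (fun s => 2 * pos s) t = spline pos t by [].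
by rewrite /spline; field.
Qed.

Lemma bump_continuous : continuous bump.
Proof. exact: has_deriv_continuous (@has_deriv_bump). Qed.

Lemma bump'_continuous : continuous bump'.
Proof. exact/spline_continuous/pos_continuous. Qed.

Lemma pos_le0 t : t <= 0 -> pos t = 0. Proof. by move=> h; rewrite /pos max_l. Qed.
Lemma pos_ge0 t : 0 <= t -> pos t = t. Proof. by move=> h; rewrite /pos max_r. Qed.

Lemma step_le0 t : t <= 0 -> step t = 0.
Proof. by move=> h; rewrite /step /spline !pos_le0 ?expr0n /=; try lra; ring. Qed.

Lemma step_ge3 t : 3 <= t -> step t = 1.
Proof. by move=> h; rewrite /step /spline !pos_ge0; try lra; field. Qed.

Lemma bump_le0 t : t <= 0 -> bump t = 0.
Proof. by move=> h; rewrite /bump /spline !pos_le0 ?expr0n /=; try lra; ring. Qed.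

Lemma bump_ge3 t : 3 <= t -> bump t = 0.
Proof. by move=> h; rewrite /bump /spline !pos_ge0; try lra; field. Qed.

(** On [0 < t < 3] the four truncated squares lie between 0 and 9, and the absolute coefficients of
    the third difference add up to 8, whence [8 * 9 / 2 = 36]. *)
Lemma bump_bound t : `|bump t| <= 36.
Proof.
have [h0|h0] := leP t 0; first by rewrite bump_le0// normr0.
have [h3|h3] := leP 3 t; first by rewrite bump_ge3// normr0.
have p (a : R) : 0 <= a -> 0 <= pos (t - a) ^+ 2 <= 9.
  rewrite /pos => a0; case: (lerP 0 (t - a)) => h; rewrite ?expr0n /=; first by apply/andP; split; nra.
  by rewrite lexx ler0n.
have := p 0; have := p 1; have := p 2; have := p 3; rewrite subr0.
move=> /(_ ltac:(lra))/andP[? ?] /(_ ltac:(lra))/andP[? ?] /(_ ltac:(lra))/andP[? ?] /(_ ltac:(lra))/andP[? ?].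
by rewrite ler_norml /bump /spline; apply/andP; split; lra.
Qed.

End RealDerivative.

(** * Approximate identities at Lebesgue points *)

Section Kernel.
Context {R : realType}.
Variable T : R.
Hypothesis T_gt0 : 0 < T.
Local Notation mu := (@lebesgue_measure R).
Local Notation I := (`]0, T[%classic : set R).
Implicit Types (f F h eta : R -> R) (s t a b e p q : R).

Lemma integrable_continuous f p q : continuous f -> mu.-integrable `[p, q] (EFin \o f).
Proof.
move=> cf; apply: continuous_compact_integrable; first exact: segment_compact.
exact: continuous_subspaceT.
Qed.

Lemma Rint_deriv0 F f t : continuous f -> (forall s, has_deriv F s (f s)) -> 0 <= t ->
  \int[mu]_(r in `]0, t[) f r = F t - F 0.
Proof.
move=> cf dF; rewrite le_eqVlt => /orP[/eqP <-|t0].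
  by rewrite set_itv_ge ?Rintegral_set0 ?subrr// bnd_simp ltxx.
have i1 := integrable_continuous 0 t cf.
rewrite Rintegral_itv_bndo_bndc; last first.
  by apply: integrableS i1 => //; move=> r /=; rewrite !in_itv/= => /andP[/ltW -> /ltW ->].
rewrite Rintegral_itv_obnd_cbnd; last first.
  by apply: integrableS i1 => //; move=> r /=; rewrite !in_itv/= => /andP[/ltW -> ->].
have cF : continuous F by exact: has_deriv_continuous dF.
rewrite /Rintegral (@continuous_FTC2 _ f F 0 t t0)//.
- exact: continuous_subspaceT.
- split=> [s _||]; first by have /has_derivP [] := dF s.
    by apply: cvg_at_right_filter; exact: cF.
  by apply: cvg_at_left_filter; exact: cF.
- by move=> s _; rewrite derive1E; have /has_derivP [_] := dF s.
Qed.

Lemma Rint_deriv F f s t : continuous f -> (forall s, has_deriv F s (f s)) ->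
  0 <= s -> s <= t -> t <= T -> \int[mu]_(r in slice s t) f r = F t - F s.
Proof.
move=> cf dF s0 st tT.
have If : mu.-integrable I (EFin \o f).
  apply: integrableS (integrable_continuous 0 T cf) => //.
  by move=> r /=; rewrite !in_itv/= => /andP[/ltW -> /ltW ->].
have := Rint_slice st tT If; rewrite !(Rint_deriv0 cf dF)//; last exact: le_trans st.
by move=> h; lra.
Qed.

Definition scalar_test eta eta' : Prop :=
  [/\ continuous eta', forall t, has_deriv eta t (eta' t) &
      exists p q, [/\ 0 < p, q < T & forall t, eta t != 0 -> p <= t <= q]].

(** An approximate identity supported in [[a, a + 3 e]], with primitive [stair]. The support lies to
    the right of [a]; at a Lebesgue point a one-sided window does as well as a centred one. *)
Definition kern a e t := e^-1 * bump ((t - a) / e).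
Definition stair a e t := step ((t - a) / e).

Lemma has_deriv_stair a e t : e != 0 -> has_deriv (stair a e) t (kern a e t).
Proof. by move=> e0; apply: has_deriv_affine => // s; exact: has_deriv_step. Qed.

Lemma kern_continuous a e : continuous (kern a e).
Proof.
move=> t; apply: cvgMl_tmp; apply: continuous_cvg; first exact: bump_continuous.
by apply: cvgMr_tmp; apply: cvgB; [exact: cvg_id|exact: cvg_cst].
Qed.

Lemma kern_out a e t : 0 < e -> ~~ (a < t < a + 3 * e) -> kern a e t = 0.
Proof.
move=> e0; rewrite negb_and -!leNgt => /orP[h|h].
  by rewrite /kern bump_le0 ?mulr0// pmulr_lle0 ?invr_gt0// subr_le0.
by rewrite /kern bump_ge3 ?mulr0// ler_pdivlMr//; lra.
Qed.

Lemma kern_supp a e t : 0 < e -> kern a e t != 0 -> a <= t <= a + 3 * e.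
Proof.
move=> e0; apply: contraNT; rewrite negb_and -!ltNge => h; apply/eqP/kern_out => //.
by rewrite negb_and -!leNgt; case/orP: h => /ltW ->; rewrite ?orbT.
Qed.

Lemma kern_bound : exists2 c : R, 0 < c & forall a e t, 0 < e -> `|kern a e t| <= c / e.
Proof.
exists 36 => // a e t e0; rewrite /kern normrM gtr0_norm ?invr_gt0// mulrC.
by apply: ler_wpM2r; [rewrite invr_ge0 ltW|exact: bump_bound].
Qed.

Lemma kern_test a e : 0 < a -> 0 < e -> a + 3 * e < T ->
  scalar_test (kern a e) (fun t => e^-1 * (e^-1 * bump' ((t - a) / e))).
Proof.
move=> a0 e0 aT; split.
- move=> t; do 2 apply: cvgMl_tmp; apply: continuous_cvg; first exact: bump'_continuous.
  by apply: cvgMr_tmp; apply: cvgB; [exact: cvg_id|exact: cvg_cst].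
- move=> t; apply: has_derivZ; apply: has_deriv_affine; rewrite ?gt_eqF// => s.
  exact: has_deriv_bump.
- by exists a, (a + 3 * e); split=> // t; exact: kern_supp.
Qed.

(** A single kernel has integral 1, hence no compactly supported primitive; a difference of two has
    one, because both stairs end at 1. These test functions detect constancy. *)
Lemma stair_test a b e : 0 < a -> a <= b -> 0 < e -> b + 3 * e < T ->
  scalar_test (fun t => stair a e t - stair b e t) (fun t => kern a e t - kern b e t).
Proof.
move=> a0 ab e0 bT; split.
- by move=> t; apply: cvgB; exact: kern_continuous.
- by move=> t; apply: has_derivB; apply: has_deriv_stair; rewrite gt_eqF.
- exists a, (b + 3 * e); split=> // t; apply: contraNT.
  rewrite negb_and -!ltNge /stair => /orP[h|h]; apply/eqP.
    rewrite !step_le0 ?subrr// pmulr_lle0 ?invr_gt0// subr_le0; last exact: ltW.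
    by apply/ltW; apply: lt_le_trans ab.
  by rewrite !step_ge3 ?subrr// ler_pdivlMr//; lra.
Qed.

Lemma Rint_kern a e : 0 < a -> 0 < e -> a + 3 * e < T -> \int[mu]_(t in I) kern a e t = 1.
Proof.
move=> a0 e0 aT.
rewrite (@Rint_deriv0 (stair a e))//; last exact: ltW.
- rewrite /stair step_ge3 ?step_le0 ?subr0//.
    by rewrite pmulr_lle0 ?invr_gt0// sub0r oppr_le0 ltW.
  by rewrite ler_pdivlMr//; lra.
- exact: kern_continuous.
- by move=> s; apply: has_deriv_stair; rewrite gt_eqF.
Qed.

Lemma integrable_bounded_mul h eta (c : R) : mu.-integrable I (EFin \o h) -> continuous eta ->
  (forall t, I t -> `|eta t| <= c) -> mu.-integrable I (EFin \o (fun t => eta t * h t)).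
Proof.
move=> ih ce ec; have mI : measurable I by exact: measurable_itv.
have ih2 : mu.-integrable I (EFin \o (fun t => c * `|h t|)).
  by apply: integrable_scale => //; have := integrable_norm ih; exact: eq_integrable.
apply: (integrable_le (T := T) mI _ _ ih2) => //.
  have mh : measurable_fun I h by apply/measurable_EFinP; exact: measurable_int ih.
  apply: measurable_funM => //.
  by apply: measurable_funTS; exact: continuous_measurable_fun.
by move=> t It; rewrite normrM ler_wpM2r// ec.
Qed.

(** The kernel is at most [c / e] and lives in the ball of radius [3 e], of measure [6 e]; the error
    is thus at most [6 c] times the mean oscillation of [h] around [a], whence the threshold
    [d / (6 c)]. *)
Lemma kern_approx h a (d : R) : I a -> mu.-integrable I (EFin \o h) -> lebesgue_pt (h \_ I) a ->
  0 < d -> \forall e \near 0^'+, a + 3 * e < T /\ `|\int[mu]_(t in I) (kern a e t * h t) - h a| <= d.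
Proof.
move=> Ia ih la d0; have /andP[a0 aT] : 0 < a < T by move: Ia; rewrite /= in_itv.
have mI : measurable I by exact: measurable_itv.
have [c c0 kc] := kern_bound.
have d6 : 0 < d / (6 * c) by rewrite divr_gt0// mulr_gt0.
have [r0 /= r00 hr0] : exists2 r0 : R, 0 < r0 & forall r, 0 < r -> r < r0 ->
    (davg (h \_ I) a r < (d / (6 * c))%:E)%E.
  have : \forall r \near 0^'+, (davg (h \_ I) a r < (d / (6 * c))%:E)%E.
    have /fine_cvgP [fin0 /cvgr_lt /(_ _ d6)] := la.
    by apply: filterS2 fin0 => r /fineK <- /=; rewrite lte_fin.
  move=> [r0 /= r00 hr]; exists r0 => // r r1 r2; apply: hr => //=.
  by rewrite sub0r normrN gtr0_norm.
(* For [e < m] the ball of radius [3 e] around [a] stays inside [I] and is small enough for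
   [hr0]. *)
pose m := Num.min (r0 / 3) (Num.min (a / 3) ((T - a) / 3)).
have m0 : 0 < m by rewrite /m !lt_min !divr_gt0// subr_gt0.
near=> e.
have e0 : 0 < e by near: e; exact: nbhs_right_gt.
have em : e < m by near: e; exact: nbhs_right_lt.
have /and3P[er ea eT] : [&& 3 * e < r0, 3 * e < a & 3 * e < T - a].
  by move: em; rewrite /m !lt_min => /and3P[? ? ?]; apply/and3P; split; lra.
have aeT : a + 3 * e < T by lra.
split=> //; set B := ball a (3 * e).
have mB : measurable B by exact: measurable_ball.
have BI : B `<=` I.
  move=> t; rewrite /B -ball_normE /ball_/= in_itv/= ltr_norml => /andP[h1 h2].
  by apply/andP; split; lra.
have i3 := integrable_bounded_mul ih (@kern_continuous a e) (fun t _ => kc a e t e0).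
have ic := integrable_bounded_mul (integrable_cst_I T_gt0 (h a)) (@kern_continuous a e) (fun t _ => kc a e t e0).
have ihc : mu.-integrable I (EFin \o (fun t => h t - h a)).
  have := integrable_sum mI ih (integrable_cst_I T_gt0 (- h a)); exact: eq_integrable.
have iG : mu.-integrable I (EFin \o (fun t => `|h t - h a|)).
  by have := integrable_norm ihc; exact: eq_integrable.
have iK := integrable_bounded_mul ihc (@kern_continuous a e) (fun t _ => kc a e t e0).
have iN : mu.-integrable I (EFin \o (fun t => `|kern a e t * (h t - h a)|)).
  by have := integrable_norm iK; exact: eq_integrable.
have -> : \int[mu]_(t in I) (kern a e t * h t) - h a = \int[mu]_(t in I) (kern a e t * (h t - h a)).
  have -> : \int[mu]_(t in I) (kern a e t * (h t - h a)) =
     \int[mu]_(t in I) (kern a e t * h t - kern a e t * cst (h a) t).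
    by apply: eq_Rintegral => t _ /=; ring.
  rewrite RintegralB//; congr (_ - _); rewrite RintegralZr.
  - by rewrite Rint_kern// mul1r.
  - exact: mI.
  - apply: integrableS (integrable_continuous 0 T (@kern_continuous a e)) => //.
    by move=> r /=; rewrite !in_itv/= => /andP[/ltW -> /ltW ->].
have hle := le_normr_Rintegral _ iK; apply: (le_trans (hle mI)).
have -> : I = B `|` (I `\` B) by rewrite setDUK.
rewrite Rintegral_setU//; last 3 first.
- exact: measurableD.
- by rewrite setDUK.
- by apply/disj_setPS => t [tB [_ ntB]]; exact: ntB.
have -> : \int[mu]_(t in I `\` B) `|kern a e t * (h t - h a)| = 0.
  rewrite (@eq_Rintegral _ _ _ mu _ (fun=> 0)); last first.
    move=> t; rewrite inE => -[It nB]; rewrite kern_out ?mul0r ?normr0//.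
    apply/negP => /andP[h1 h2]; apply: nB; rewrite /B -ball_normE /ball_/= ltr_norml.
    by apply/andP; split; lra.
  by rewrite Rintegral_cst ?mul0r//; exact: measurableD.
rewrite addr0; apply: le_trans (_ : \int[mu]_(t in B) (c / e * `|h t - h a|) <= _).
  apply: le_Rintegral => //; [exact: integrableS iN|apply: integrable_scale => //; exact: integrableS iG|].
  by move=> t _; rewrite normrM ler_wpM2r// kc.
rewrite RintegralZl//; last exact: integrableS iG.
have := hr0 (3 * e) ltac:(by rewrite mulr_gt0) er; rewrite /davg /iavg.
rewrite lebesgue_measure_ball; last by rewrite mulr_ge0// ltW.
rewrite inver gt_eqF; last by rewrite mulrn_wgt0// mulr_gt0.
have -> : (\int[mu]_(y in ball a (3 * e)) `|((center ((h \_ I) a) \o h \_ I) y)%:E|)%E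
   = (\int[mu]_(t in B) `|h t - h a|)%:E.
  rewrite /Rintegral fineK; last by apply: integrable_fin_num => //; exact: integrableS iG.
  apply: eq_integral => t; rewrite inE => /BI It /=.
  by rewrite !patchE !mem_set.
rewrite -EFinM lte_fin -(mulr_natl (3 * e) 2) => hd.
set X := \int[mu]_(t in B) _ in hd *.
have e6 : 0 < 2 * (3 * e) by rewrite !mulr_gt0.
move: hd; rewrite mulrC ltr_pdivrMr// => hX.
have {}hX : X <= d / c * e.
  by apply: le_trans (ltW hX) _; rewrite le_eqVlt; apply/orP; left; apply/eqP; field; rewrite gt_eqF.
rewrite mulrAC ler_pdivrMr//.
by move: hX; rewrite mulrAC ler_pdivlMr// mulrC.
Unshelve. all: by end_near. Qed.

End Kernel.

(** * Test functions and weak derivatives *)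

Section TestFunctions.
Local Open Scope complex_scope.
Context {R : realType} {V : hilbertType R}.
Variable T : R.
Hypothesis T_gt0 : 0 < T.
Local Notation mu := (@lebesgue_measure R).
Local Notation I := (`]0, T[%classic : set R).
Implicit Types (phi u v w k g : R -> V) (x : V).

Lemma tderiveP phi t l :
  tquotient phi t h @[h --> 0^'] --> l -> tderivable phi t /\ tderive phi t = l.
Proof.
by move=> h; split; [apply/cvg_ex; exists l|rewrite /tderive; apply: cvg_lim].
Qed.

Lemma tderivable_cvg phi t : tderivable phi t -> tquotient phi t h @[h --> 0^'] --> tderive phi t.
Proof. by []. Qed.

Lemma tderive_op (A : V -> V) a phi t : linear A -> (forall y, hnorm (A y) <= a * hnorm y) ->
  tderivable phi t ->
  tderivable (fun s => A (phi s)) t /\ tderive (fun s => A (phi s)) t = A (tderive phi t).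
Proof.
move=> lA bA /tderivable_cvg h; apply: tderiveP.
have -> : tquotient (fun s => A (phi s)) t = (fun h => A (tquotient phi t h)).
  by apply/funext => r; rewrite /tquotient (linear_opZ lA) (linear_opB lA).
exact: bounded_cvg bA h.
Qed.

Lemma scale_linear (c : R[i]) : linear (fun x : V => c *: x).
Proof. by move=> a x y; rewrite scalerDr !scalerA mulrC. Qed.

Lemma hnormI_le (y : V) : hnorm ('i *: y) <= 1 * hnorm y.
Proof. by rewrite hnormI mul1r. Qed.

Lemma Cc_out phi t : Cc T phi -> ~ I t -> phi t = 0.
Proof.
move=> [_ sI] nI; apply: contrapT => p0; apply/nI/sI/subset_closure/eqP; exact: p0.
Qed.

Lemma Cc_comp (A : V -> V) phi : A 0 = 0 -> Cc T phi -> Cc T (fun t => A (phi t)).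
Proof.
move=> A0 [cK sI].
have sub : closure [set t | A (phi t) != 0] `<=` closure [set t | phi t != 0].
  by apply: closure_subset => t /=; apply: contraNN => /eqP ->; rewrite A0.
split; last exact: subset_trans sI.
by apply: subclosed_compact cK sub; exact: closed_closure.
Qed.

Section Fixed.
Variables (D : set V) (H : V -> V).
Hypothesis selfH : selfadjoint D H.

Lemma test_continuous phi : test_fun T D H phi -> continuous phi.
Proof.
move=> [[_ _ gn] _] t; apply/hnorm_cvgP => e e0.
move/cvgrPdist_lt : (gn t) => /(_ e e0); apply: filterS => s.
rewrite sub0r normrN /graph_norm ger0_norm ?addr_ge0 ?hnorm_ge0//.
by apply: le_lt_trans; rewrite lerDl hnorm_ge0.
Qed.

Lemma test_H_continuous phi : test_fun T D H phi -> continuous (H \o phi).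
Proof.
move=> [[_ Dp gn] _] t; apply/hnorm_cvgP => e e0.
move/cvgrPdist_lt : (gn t) => /(_ e e0); apply: filterS => s.
rewrite sub0r normrN /graph_norm ger0_norm ?addr_ge0 ?hnorm_ge0//.
by apply: le_lt_trans; rewrite /= -(sa_HB selfH)// lerDr hnorm_ge0.
Qed.

Lemma L2_continuous w : continuous w -> L2 T w.
Proof. by move=> cw; apply: L2_within => //; exact: continuous_subspaceT. Qed.

Lemma test_L2 phi : test_fun T D H phi -> L2 T phi.
Proof. by move=> tp; apply: L2_continuous; exact: test_continuous tp. Qed.

Lemma test_deriv_L2 phi : test_fun T D H phi -> L2 T (tderive phi).
Proof. by move=> [_ [_ _ c]]; exact: L2_continuous. Qed.

Lemma test_H_L2 phi : test_fun T D H phi -> L2 T (fun t => H (phi t)).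
Proof. by move=> tp; apply: L2_continuous; exact: test_H_continuous tp. Qed.

Lemma schrodinger_L2 phi : test_fun T D H phi -> L2 T (schrodinger H phi).
Proof.
move=> tp; apply: L2B; last exact: test_H_L2.
by apply: L2Z; exact: test_deriv_L2 tp.
Qed.

Lemma test_i phi : test_fun T D H phi ->
  test_fun T D H (fun t => 'i *: phi t) /\
  forall t, tderive (fun t => 'i *: phi t) t = 'i *: tderive phi t.
Proof.
move=> [[cc Dp gn] [_ dp cd]].
have d t := tderive_op (scale_linear 'i) hnormI_le (dp t).
have cci : Cc T (fun t => 'i *: phi t) by apply: (@Cc_comp (fun x => 'i *: x)) => //; rewrite scaler0.
split; last by move=> t; case: (d t).
split; split=> //.
- by move=> t; apply: (sa_DZ selfH).
- move=> t; move: (gn t); rewrite /graph_norm.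
  suff -> : (fun s => hnorm ('i *: phi s - 'i *: phi t) + hnorm (H ('i *: phi s - 'i *: phi t)))
   = (fun s => hnorm (phi s - phi t) + hnorm (H (phi s - phi t))) by [].
  apply/funext => s; rewrite -scalerBr hnormI (sa_HZ selfH) ?hnormI//.
  exact: (sa_DB selfH).
- by move=> t; case: (d t).
- have -> : tderive (fun t => 'i *: phi t) = (fun t => 'i *: tderive phi t).
    by apply/funext => t; case: (d t).
  by move=> t; apply: cvgZl_tmp; exact: cd.
Qed.

Definition weakR u g : Prop := forall phi, test_fun T D H phi ->
  \int[mu]_(t in I) rinner (u t) (schrodinger H phi t) = \int[mu]_(t in I) rinner (g t) (phi t).

(** Testing with ['i *: phi] turns the real part of the identity into its imaginary part, so one
    real integral carries the whole complex equation. *)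
Lemma weakRP u g : weak_schrodinger T D H u g <-> weakR u g.
Proof.
split=> [h phi tp|h phi tp]; first by have [] := h phi tp.
rewrite /L2inner; congr Complex; first exact: h.
have [ti di] := test_i tp.
under eq_Rintegral do rewrite Im_inner.
under [RHS]eq_Rintegral do rewrite Im_inner.
rewrite -h//; apply: eq_Rintegral => t _; congr rinner.
rewrite /schrodinger di (sa_HZ selfH) ?scalerBr//.
by case: tp => -[].
Qed.

Lemma test_primitive phi : test_fun T D H phi -> primitive_of T (tderive phi) phi.
Proof.
move=> tp s t s0 st tT; apply: rinner_ext => x.
have ld := test_deriv_L2 tp; have [_ [_ dp cd]] := tp.
rewrite (rinner_weak_integral T_gt0)//; [|exact: measurable_slice|exact: slice_sub].
rewrite (@Rint_deriv R T (fun r => rinner (phi r) x))//.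
- by rewrite rinnerDl rinnerNl.
- by move=> r; apply: cvg_rinner; [exact: cd|exact: cvg_cst].
- move=> r; rewrite /has_deriv.
  have -> : (fun h => h^-1 * (rinner (phi (r + h)) x - rinner (phi r) x)) =
    (fun h => rinner (tquotient phi r h) x).
    by apply/funext => h; rewrite /tquotient !rinnerE.
  by apply: cvg_rinner; [exact: dp|exact: cvg_cst].
Qed.

(** These products are the test functions that localise a weak equation in time; the graph norm of
    an increment is [|eta s - eta t|] times a constant. *)
Lemma scalar_test_fun eta eta' x : scalar_test T eta eta' -> D x ->
  test_fun T D H (fun t => (eta t)%:C *: x) /\
  forall t, tderive (fun t => (eta t)%:C *: x) t = (eta' t)%:C *: x.
Proof.
move=> [ce' de [p [q [p0 qT pq]]]] Dx.
have ce : continuous eta by exact: has_deriv_continuous de.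
have cv (f : R -> R) t : {for t, continuous f} -> (f s)%:C *: x @[s --> t] --> (f t)%:C *: x.
  move=> cf; apply/hnorm_cvgP => e e0.
  have x1 : 0 < hnorm x + 1 by rewrite ltr_wpDl// hnorm_ge0.
  have /cvgrPdist_lt /(_ (e / (hnorm x + 1))) := cf; rewrite divr_gt0// => /(_ isT).
  apply: filterS => s; rewrite distrC ltr_pdivlMr// => h.
  rewrite -scalerBl -rmorphB hnormZ; apply: le_lt_trans h.
  by rewrite ler_wpM2l// lerDl.
have d t : tderivable (fun t => (eta t)%:C *: x) t /\
   tderive (fun t => (eta t)%:C *: x) t = (eta' t)%:C *: x.
  apply: tderiveP.
  have -> : tquotient (fun t => (eta t)%:C *: x) t = (fun h => (h^-1 * (eta (t + h) - eta t))%:C *: x).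
    by apply/funext => h; rewrite /tquotient -scalerBl scalerA -rmorphB -rmorphM.
  apply/hnorm_cvgP => e e0.
  have x1 : 0 < hnorm x + 1 by rewrite ltr_wpDl// hnorm_ge0.
  have /cvgrPdist_lt /(_ (e / (hnorm x + 1))) := de t; rewrite divr_gt0// => /(_ isT).
  apply: filterS => s; rewrite distrC ltr_pdivlMr// => h.
  rewrite -scalerBl -rmorphB hnormZ; apply: le_lt_trans h.
  by rewrite ler_wpM2l// lerDl.
have cc : Cc T (fun t => (eta t)%:C *: x).
  have sub : closure [set t | (eta t)%:C *: x != 0] `<=` `[p, q]%classic.
    have cl : closed (`[p, q]%classic : set R) by exact: interval_closed.
    rewrite [X in _ `<=` X]((closure_id _).1 cl).
    apply: closure_subset => t /= h; rewrite in_itv/=; apply: pq.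
    by apply: contraNN h => /eqP ->; rewrite scale0r.
  split; first by apply: subclosed_compact (segment_compact (a := p) (b := q)) sub; exact: closed_closure.
  move=> t /sub; rewrite /= !in_itv/= => /andP[pt tq].
  by rewrite (lt_le_trans p0 pt) (le_lt_trans tq qT).
split; last by move=> t; case: (d t).
split; split=> //.
- by move=> t; exact: (sa_DZ selfH).
- move=> t; rewrite /graph_norm.
  have -> : (fun s => hnorm ((eta s)%:C *: x - (eta t)%:C *: x) + hnorm (H ((eta s)%:C *: x - (eta t)%:C *: x)))
    = (fun s => `|eta s - eta t| * (hnorm x + hnorm (H x))).
    apply/funext => s; rewrite -scalerBl -rmorphB (sa_HZ selfH)// !hnormZ; ring.
  have hn : `|eta s - eta t| @[s --> t] --> (0 : R).
    apply/cvgrPdist_lt => e e0; have /cvgrPdist_lt /(_ e e0) := ce t; apply: filterS => s.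
    by rewrite sub0r normrN normr_id distrC.
  have := cvgMr_tmp (b := hnorm x + hnorm (H x)) hn.
  by rewrite mul0r; apply.
- by move=> t; case: (d t).
- have -> : tderive (fun t => (eta t)%:C *: x) = (fun t => (eta' t)%:C *: x).
    by apply/funext => t; case: (d t).
  by move=> t; apply: cv; exact: ce'.
Qed.

End Fixed.

Lemma slice0 t : slice 0 t = `]0, t[%classic :> set R.
Proof.
rewrite /slice; have -> : `]0, 0[%classic = set0 :> set R.
  by apply/seteqP; split => r //=; rewrite in_itv/= lt_asym.
by rewrite setD0.
Qed.

Lemma primitive_test D H (selfH : selfadjoint D H) w k phi : L2 T w -> L2 T k -> primitive_of T k w ->
  test_fun T D H phi ->
  \int[mu]_(t in I) rinner (w t) (tderive phi t) = - \int[mu]_(t in I) rinner (k t) (phi t).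
Proof.
move=> lw lk kw tp; have lp := test_L2 tp; have ld := test_deriv_L2 tp.
have mI := @measurable_I R T.
have := primitive_of_by_parts T_gt0 lk ld lw lp kw (test_primitive tp) (lexx 0) (ltW T_gt0) (lexx T).
have out t : ~ I t -> phi t = 0 by case: tp => -[cc _ _] _; exact: Cc_out cc.
rewrite !out; [|by rewrite /= in_itv/= ltxx ?andbF..].
rewrite !rinner0r subrr slice0 RintegralD; first by move=> h; lra.
- exact: mI.
- exact: (integrable_rinner mI (@subset_refl _ _) lk lp).
- exact: (integrable_rinner mI (@subset_refl _ _) lw ld).
Qed.

(** * Weak derivatives evaluated at Lebesgue points *)

Lemma ae_exists_I (P : R -> Prop) : {ae mu, forall t, P t} -> exists t, I t /\ P t.
Proof.
move=> aeP; apply: contrapT => nP.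
have : mu.-negligible I.
  by apply: negligibleS aeP => t It /= Pt; apply: nP; exists t.
move=> /(negligibleP mu (@measurable_I R T)) h0.
have : (mu I = T%:E)%E by rewrite lebesgue_measure_itv/= lte_fin T_gt0 sube0.
by move=> h1; move: T_gt0; rewrite -lte_fin -h1 [X in (_ < X)%E]h0 ltxx.
Qed.

(** Du Bois-Reymond at two Lebesgue points: the test function [stair a e - stair b e] has derivative
    [kern a e - kern b e], whose integral against [h] tends to [h a - h b]. *)
Lemma scalar_dbr (h : R -> R) a b : mu.-integrable I (EFin \o h) ->
  (forall eta eta', scalar_test T eta eta' -> \int[mu]_(t in I) (eta' t * h t) = 0) ->
  I a -> I b -> a <= b -> lebesgue_pt (h \_ I) a -> lebesgue_pt (h \_ I) b -> h a = h b.
Proof.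
move=> ih hh Ia Ib ab la lb; apply/eqP; rewrite -subr_eq0 -normr_le0.
apply/ler_addgt0Pl => d d0; rewrite addr0; have d2 : 0 < d / 2 by rewrite divr_gt0.
have /andP[a0 _] : 0 < a < T by move: Ia; rewrite /= in_itv.
have [e [[_ ea] [[be eb] e0]]] := @filter_ex _ _ _ _ (filterI (kern_approx T_gt0 Ia ih la d2)
   (filterI (kern_approx T_gt0 Ib ih lb d2) (nbhs_right_gt 0))).
have [c c0 kc] := @kern_bound R.
have := hh _ _ (stair_test a0 ab e0 be).
have -> : \int[mu]_(t in I) ((kern a e t - kern b e t) * h t) =
   \int[mu]_(t in I) (kern a e t * h t) - \int[mu]_(t in I) (kern b e t * h t).
  rewrite -RintegralB//.
  - by apply: eq_Rintegral => t _; ring.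
  - exact: (integrable_bounded_mul ih (@kern_continuous R a e) (fun t _ => kc a e t e0)).
  - exact: (integrable_bounded_mul ih (@kern_continuous R b e) (fun t _ => kc b e t e0)).
move: ea eb; rewrite !ler_norml => /andP[? ?] /andP[? ?] ?.
by apply/andP; split; lra.
Qed.

Lemma scalar_fundamental (h : R -> R) a : mu.-integrable I (EFin \o h) ->
  (forall eta eta', scalar_test T eta eta' -> \int[mu]_(t in I) (eta t * h t) = 0) ->
  I a -> lebesgue_pt (h \_ I) a -> h a = 0.
Proof.
move=> ih hh Ia la; apply/eqP; rewrite -normr_le0.
apply/ler_addgt0Pl => d d0; rewrite addr0.
have /andP[a0 _] : 0 < a < T by move: Ia; rewrite /= in_itv.
have [e [[ea he] e0]] := @filter_ex _ _ _ _ (filterI (kern_approx T_gt0 Ia ih la d0)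
   (nbhs_right_gt 0)).
by move: he; rewrite (hh _ _ (kern_test a0 e0 ea)) sub0r normrN.
Qed.

(** A countable dense set, enumerated through an injection into [nat]; indices outside the image
    give the vector 0, a void condition. Countability is what lets one null set serve for all test
    vectors. *)
Lemma separable_total : separable_hilbert V ->
  exists s : nat -> V, forall x, (forall n, rinner x (s n) = 0) -> x = 0.
Proof.
move=> [S /pcard_leP [f] dS].
exists (fun n => xget 0 [set y | S y /\ f y = n]) => x h.
apply: dense_rinner0 dS _ => y Sy; rewrite -(h (f y)); congr rinner.
case: xgetP => [z _ [Sz fz]|/(_ y)]; last by case.
by apply: (@inj _ _ _ f); rewrite ?inE.
Qed.

Lemma ae_lebesgue_pt (h : R -> R) : mu.-integrable I (EFin \o h) ->
  {ae mu, forall t, lebesgue_pt (h \_ I) t}.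
Proof.
move=> ih; apply: lebesgue_differentiation; apply: integrable_locally ih.
exact: measurable_I.
Qed.

Lemma continuous_scalar_test eta eta' : scalar_test T eta eta' ->
  continuous eta /\ continuous eta'.
Proof. by move=> [c d _]; split=> //; exact: has_deriv_continuous d. Qed.

Lemma integrable_scalar_rinner (eta : R -> R) u v : continuous eta -> L2 T u -> L2 T v ->
  mu.-integrable I (EFin \o (fun t => eta t * rinner (u t) (v t))).
Proof.
move=> ce lu lv.
have [c _ hc] := @EVT_max R (fun t => `|eta t|) 0 T (ltW T_gt0)
  (continuous_subspaceT (fun t => @cvg_norm _ _ _ _ _ _ _ (ce t))).
apply: (@integrable_bounded_mul R T _ _ `|eta c|) => //.
  exact: (integrable_rinner (@measurable_I R T) (@subset_refl _ _) lu lv).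
by move=> t; rewrite /= in_itv => /andP[/ltW t0 /ltW tT]; apply: hc; rewrite in_itv/= t0.
Qed.

(** [v - primitive k] has zero weak derivative against each vector of a countable total family.
    Outside one null set every time is a Lebesgue point of all these pairings, and any such [t0]
    provides the constant. *)
Lemma vector_dbr (sepV : separable_hilbert V) v k : L2 T v -> L2 T k ->
  (forall eta eta' x, scalar_test T eta eta' ->
    \int[mu]_(t in I) (eta' t * rinner (v t) x) = - \int[mu]_(t in I) (eta t * rinner (k t) x)) ->
  exists c, L2eq T v (fun t => c + primitive k t).
Proof.
move=> lv lk hv; have [s hs] := separable_total sepV.
have lw : L2 T (primitive k) by apply: L2_within => //; exact: primitive_within.
have lc x : L2 T (fun=> x) by exact: L2_cst.
have mI := @measurable_I R T.
pose d t := v t - primitive k t; have ld : L2 T d by exact: L2B.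
have id x : mu.-integrable I (EFin \o (fun t => rinner (d t) x)) by exact: (integrable_rinner_cst T_gt0 x mI (@subset_refl _ _) ld).
(* For the zero operator every [eta(t) x] is a test function, so [primitive_test] can be used with
   an arbitrary vector [x]. *)
have zero : selfadjoint [set: V] (fun=> 0 : V).
  apply: symmetric_selfadjoint => [a x y|x y]; first by rewrite scaler0 addr0.
  by rewrite rinner0l rinner0r.
have dz x eta eta' : scalar_test T eta eta' -> \int[mu]_(t in I) (eta' t * rinner (d t) x) = 0.
  move=> st; have [ce ce'] := continuous_scalar_test st.
  have [tp dp] := @scalar_test_fun [set: V] _ zero eta eta' x st Logic.I.
  have pk : primitive_of T k (primitive k) by move=> *; exact: (primitiveB T_gt0).
  have := primitive_test zero lw lk pk tp.
  have -> : \int[mu]_(t in I) (eta' t * rinner (d t) x) =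
    \int[mu]_(t in I) (eta' t * rinner (v t) x) - \int[mu]_(t in I) (eta' t * rinner (primitive k t) x).
    rewrite -RintegralB//; try exact: (integrable_scalar_rinner _ _ (lc x)).
    by apply: eq_Rintegral => t _; rewrite /d !rinnerE; ring.
  rewrite (hv _ _ x st).
  under eq_Rintegral do rewrite dp rinnerZr.
  under [X in _ = - X -> _]eq_Rintegral do rewrite rinnerZr.
  by move=> ->; rewrite subrr.
have aeL : {ae mu, forall t, forall n, lebesgue_pt ((fun t => rinner (d t) (s n)) \_ I) t}.
  by apply: ae_foralln => n; exact: ae_lebesgue_pt.
have [t0 [It0 lt0]] := ae_exists_I aeL.
exists (d t0); apply: ae_imp aeL => t lt It.
suff -> : d t0 = d t by rewrite /d subrK.
apply/eqP; rewrite -subr_eq0; apply/eqP/hs => n; rewrite rinnerDl rinnerNl.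
apply/eqP; rewrite subr_eq0; apply/eqP.
have dn := fun eta eta' st => @dz (s n) eta eta' st.
have [tt|/ltW tt] := leP t0 t; first exact: (scalar_dbr (id _) dn It0 It tt).
by apply/esym; apply: (scalar_dbr (id _) dn It It0 tt).
Qed.

(** Test vectors must lie in [D], so the total family is replaced by its image under the resolvent
    at 1. A vector orthogonal to that image has zero resolvent at -1, and resolvents are
    injective. *)
Lemma weakR_uniq (sepV : separable_hilbert V) D H (selfH : selfadjoint D H) u g1 g2 :
  L2 T g1 -> L2 T g2 -> weakR D H u g1 -> weakR D H u g2 -> L2eq T g1 g2.
Proof.
move=> l1 l2 w1 w2; have [s hs] := separable_total sepV.
have n1 : (1 : R) != 0 by exact: oner_neq0.
pose r n := resolvent D H 1 (s n); have Dr n : D (r n) by exact: resolvent_D.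
pose d t := g1 t - g2 t; have ld : L2 T d by exact: L2B.
have id x : mu.-integrable I (EFin \o (fun t => rinner (d t) x)).
  exact: (integrable_rinner_cst T_gt0 x (@measurable_I R T) (@subset_refl _ _) ld).
have aeL : {ae mu, forall t, forall n, lebesgue_pt ((fun t => rinner (d t) (r n)) \_ I) t}.
  by apply: ae_foralln => n; exact: ae_lebesgue_pt.
apply: ae_imp aeL => t lt It; apply/eqP; rewrite -subr_eq0; apply/eqP.
have dz n : rinner (d t) (r n) = 0.
  apply: (@scalar_fundamental (fun t => rinner (d t) (r n))) => // eta eta' st.
  have [ce _] := continuous_scalar_test st.
  have [tp _] := @scalar_test_fun D H selfH eta eta' (r n) st (Dr n).
  have := w1 _ tp; rewrite w2// => h.
  have -> : \int[mu]_(t in I) (eta t * rinner (d t) (r n)) =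
    \int[mu]_(t in I) rinner (g1 t) ((eta t)%:C *: r n) - \int[mu]_(t in I) rinner (g2 t) ((eta t)%:C *: r n).
    rewrite -RintegralB//.
    - by apply: eq_Rintegral => y _; rewrite /d !rinnerE; ring.
    - exact: (integrable_rinner (@measurable_I R T) (@subset_refl _ _) l1 (test_L2 tp)).
    - exact: (integrable_rinner (@measurable_I R T) (@subset_refl _ _) l2 (test_L2 tp)).
  by rewrite h subrr.
have m1 : - (1 : R) != 0 by rewrite oppr_eq0.
have : resolvent D H (- 1) (d t) = 0.
  by apply: hs => n; rewrite (resolvent_adj selfH)// opprK dz.
have [_] := resolventP selfH (d t) m1 => + e.
by rewrite e /shifted (sa_H0 selfH) !scaler0 subr0 => h0; rewrite -[LHS]/(d t) -h0.
Qed.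

End TestFunctions.

(** * Regularity of weak solutions *)

Section Energy.
Local Open Scope complex_scope.
Context {R : realType} {V : hilbertType R}.
Variable T : R.
Hypothesis T_gt0 : 0 < T.
Local Notation mu := (@lebesgue_measure R).
Local Notation I := (`]0, T[%classic : set R).
Implicit Types (phi u v w k g : R -> V) (x : V).

Let mI : measurable I := @measurable_I R T.
Let II : I `<=` I := @subset_refl _ _.

Lemma integrable_normr (h : R -> R) A : measurable A -> mu.-integrable A (EFin \o h) ->
  mu.-integrable A (EFin \o (fun t => `|h t|)).
Proof. by move=> mA ih; have := integrable_norm ih; exact: eq_integrable. Qed.

Lemma ae_exists_itv (P : R -> Prop) p q : p < q -> {ae mu, forall t, P t} ->
  exists t, p < t < q /\ P t.
Proof.
move=> pq aeP; apply: contrapT => nP.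
have mp : measurable (`]p, q[%classic : set R) by exact: measurable_itv.
have : mu.-negligible `]p, q[.
  apply: negligibleS aeP => t /= It Pt; apply: nP; exists t; split=> //.
move=> /(negligibleP mu mp) h0.
have : (mu `]p, q[%classic = (q - p)%:E)%E by rewrite lebesgue_measure_itv/= lte_fin pq EFinB.
by move=> h1; move: pq; rewrite -subr_gt0 -lte_fin -h1 [X in (_ < X)%E]h0 ltxx.
Qed.

Lemma within_ballP w : {within `[0, T], continuous w} <->
  forall t : R, 0 <= t -> t <= T -> forall e : R, 0 < e -> exists2 d : R, 0 < d &
    forall s : R, 0 <= s -> s <= T -> `|t - s| < d -> hnorm (w s - w t) < e.
Proof.
rewrite subspace_continuousP; split=> [h t t0 tT e e0|h t].
  have tT' : `[0, T]%classic t by rewrite /= in_itv/= t0 tT.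
  have /hnorm_cvgP /(_ e e0) [d /= d0 hd] := h t tT'.
  by exists d => // s s0 sT /hd; apply; rewrite /= in_itv/= s0 sT.
rewrite /= in_itv/= => /andP[t0 tT]; apply/hnorm_cvgP => e e0.
have [d d0 hd] := h t t0 tT e e0; exists d => // s /= ts; rewrite in_itv/= => /andP[s0 sT].
exact: hd.
Qed.

Lemma within_ae_uniq w1 w2 : {within `[0, T], continuous w1} -> {within `[0, T], continuous w2} ->
  L2eq T w1 w2 -> forall t : R, 0 <= t -> t <= T -> w1 t = w2 t.
Proof.
move=> /within_ballP c1 /within_ballP c2 aeq t t0 tT; apply/eqP; rewrite -subr_eq0; apply/eqP.
apply: hnorm_small => e e0; have e2 : 0 < e / 2 by rewrite divr_gt0.
have [d1 d10 h1] := c1 t t0 tT _ e2; have [d2 d20 h2] := c2 t t0 tT _ e2.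
move: T_gt0 => T0.
(* Cutting the neighbourhood of [t] down to [[0, T]] treats the endpoints together with interior
   times: the remaining interval still has positive length. *)
pose p := Num.max 0 (Num.max (t - d1) (t - d2)); pose q := Num.min T (Num.min (t + d1) (t + d2)).
have pq : p < q.
  by rewrite /p /q !gt_max !lt_min; apply/and3P; split; apply/and3P; split; lra.
have [s []] := ae_exists_itv pq aeq; rewrite /p /q !gt_max !lt_min.
move=> /andP[/and3P[s0 a1 a2] /and3P[sT b1 b2]] ws.
have {}ws : w1 s = w2 s by apply: ws; rewrite /= in_itv/= s0 sT.
have := h1 s (ltW s0) (ltW sT); have := h2 s (ltW s0) (ltW sT).
rewrite !ltr_norml => /(_ ltac:(apply/andP; split; lra)) k2 /(_ ltac:(apply/andP; split; lra)) k1.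
have := hnorm_dist (w1 s) (w1 t) (w2 t).
have -> : hnorm (w1 s - w2 t) = hnorm (w2 s - w2 t) by rewrite ws.
by rewrite (hnormBC (w1 t) (w1 s)) => h; apply: le_trans h _; lra.
Qed.

Lemma uniform_limit (w : nat -> R -> V) : (forall n, {within `[0, T], continuous (w n)}) ->
  (forall e : R, 0 < e -> exists N, forall m n, (N <= m)%N -> (N <= n)%N ->
    forall t : R, 0 <= t -> t <= T -> hnorm (w m t - w n t) <= e) ->
  exists2 l, {within `[0, T], continuous l} &
    forall e : R, 0 < e -> exists N, forall n, (N <= n)%N ->
      forall t : R, 0 <= t -> t <= T -> hnorm (w n t - l t) <= e.
Proof.
move=> wc hw.
have ex (t : R) : exists l : V, 0 <= t <= T -> w n t @[n --> \oo] --> l.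
  case: (boolP (0 <= t <= T)) => [/andP[t0 tT]|_]; last by exists 0.
  have [|l hl] := @hnorm_cauchy R V (fun n => w n t); last by exists l.
  move=> e e0; have [|N hN] := hw (e / 2); first by rewrite divr_gt0.
  exists N => m n Nm Nn; apply: le_lt_trans (hN m n Nm Nn t t0 tT) _; lra.
have [l hl] := choice ex.
have unif (e : R) : 0 < e -> exists N, forall n, (N <= n)%N ->
      forall t : R, 0 <= t -> t <= T -> hnorm (w n t - l t) <= e.
  move=> e0; have [N hN] := hw e e0; exists N => n Nn t t0 tT.
  have tT' : 0 <= t <= T by rewrite t0 tT.
  have hc : hnorm (w n t - w m t) @[m --> \oo] --> hnorm (w n t - l t).
    by apply: cvg_hnorm; apply: cvgB; [exact: cvg_cst|exact: hl].
  by apply: cvgr_ub hc _; exists N => // m /= Nm; exact: hN.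
exists l => //; apply/within_ballP => t t0 tT e e0.
have e3 : 0 < e / 4 by rewrite divr_gt0.
have [N hN] := unif _ e3; have /within_ballP /(_ t t0 tT _ e3)[d d0 hd] := wc N.
exists d => // s s0 sT ts; have := hN N (leqnn _) t t0 tT; have := hN N (leqnn _) s s0 sT.
have := hd s s0 sT ts; have := hnorm_dist (w N s) (l s) (l t).
by have := hnorm_dist (w N t) (w N s) (l t); rewrite (hnormBC (l s) (w N s)); lra.
Qed.

Lemma Rint_slice_total (h : R -> R) (s t : R) : 0 <= s -> s <= t -> t <= T ->
  (forall r, I r -> 0 <= h r) -> mu.-integrable I (EFin \o h) ->
  \int[mu]_(r in slice s t) h r <= \int[mu]_(r in I) h r.
Proof.
move=> s0 st tT h0 ih; apply: Rint_subset => //; first exact: measurable_slice.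
exact: slice_sub.
Qed.

Lemma primitive_ofB k1 k2 w1 w2 : L2 T k1 -> L2 T k2 -> primitive_of T k1 w1 ->
  primitive_of T k2 w2 -> primitive_of T (fun r => k1 r - k2 r) (fun r => w1 r - w2 r).
Proof.
move=> l1 l2 p1 p2 s t s0 st tT.
have ms : measurable (slice s t : set R) by exact: measurable_slice.
have ss : slice s t `<=` I by exact: slice_sub.
apply: rinner_ext => x; rewrite (rinner_weak_integral T_gt0)//; last exact: L2B.
have -> : w1 t - w2 t - (w1 s - w2 s) = (w1 t - w1 s) - (w2 t - w2 s).
  by apply: rinner_ext => y; rewrite !rinnerE; ring.
rewrite p1// p2// rinnerDl rinnerNl !(rinner_weak_integral T_gt0)// -RintegralB//.
- by apply: eq_Rintegral => r _; rewrite !rinnerE.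
- exact: (integrable_rinner_cst T_gt0).
- exact: (integrable_rinner_cst T_gt0).
Qed.

Section Regularity.
Variables (D : set V) (H : V -> V).
Hypothesis selfH : selfadjoint D H.
Hypothesis sepV : separable_hilbert V.

Local Notation J n := (resolvent D H n.+1%:R).

Lemma nat_neq0 n : n.+1%:R != 0 :> R. Proof. by rewrite pnatr_eq0. Qed.
Hint Resolve nat_neq0 : core.

Lemma J_bounded n y : hnorm (J n y) <= 1 * hnorm y.
Proof. by rewrite mul1r (resolvent_le selfH). Qed.

Lemma J_linear n : linear (J n).
Proof. exact: (resolvent_linear selfH). Qed.

Lemma L2_J n u : L2 T u -> L2 T (fun t => J n (u t)).
Proof. by apply: L2_op (@J_linear n) (@J_bounded n). Qed.

Lemma J_cvg x : J n x @[n --> \oo] --> x.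
Proof. by apply: (@resolvent_cvg R V D H selfH (fun n => n.+1%:R)) => n; rewrite ger0_norm. Qed.

(* The time derivative of [J n u] when [u] is a weak solution, since [i H J n = n (J n - 1)]. *)
Definition reg_deriv n u g t : V :=
  (n.+1%:R)%:C *: (u t - J n (u t)) - 'i *: J n (g t).

Lemma L2_reg_deriv n u g : L2 T u -> L2 T g -> L2 T (reg_deriv n u g).
Proof.
move=> lu lg; apply: L2B; apply: L2Z; last exact: L2_J.
by apply: L2B => //; exact: L2_J.
Qed.

(** The test vector [y], a resolvent of ['i *: x], lies in [D]. Taking adjoints moves the resolvent
    onto [u], the two factors ['i] combine to a sign, and [H y] is bounded in [x]; what remains is a
    weak time derivative to which [vector_dbr] applies. *)
Lemma regularised_primitive n u g : L2 T u -> L2 T g -> weakR T D H u g ->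
  exists c, L2eq T (fun t => J n (u t)) (fun t => c + primitive (reg_deriv n u g) t).
Proof.
move=> lu lg wug; apply: vector_dbr => //; [exact: L2_J|exact: L2_reg_deriv|].
move=> eta eta' x st.
have n0 : - (n.+1%:R : R) != 0 by rewrite oppr_eq0.
pose y := resolvent D H (- n.+1%:R) ('i *: x).
have Dy : D y by exact: resolvent_D.
have [tp dp] := scalar_test_fun selfH st Dy.
have lx : L2 T (fun=> x) by exact: L2_cst.
have [ce ce'] := continuous_scalar_test st.
have Hy : H y = (n.+1%:R)%:C *: (x - resolvent D H (- n.+1%:R) x).
  rewrite /y (H_resolvent selfH)// (linearP_i (resolvent_linear selfH n0)) -scalerBr scale_ii.
  by rewrite rmorphN scaleNr scalerN opprK.
have E t : rinner (u t) (schrodinger H (fun t => (eta t)%:C *: y) t) - rinner (g t) ((eta t)%:C *: y)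
   = - (eta' t * rinner (J n (u t)) x) - eta t * rinner (reg_deriv n u g t) x.
  rewrite /schrodinger dp (sa_HZ selfH)// Hy /y (linearP_i (resolvent_linear selfH n0)).
  rewrite /reg_deriv scale_iC scale_ii !rinnerE rinner_il ?rinnerE.
  rewrite !(resolvent_adj selfH)// (linearP_i (resolvent_linear selfH n0)); ring.
have i1 := integrable_scalar_rinner T_gt0 ce' (L2_J n lu) lx.
have i2 := integrable_scalar_rinner T_gt0 ce (L2_reg_deriv n lu lg) lx.
have j1 := integrable_rinner mI II lu (schrodinger_L2 T_gt0 selfH tp).
have j2 := integrable_rinner mI II lg (test_L2 T_gt0 tp).
have := wug _ tp => /eqP; rewrite -subr_eq0 -RintegralB//.
under eq_Rintegral do rewrite E.
have -> : \int[mu]_(t in I) (- (eta' t * rinner (J n (u t)) x) - eta t * rinner (reg_deriv n u g t) x)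
  = - ((\int[mu]_(t in I) (eta' t * rinner (J n (u t)) x)) +
      (\int[mu]_(t in I) (eta t * rinner (reg_deriv n u g t) x))).
  rewrite -RintegralD// -mulN1r -RintegralZl//; last exact: integrable_sum.
  by apply: eq_Rintegral => t _; ring.
by rewrite oppr_eq0 addr_eq0 => /eqP.
Qed.

(** With [N = n + 1], the vector [N (y - J n y)] is [- i H (J n y)], so this is [sa_im] for
    [J n y]. *)
Lemma reg_skew n y : rinner ((n.+1%:R)%:C *: (y - J n y)) (J n y) = 0.
Proof.
have h := sa_im selfH (resolvent_D selfH y (nat_neq0 n)).
by move: h; rewrite (H_resolvent selfH)// !rinnerZl rinner_ii.
Qed.

(** The same cancellation for a difference: the two unbounded parts combine into
    [- i H (J n y - J m y)]. Only source terms survive when two regularisations are compared. *)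
Lemma reg_skew2 n m y :
  rinner ((n.+1%:R)%:C *: (y - J n y) - (m.+1%:R)%:C *: (y - J m y)) (J n y - J m y) = 0.
Proof.
have Dn := resolvent_D selfH y (nat_neq0 n); have Dm := resolvent_D selfH y (nat_neq0 m).
have h := sa_im selfH (sa_DB selfH Dn Dm).
move: h; rewrite (sa_HB selfH)// !(H_resolvent selfH)//.
move: (y - J n y) (y - J m y) (J n y - J m y) => a b z.
by rewrite !rinnerDl !rinnerNl !rinnerZl !rinner_ii.
Qed.

Lemma reg_derivB n m u g r :
  rinner (reg_deriv n u g r - reg_deriv m u g r) (J n (u r) - J m (u r)) =
  - rinner ('i *: (J n (g r) - J m (g r))) (J n (u r) - J m (u r)).
Proof.
have := reg_skew2 n m (u r); rewrite /reg_deriv.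
move: (_ *: (u r - J n (u r))) (_ *: (u r - J m (u r))) (J n (g r)) (J m (g r)) => a b x y.
by move: (J n (u r) - J m (u r)) => z; rewrite !(rinner_il, rinnerE) => h; lra.
Qed.

Theorem weak_regularity u g : L2 T u -> L2 T g -> weakR T D H u g ->
  exists w, [/\ {within `[0, T], continuous w}, L2eq T w u &
    forall s t : R, 0 <= s -> s <= t -> t <= T ->
      hnorm (w t) ^+ 2 - hnorm (w s) ^+ 2 =
      - (2 * \int[mu]_(r in slice s t) rinner ('i *: g r) (u r))].
Proof.
move=> lu lg wug.
have /choice[c hc] n : exists c, L2eq T (fun t => J n (u t))
     (fun t => c + primitive (reg_deriv n u g) t) by exact: regularised_primitive.
pose k n := reg_deriv n u g; have lk n : L2 T (k n) by exact: L2_reg_deriv.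
pose w n t := c n + primitive (k n) t.
have wc n : {within `[0, T], continuous (w n)} by exact: primitive_shift_within.
have lw n : L2 T (w n) by exact: L2_within.
have pw n : primitive_of T (k n) (w n) by exact: primitive_of_shift.
have aew : {ae mu, forall t, forall n, I t -> w n t = J n (u t)}.
  by apply: ae_foralln => n; apply: ae_imp (hc n) => t h /h.
have ms (s t : R) : measurable (slice s t : set R) by exact: measurable_slice.
have en n (s t : R) : 0 <= s -> s <= t -> t <= T -> hnorm (w n t) ^+ 2 - hnorm (w n s) ^+ 2 =
    - (2 * \int[mu]_(r in slice s t) rinner ('i *: J n (g r)) (J n (u r))).
  move=> s0 st tT; have ss : slice s t `<=` I by exact: slice_sub.
  have lJu := L2_J n lu; have lJg := L2_J n lg.
  have i1 := integrable_rinner (ms s t) ss (L2Z 'i lJg) lJu.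
  rewrite !hnorm_sq (primitive_of_by_parts T_gt0 (lk n) (lk n))// -mulNr -RintegralZl//; last exact: ms.
  apply: ae_Rintegral => //.
  - exact: (measurable_funD (measurable_rinner ss (L2_sm (lk n)) (L2_sm (lw n)))
      (measurable_rinner ss (L2_sm (lw n)) (L2_sm (lk n)))).
  - by apply: measurable_funM => //; exact: (measurable_rinner ss (L2_sm (L2Z 'i lJg)) (L2_sm lJu)).
  - apply: ae_imp aew => r hr /ss Ir; rewrite (hr n Ir) (rinnerC (J n (u r))).
    by rewrite /k /reg_deriv rinnerDl reg_skew rinnerNl; ring.
(* Between any two times the distance of two regularisations varies by no more than this integral
   over all of [I], in which [H] no longer occurs. *)
have dn n m (s t : R) : 0 <= s -> s <= t -> t <= T ->
   `| hnorm (w n t - w m t) ^+ 2 - hnorm (w n s - w m s) ^+ 2 | <=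
     2 * \int[mu]_(r in I) (hnorm (J n (g r) - J m (g r)) * hnorm (J n (u r) - J m (u r))).
  move=> s0 st tT; have ss : slice s t `<=` I by exact: slice_sub.
  have lJu := L2B (L2_J n lu) (L2_J m lu); have lJg := L2B (L2_J n lg) (L2_J m lg).
  have ld := L2B (lw n) (lw m); have ldk := L2B (lk n) (lk m).
  have i1 := integrable_rinner (ms s t) ss (L2Z 'i lJg) lJu.
  have i2 := integrable_hnormM (ms s t) ss lJg lJu.
  have i3 := integrable_hnormM mI II lJg lJu.
  have pd : primitive_of T (fun r => k n r - k m r) (fun r => w n r - w m r).
    exact: primitive_ofB.
  have -> : hnorm (w n t - w m t) ^+ 2 - hnorm (w n s - w m s) ^+ 2 =
    -2 * \int[mu]_(r in slice s t) rinner ('i *: (J n (g r) - J m (g r))) (J n (u r) - J m (u r)).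
    rewrite !hnorm_sq (primitive_of_by_parts T_gt0 ldk ldk ld ld pd pd)// -RintegralZl//; last exact: ms.
    apply: ae_Rintegral => //.
    - exact: (measurable_funD (measurable_rinner ss (L2_sm ldk) (L2_sm ld))
        (measurable_rinner ss (L2_sm ld) (L2_sm ldk))).
    - by apply: measurable_funM => //; exact: (measurable_rinner ss (L2_sm (L2Z 'i lJg)) (L2_sm lJu)).
    - apply: ae_imp aew => r hr /ss Ir; rewrite !(hr _ Ir) (rinnerC (J n (u r) - _)).
      by rewrite /k reg_derivB; ring.
  rewrite normrM (_ : `|-2 : R| = 2); last by rewrite normrN ger0_norm.
  rewrite ler_wpM2l//; apply: le_trans (le_normr_Rintegral _ i1) _; first exact: ms.
  apply: (@le_trans _ _ (\int[mu]_(r in slice s t) (hnorm (J n (g r) - J m (g r)) * hnorm (J n (u r) - J m (u r))))).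
    apply: le_Rintegral => //; first exact: ms.
      exact: integrable_normr (ms s t) i1.
    by move=> r _; apply: le_trans (rinner_le _ _) _; rewrite hnormI.
  by apply: Rint_slice_total => // r _; rewrite mulr_ge0 ?hnorm_ge0.
(* One time at which all [w n] agree with [J n (u t)] serves as an anchor: [J n (u t0)] converges,
   and [dn] carries the Cauchy property from [t0] to all times. *)
have [t0 [It0 ht0]] := ae_exists_I T_gt0 aew.
have {}ht0 n : w n t0 = J n (u t0) by exact: ht0.
pose a n := \int[mu]_(r in I) (hnorm (J n (g r) - g r) * hnorm (u r)).
have lJg n : L2 T (fun r => J n (g r) - g r) by apply: L2B => //; exact: L2_J.
have ia n := integrable_hnormM mI II (lJg n) lu.
have Jle n y : hnorm (J n y) <= hnorm y by rewrite (resolvent_le selfH).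
have a0 : a n @[n --> \oo] --> (0 : R).
  have -> : (0 : R) = \int[mu]_(r in I) (0 : R) by rewrite Rintegral_cst// mul0r.
  have ig : mu.-integrable I (EFin \o (fun r => 2 * (hnorm (g r) * hnorm (u r)))).
    exact: (integrable_scale 2 mI (integrable_hnormM mI II lg lu)).
  apply: (Rint_dominated mI _ ig).
  - by move=> n; apply/measurable_EFinP; apply: measurable_int (ia n).
  - move=> r Ir; rewrite -(mul0r (hnorm (u r))) -{1}(@hnorm0 R V) -(subrr (g r)).
    apply: cvgMr_tmp; apply: cvg_hnorm; apply: cvgB; [exact: J_cvg|exact: cvg_cst].
  - move=> n r Ir; rewrite ger0_norm ?mulr_ge0 ?hnorm_ge0// mulrA ler_wpM2r ?hnorm_ge0//.
    by have := hnormB (J n (g r)) (g r); have := Jle n (g r); lra.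
have dd n m (t : R) : 0 <= t -> t <= T ->
   hnorm (w n t - w m t) ^+ 2 <= hnorm (J n (u t0) - J m (u t0)) ^+ 2 + 4 * (a n + a m).
  move=> tp tT; have /andP[t00 t0T] : 0 < t0 < T by move: It0; rewrite /= in_itv.
  have key : `| hnorm (w n t - w m t) ^+ 2 - hnorm (w n t0 - w m t0) ^+ 2 | <=
     2 * \int[mu]_(r in I) (hnorm (J n (g r) - J m (g r)) * hnorm (J n (u r) - J m (u r))).
    have [h|/ltW h] := leP t0 t; first by apply: dn => //; exact: ltW.
    by rewrite distrC; apply: dn => //; exact: ltW.
  have le : \int[mu]_(r in I) (hnorm (J n (g r) - J m (g r)) * hnorm (J n (u r) - J m (u r)))
     <= 2 * (a n + a m).
    rewrite /a -RintegralD// -RintegralZl//; last exact: (integrable_sum mI (ia n) (ia m)).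
    apply: le_Rintegral => //.
    - exact: (integrable_hnormM mI II (L2B (L2_J n lg) (L2_J m lg)) (L2B (L2_J n lu) (L2_J m lu))).
    - exact: (integrable_scale 2 mI (integrable_sum mI (ia n) (ia m))).
    move=> r _; rewrite -mulrDl mulrCA [leRHS]mulrC.
    rewrite [leLHS]mulrC; apply: ler_pM; rewrite ?hnorm_ge0//.
    + by have := hnormB (J n (u r)) (J m (u r)); have := Jle n (u r); have := Jle m (u r); lra.
    + by have := hnorm_dist (g r) (J n (g r)) (J m (g r)); rewrite (hnormBC (g r)).
  move: key; rewrite !ht0 ler_norml => /andP[_ h]; lra.
have [e e0|l lc hl] := uniform_limit wc.
  (* With these choices the bound [dd] is at most [e^2 / 4 + 4 (e^2 / 16 + e^2 / 16)], below
     [e^2]. *)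
  have e2 : 0 < e ^+ 2 / 16 by rewrite divr_gt0// exprn_gt0.
  have e4 : 0 < e / 4 by rewrite divr_gt0.
  have /cvgrPdist_lt /(_ _ e2)[N1 _ h1] := a0.
  have /hnorm_cvgP /(_ _ e4)[N2 _ h2] := @J_cvg (u t0).
  exists (maxn N1 N2) => m n; rewrite !geq_max => /andP[m1 m2] /andP[n1 n2] t tp tT.
  rewrite -(ler_pXn2r (_ : 0 < 2)%N) ?nnegrE ?hnorm_ge0//; last exact: ltW.
  apply: le_trans (dd m n t tp tT) _.
  have := h1 _ m1; have := h1 _ n1; have := h2 _ m2; have := h2 _ n2 => /=.
  rewrite !sub0r !normrN => k1 k2 k3 k4.
  have := hnorm_dist (u t0) (J m (u t0)) (J n (u t0)); rewrite (hnormBC (u t0)) => k5.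
  have := hnorm_ge0 (J m (u t0) - J n (u t0)) => k6.
  have := ler_norm (a m); have := ler_norm (a n) => k7 k8.
  have k9 : hnorm (J m (u t0) - J n (u t0)) <= e / 2 by lra.
  have k10 : hnorm (J m (u t0) - J n (u t0)) ^+ 2 <= e ^+ 2 / 4.
    by apply: le_trans (_ : (e / 2) ^+ 2 <= _); [rewrite lerXn2r ?nnegrE// ltW// divr_gt0|rewrite expr_div_n; lra].
  lra.
have wl (t : R) : 0 <= t -> t <= T -> w n t @[n --> \oo] --> l t.
  move=> tp tT; apply/hnorm_cvgP => e e0; have [|N hN] := hl (e / 2); first by rewrite divr_gt0.
  by exists N => // n /= Nn; have := hN n Nn t tp tT; lra.
have lu' : L2eq T l u.
  apply: ae_imp aew => t ht It; have /andP[tp tT] : 0 < t < T by move: It; rewrite /= in_itv.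
  apply: (hilbert_cvg_unique (wl t (ltW tp) (ltW tT))).
  have -> : (fun n => w n t) = (fun n => J n (u t)) by apply/funext => n; exact: ht.
  exact: J_cvg.
exists l; split=> // s t s0 st tT; have ss : slice s t `<=` I by exact: slice_sub.
have c1 : hnorm (w n t) ^+ 2 - hnorm (w n s) ^+ 2 @[n --> \oo] --> hnorm (l t) ^+ 2 - hnorm (l s) ^+ 2.
  apply: cvgB; rewrite !expr2; apply: cvgM; apply: cvg_hnorm; apply: wl => //.
  - exact: le_trans st.
  - exact: le_trans st.
  - exact: le_trans tT.
  - exact: le_trans tT.
have c2 : - (2 * \int[mu]_(r in slice s t) rinner ('i *: J n (g r)) (J n (u r))) @[n --> \oo] -->
   - (2 * \int[mu]_(r in slice s t) rinner ('i *: g r) (u r)).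
  apply: cvgN; apply: cvgMl_tmp.
  have ig : mu.-integrable (slice s t) (EFin \o (fun r => hnorm (g r) * hnorm (u r))).
    exact: (integrable_hnormM (ms s t) ss lg lu).
  apply: (Rint_dominated (ms s t) _ ig).
  - by move=> n; exact: (measurable_rinner ss (L2_sm (L2Z 'i (L2_J n lg))) (L2_sm (L2_J n lu))).
  - by move=> r _; apply: cvg_rinner; [apply: cvgZl_tmp; exact: J_cvg|exact: J_cvg].
  - move=> n r _; apply: le_trans (rinner_le _ _) _; rewrite hnormI.
    by apply: ler_pM; rewrite ?hnorm_ge0// Jle.
apply: (cvg_unique (@Rhausdorff R) c1); apply: cvg_trans c2.
by apply: near_eq_cvg; apply: nearW => n; rewrite en.
Qed.

(** The energy identity is used up to the time [c] where the norm is largest on [[0, t]]. With [M]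
    this maximum and [b] the integral of the norm of the source, it gives [M^2 <= |w 0|^2 + 2 M b],
    which forces [M <= |w 0| + 2 b] without any Gronwall argument. *)
Theorem energy_bound w g : {within `[0, T], continuous w} -> L2 T g -> weakR T D H w g ->
  forall t : R, 0 <= t -> t <= T ->
    hnorm (w t) <= hnorm (w 0) + 2 * \int[mu]_(r in `]0, t[) hnorm (g r).
Proof.
move=> wc lg wg t t0 tT; have lw := L2_within T_gt0 wc.
have [l [lc lw' en]] := weak_regularity lw lg wg.
have E := within_ae_uniq lc wc lw'.
pose b := \int[mu]_(r in `]0, t[) hnorm (g r).
have b0 : 0 <= b by apply: Rintegral_ge0 => r _; exact: hnorm_ge0.
have [c ct hc] : exists2 c, c \in `[0, t] & forall s, s \in `[0, t] -> hnorm (w s) <= hnorm (w c).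
  apply: EVT_max => //; apply: (@continuous_subspaceW _ _ _ `[0, T]).
    by move=> r /=; rewrite !in_itv/= => /andP[-> /le_trans ->].
  apply/subspace_continuousP => r rT; apply: cvg_hnorm.
  by move/subspace_continuousP : wc; apply.
move: ct; rewrite in_itv/= => /andP[c0 ct]; set M := hnorm (w c) in hc.
have cT : c <= T by exact: le_trans tT.
have M0 : 0 <= M by exact: hnorm_ge0.
have wt : hnorm (w t) <= M by apply: hc; rewrite in_itv/= t0 lexx.
have key : M ^+ 2 <= hnorm (w 0) ^+ 2 + 2 * (M * b).
  have := en 0 c (lexx 0) c0 cT; rewrite !E// ?(ltW T_gt0)// -/M => h.
  have ss : slice 0 c `<=` I by exact: slice_sub.
  have ms : measurable (slice 0 c : set R) by exact: measurable_slice.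
  have i1 := integrable_rinner ms ss (L2Z 'i lg) lw.
  have i2 := integrable_hnorm T_gt0 ms ss lg.
  have i3 := integrable_hnorm T_gt0 mI II lg.
  have le1 : `|\int[mu]_(r in slice 0 c) rinner ('i *: g r) (w r)| <= M * b.
    apply: le_trans (le_normr_Rintegral _ i1) _ => //.
    apply: (@le_trans _ _ (M * \int[mu]_(r in slice 0 c) hnorm (g r))).
      rewrite -RintegralZl//; apply: le_Rintegral => //.
      - exact: integrable_normr ms i1.
      - exact: integrable_scale.
      move=> r /sliceP /andP[r0 rc]; apply: le_trans (rinner_le _ _) _.
      rewrite hnormI mulrC ler_wpM2r ?hnorm_ge0// hc// in_itv/= r0.
      exact: le_trans (ltW rc) ct.
    rewrite ler_wpM2l// slice0 /b (Rint_slice ct tT i3) lerDl.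
    by apply: Rintegral_ge0 => r _; exact: hnorm_ge0.
  have := ler_norm (- \int[mu]_(r in slice 0 c) rinner ('i *: g r) (w r)).
  rewrite normrN; move: h le1; set X := \int[mu]_(r in slice 0 c) _; set Y := `|X|.
  by move=> h1 h2 h3; lra.
apply: le_trans wt _; rewrite leNgt; apply/negP => h.
have A0 := hnorm_ge0 (w 0); rewrite -/b in h.
have h1 : 0 < M * (M - (hnorm (w 0) + 2 * b)) by rewrite mulr_gt0 ?subr_gt0//; lra.
have h2 : 0 <= hnorm (w 0) * (M - hnorm (w 0)) by rewrite mulr_ge0// subr_ge0; lra.
move: h1 h2 key; rewrite !expr2 !mulrBr mulrDr; lra.
Qed.

End Regularity.

End Energy.

(** * Bounded perturbations *)

Section Perturbation.
Local Open Scope complex_scope.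
Context {R : realType} {V : hilbertType R}.
Variable T : R.
Hypothesis T_gt0 : 0 < T.
Local Notation mu := (@lebesgue_measure R).
Local Notation I := (`]0, T[%classic : set R).
Implicit Types (phi u v w k g f : R -> V) (x : V).

Let mI : measurable I := @measurable_I R T.
Let II : I `<=` I := @subset_refl _ _.

Lemma I_closed (t : R) : I t -> 0 <= t /\ t <= T.
Proof. by rewrite /= in_itv/= => /andP[/ltW ? /ltW ?]. Qed.

Lemma Rint_rinnerB u v w : L2 T u -> L2 T v -> L2 T w ->
  \int[mu]_(t in I) rinner (u t - v t) (w t) =
  \int[mu]_(t in I) rinner (u t) (w t) - \int[mu]_(t in I) rinner (v t) (w t).
Proof.
move=> lu lv lw.
have i1 := integrable_rinner mI II lu lw; have i2 := integrable_rinner mI II lv lw.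
by rewrite -RintegralB//; apply: eq_Rintegral => t _; rewrite rinnerDl rinnerNl.
Qed.

Section Fixed.
Variables (D : set V) (H : V -> V).
Hypothesis selfH : selfadjoint D H.

Lemma weakRB u1 u2 g1 g2 : L2 T u1 -> L2 T u2 -> L2 T g1 -> L2 T g2 ->
  weakR T D H u1 g1 -> weakR T D H u2 g2 ->
  weakR T D H (fun t => u1 t - u2 t) (fun t => g1 t - g2 t).
Proof.
move=> lu1 lu2 lg1 lg2 w1 w2 phi tp.
have ls := schrodinger_L2 T_gt0 selfH tp; have lp := test_L2 T_gt0 tp.
by rewrite !Rint_rinnerB// w1// w2.
Qed.

(** The dominating function [hnorm (v t) + a] suits both a bounded sequence of solutions and sources
    [f + B u], where [f] is merely square integrable. *)
Lemma weakR_lim (u g : nat -> R -> V) u' g' v (a : R) : L2 T v ->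
  (forall n, L2 T (u n)) -> (forall n, L2 T (g n)) ->
  (forall n, weakR T D H (u n) (g n)) ->
  (forall t, I t -> u n t @[n --> \oo] --> u' t) -> (forall t, I t -> g n t @[n --> \oo] --> g' t) ->
  (forall n t, I t -> hnorm (u n t) <= hnorm (v t) + a) ->
  (forall n t, I t -> hnorm (g n t) <= hnorm (v t) + a) ->
  weakR T D H u' g'.
Proof.
move=> lv lu lg wn cu cg bu bg phi tp.
have lim (r : nat -> R -> V) r' p : (forall n, L2 T (r n)) -> L2 T p ->
    (forall t, I t -> r n t @[n --> \oo] --> r' t) ->
    (forall n t, I t -> hnorm (r n t) <= hnorm (v t) + a) ->
    \int[mu]_(t in I) rinner (r n t) (p t) @[n --> \oo] --> \int[mu]_(t in I) rinner (r' t) (p t).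
  move=> lr lp cr br.
  have ig := integrable_sum mI (integrable_hnormM mI II lv lp)
     (integrable_scale a mI (integrable_hnorm T_gt0 mI II lp)).
  apply: (Rint_dominated mI _ ig).
  - by move=> n; exact: (measurable_rinner II (L2_sm (lr n)) (L2_sm lp)).
  - by move=> t It; apply: cvg_rinner; [exact: cr|exact: cvg_cst].
  - move=> n t It; rewrite -mulrDl; apply: le_trans (rinner_le _ _) _.
    by rewrite ler_wpM2r ?hnorm_ge0// br.
have c1 := lim u u' _ lu (schrodinger_L2 T_gt0 selfH tp) cu bu.
have c2 := lim g g' _ lg (test_L2 T_gt0 tp) cg bg.
apply: (cvg_unique (@Rhausdorff R) c1); apply: cvg_trans c2.
by apply: near_eq_cvg; apply: nearW => n; rewrite wn.
Qed.

Definition solvable : Prop := forall x g, L2 T g ->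
  exists u, [/\ {within `[0, T], continuous u}, u 0 = x & weakR T D H u g].

End Fixed.

Section Picard.
Variables (D : set V) (H : V -> V).
Hypothesis selfH : selfadjoint D H.
Hypothesis sepV : separable_hilbert V.
Variables (B : R -> V -> V) (M : R).
Hypothesis M_ge0 : 0 <= M.
Hypothesis linB : forall t : R, 0 <= t -> t <= T -> linear (B t).
Hypothesis bndB : forall t : R, 0 <= t -> t <= T -> forall x, hnorm (B t x) <= M * hnorm x.
Hypothesis contB : forall x, {within `[0, T], continuous (fun t => B t x)}.

(** The joint continuity asked by [sm_caratheodory] comes from strong continuity in [t] and the
    bound [M], uniform in [t], for the dependence on the vector. *)
Lemma L2_family u : L2 T u -> L2 T (fun t => B t (u t)).
Proof.
move=> lu; apply: (@L2_dom _ _ T _ u M) => //; last first.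
  by move=> t /I_closed[t0 tT]; exact: bndB.
apply: (@sm_caratheodory R V T T_gt0 B u (L2_sm lu)) => t x r y It Ir rt yx.
have [t0 tT] := I_closed It.
have Bx : B (r n) x @[n --> \oo] --> B t x.
  have tT' : `[0, T]%classic t by rewrite /= in_itv/= t0.
  have rT' n : `[0, T]%classic (r n) by have [r0 rT] := I_closed (Ir n); rewrite /= in_itv/= r0.
  exact: (@within_cvg_seq R V T (fun t => B t x) t r (@contB x) tT' rT' rt).
apply/hnorm_cvgP => e e0; have M0 := M_ge0; have M1 : 0 < M + 1 by lra.
have e2 : 0 < e / 2 by rewrite divr_gt0.
have e3 : 0 < (e / 2) / (M + 1) by rewrite divr_gt0.
move/hnorm_cvgP : yx => /(_ _ e3) => h1; move/hnorm_cvgP : Bx => /(_ _ e2) => h2.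
apply: filterS2 h1 h2 => n; rewrite ltr_pdivlMr// => h1 h2.
have [r0 rT] := I_closed (Ir n).
have := bndB r0 rT (y n - x); rewrite (linear_opB (linB r0 rT)) => h3.
have := hnorm_dist (B (r n) x) (B (r n) (y n)) (B t x).
have := hnorm_ge0 (y n - x); nra.
Qed.

Lemma Rint_exp (a t : R) : 0 < a -> 0 <= t -> t <= T ->
  \int[mu]_(s in `]0, t[) expR (a * s) <= a^-1 * expR (a * t).
Proof.
move=> a0 t0 tT.
have dF s : has_deriv (fun s : R => a^-1 * expR ((s - 0) / a^-1)) s (expR (a * s)).
  have : has_deriv (fun s : R => a^-1 * expR ((s - 0) / a^-1)) s (a^-1 * (a^-1^-1 * expR ((s - 0) / a^-1))).
    apply: has_derivZ; apply: has_deriv_affine; first by rewrite invr_eq0 gt_eqF.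
    by move=> r; apply/has_derivP; exact: is_derive_expR.
  by rewrite subr0 invrK mulrA mulVf ?gt_eqF// mul1r (mulrC s).
have ce : continuous (fun s => expR (a * s)).
  move=> s; apply: continuous_cvg; first exact: continuous_expR.
  by apply: cvgMl_tmp; exact: cvg_id.
rewrite (Rint_deriv0 ce dF)// !subr0 invrK (mulrC t).
by rewrite lerBlDr lerDl mulr_ge0 ?invr_ge0 ?(ltW a0)// expR_ge0.
Qed.

(** Each iterate solves the equation for [H] with the preceding one inserted in [B]. Measured
    against [exp (a t)], successive differences are halved on all of [[0, T]], so the interval need
    not be subdivided. *)
Theorem perturbed_solution x f : solvable D H -> L2 T f ->
  exists u, [/\ {within `[0, T], continuous u}, u 0 = x &
    weakR T D H u (fun t => f t + B t (u t))].
Proof.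
move=> solH lf.
have /choice[S hS] g : exists u, L2 T g -> [/\ {within `[0, T], continuous u}, u 0 = x & weakR T D H u g].
  have [lg|nlg] := pselect (L2 T g); last by exists (fun=> 0).
  by have [u hu] := solH x g lg; exists u.
pose fix u n : R -> V := if n is m.+1 then S (fun t => f t + B t (u m t)) else S f.
have uc n : [/\ {within `[0, T], continuous (u n)} , L2 T (u n) & u n 0 = x].
  elim: n => [|n [_ lu _]] /=; first by have [c x0 _] := hS _ lf; split=> //; exact: L2_within.
  have [c x0 _] := hS _ (L2D lf (L2_family lu)); split=> //; exact: L2_within.
have lu n : L2 T (u n) by case: (uc n).
have cu n : {within `[0, T], continuous (u n)} by case: (uc n).
have lg n : L2 T (fun t => f t + B t (u n t)) by apply: L2D => //; exact: L2_family.
have wu n : weakR T D H (u n.+1) (fun t => f t + B t (u n t)) by case: (hS _ (lg n)).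
(* The energy bound contributes [2 M] and the integral of [exp (a s)] contributes [1 / a]; this [a]
   makes the product at most 1/2, and stays positive when [M = 0]. *)
have M0 := M_ge0; pose a := 4 * (M + 1); have a0 : 0 < a by rewrite mulr_gt0//; lra.
have cB w1 w2 : {within `[0, T], continuous w1} -> {within `[0, T], continuous w2} ->
    {within `[0, T], continuous (fun t => w1 t - w2 t)}.
  move=> /subspace_continuousP h1 /subspace_continuousP h2; apply/subspace_continuousP => t tT.
  by apply: cvgB; [exact: h1|exact: h2].
have [c0 _ hc0] := within_bounded T_gt0 (cB _ _ (cu 1%N) (cu 0%N)).
pose C := hnorm (u 1%N c0 - u 0%N c0); have C0 : 0 <= C by exact: hnorm_ge0.
have dn n (t : R) : 0 <= t -> t <= T -> hnorm (u n.+1 t - u n t) <= C / 2 ^+ n * expR (a * t).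
  elim: n t => [|n IH] t t0 tT.
    rewrite expr0 divr1; apply: le_trans (hc0 t _) _; first by rewrite /= in_itv/= t0.
    rewrite -/C ler_peMr//; apply: le_trans (expR_ge1Dx _); rewrite lerDl mulr_ge0// ltW//.
  have ld : L2 T (fun t => u n.+1 t - u n t) by exact: L2B.
  have lBd := L2_family ld.
  have wd : weakR T D H (fun t => u n.+2 t - u n.+1 t) (fun t => B t (u n.+1 t - u n t)).
    move=> phi tp; rewrite (weakRB selfH (lu n.+2) (lu n.+1) (lg n.+1) (lg n) (wu n.+1) (wu n) tp).
    apply: eq_Rintegral => t' /set_mem /I_closed[s0 sT]; rewrite (linear_opB (linB s0 sT)).
    by rewrite opprD addrACA subrr add0r.
  have := energy_bound T_gt0 selfH sepV (cB _ _ (cu n.+2) (cu n.+1)) lBd wd t0 tT.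
  have -> : hnorm (u n.+2 0 - u n.+1 0) = 0.
    by have [_ _ ->] := uc n.+2; have [_ _ ->] := uc n.+1; rewrite subrr hnorm0.
  rewrite add0r => /le_trans; apply.
  have sub : `]0, t[%classic `<=` I by exact: initial_sub.
  have i1 := integrable_hnorm T_gt0 (measurable_itv _) sub lBd.
  have ce : continuous (fun s => expR (a * s)).
    move=> s; apply: continuous_cvg; first exact: continuous_expR.
    by apply: cvgMl_tmp; exact: cvg_id.
  have i2 : mu.-integrable `]0, t[ (EFin \o (fun s => expR (a * s))).
    apply: integrableS (integrable_continuous 0 t ce) => //.
    by move=> r /=; rewrite !in_itv/= => /andP[/ltW -> /ltW ->].
  apply: (@le_trans _ _ (2 * (M * (C / 2 ^+ n) * \int[mu]_(s in `]0, t[) expR (a * s)))).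
    rewrite ler_wpM2l// -RintegralZl//; apply: le_Rintegral => //.
      exact: integrable_scale.
    move=> s /= st; have [s0 sT] := I_closed (sub s st).
    apply: le_trans (bndB s0 sT _) _; rewrite -mulrA ler_wpM2l//; exact: IH.
  have p2 : 0 < 2 ^+ n :> R by rewrite exprn_gt0.
  have K0 : 0 <= C / 2 ^+ n by rewrite divr_ge0// ltW.
  have := Rint_exp a0 t0 tT; set X := \int[mu]_(s in `]0, t[) expR (a * s) => hX.
  have e1 : 2 * M * a^-1 <= 2^-1.
    by rewrite ler_pdivrMr// /a; lra.
  have E0 : 0 <= expR (a * t) by exact: expR_ge0.
  rewrite exprSr invfM (mulrA C).
  move: K0 hX; set K := C / 2 ^+ n => K0 hX.
  apply: (@le_trans _ _ (2 * (M * K * (a^-1 * expR (a * t))))).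
    by rewrite ler_wpM2l// ler_wpM2l// mulr_ge0.
  have -> : 2 * (M * K * (a^-1 * expR (a * t))) = (2 * M * a^-1) * (K * expR (a * t)) by ring.
  have -> : K * 2^-1 * expR (a * t) = 2^-1 * (K * expR (a * t)) by ring.
  by apply: ler_wpM2r => //; exact: mulr_ge0.
have [K K0 dn2] : exists2 K : R, 0 <= K & forall n (t : R), 0 <= t -> t <= T ->
    hnorm (u n.+1 t - u n t) <= K / 2 ^+ n.
  exists (C * expR (a * T)); first by rewrite mulr_ge0 ?expR_ge0.
  move=> n t t0 tT; apply: le_trans (dn n t t0 tT) _; rewrite mulrAC.
  by rewrite ler_wpM2r ?invr_ge0 ?exprn_ge0// ler_wpM2l// ler_expR ler_wpM2l// ltW.
(* Keeping the tail of the geometric series in the bound lets the induction on [m] close. *)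
have dn3 n m (t : R) : 0 <= t -> t <= T ->
    hnorm (u (n + m)%N t - u n t) <= 2 * K / 2 ^+ n - 2 * K / 2 ^+ (n + m).
  move=> t0 tT; elim: m => [|m IH]; first by rewrite addn0 !subrr hnorm0.
  rewrite addnS; apply: le_trans (hnorm_dist (u (n + m)%N t) _ _) _.
  have := dn2 (n + m)%N t t0 tT; rewrite exprS invfM.
  by move: IH; set q := (2 ^+ (n + m))^-1; set p := (2 ^+ n)^-1; lra.
have dn4 n m (t : R) : (n <= m)%N -> 0 <= t -> t <= T -> hnorm (u m t - u n t) <= 2 * K / 2 ^+ n.
  move=> nm t0 tT; rewrite -(subnKC nm); apply: le_trans (dn3 n _ t t0 tT) _.
  by rewrite gerBl divr_ge0 ?mulr_ge0 ?exprn_ge0.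
have [e e0|l lc hl] := uniform_limit cu.
  have K1 : 0 < 4 * K + 1 by lra.
  have [|N hN] := @invS_lt R (e / (4 * K + 1)); first by rewrite divr_gt0.
  exists N => m n Nm Nn t t0 tT; apply: le_trans (hnorm_dist (u N t) _ _) _.
  have := dn4 N m t Nm t0 tT; have := dn4 N n t Nn t0 tT; rewrite (hnormBC (u N t)).
  have h2 : (2 ^+ N)^-1 <= N.+1%:R^-1 :> R.
    by rewrite lef_pV2 ?posrE ?exprn_gt0 ?ltr0n// -natrX ler_nat ltn_expl.
  have := hN N (leqnn N); rewrite ltr_pdivlMr//.
  have h3 : 0 <= (2 ^+ N)^-1 :> R by rewrite invr_ge0 exprn_ge0.
  by move: h2 h3; set q := (2 ^+ N)^-1; set p := N.+1%:R^-1; nra.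
have ul (t : R) : 0 <= t -> t <= T -> u n t @[n --> \oo] --> l t.
  move=> tp tT; apply/hnorm_cvgP => e e0; have [|N hN] := hl (e / 2); first by rewrite divr_gt0.
  by exists N => // n /= Nn; have := hN n Nn t tp tT; lra.
have l0 : l 0 = x.
  apply: (hilbert_cvg_unique (ul 0 (lexx 0) (ltW T_gt0))).
  by have -> : (fun n => u n 0) = (fun=> x); [apply/funext => n; case: (uc n)|exact: cvg_cst].
exists l; split=> //.
have [c1 _ hc1] := within_bounded T_gt0 (cu 0%N).
pose A := 2 * K + hnorm (u 0%N c1); have A0 : 0 <= A by rewrite addr_ge0 ?hnorm_ge0// mulr_ge0.
have uA n t : I t -> hnorm (u n t) <= A.
  move=> /I_closed[t0 tT]; have := dn4 0%N n t (leq0n n) t0 tT.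
  have := hc1 t; rewrite /= in_itv/= t0 tT => /(_ isT); rewrite expr0 divr1 /A.
  by have := hnormD (u n t - u 0%N t) (u 0%N t); rewrite subrK; lra.
have MA0 : 0 <= M * A by exact: mulr_ge0.
apply: (@weakR_lim D H selfH (fun n => u n.+1) (fun n t => f t + B t (u n t)) l _ f (A + M * A) lf) => //.
- move=> t It; have [t0 tT] := I_closed It; apply/hnorm_cvgP => e e0.
  have /hnorm_cvgP /(_ e e0)[N _ hN] := ul t t0 tT.
  by exists N => // n Nn; apply: hN; exact: leqW.
- move=> t It; have [t0 tT] := I_closed It; apply: cvgD; first exact: cvg_cst.
  exact: (bounded_cvg (linB t0 tT) (bndB t0 tT) (ul t t0 tT)).
- by move=> n t It; have := uA n.+1 t It; have := hnorm_ge0 (f t); lra.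
- move=> n t It; have [t0 tT] := I_closed It; have := bndB t0 tT (u n t).
  have := hnormD (f t) (B t (u n t)).
  have : M * hnorm (u n t) <= M * A by rewrite ler_wpM2l// uA.
  lra.
Qed.

End Picard.
End Perturbation.

(** * Existence for the unperturbed equation *)

Section Solvability.
Local Open Scope complex_scope.
Context {R : realType} {V : hilbertType R}.
Variable T : R.
Hypothesis T_gt0 : 0 < T.
Hypothesis sepV : separable_hilbert V.
Local Notation mu := (@lebesgue_measure R).
Local Notation I := (`]0, T[%classic : set R).
Local Notation O := (fun=> 0 : V).
Implicit Types (phi u v w k g f : R -> V) (x : V) (A : V -> V).

Let mI : measurable I := @measurable_I R T.
Let II : I `<=` I := @subset_refl _ _.

Lemma zero_selfadjoint : selfadjoint [set: V] O.
Proof.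
apply: symmetric_selfadjoint => [a x y|x y]; first by rewrite scaler0 addr0.
by rewrite rinner0l rinner0r.
Qed.

(** For a bounded operator the graph norm is controlled by the norm, so a test function for any [H]
    remains one for [A]. The equations for the [Y n] can thus be tested with the functions
    admissible for [H]. *)
Lemma test_bounded D H phi A (a : R) : linear A -> (forall y, hnorm (A y) <= a * hnorm y) ->
  test_fun T D H phi -> test_fun T [set: V] A phi.
Proof.
move=> lA bA tp; have cp := test_continuous tp; have [[cc _ _] c1] := tp.
split=> //; split=> // t; apply/cvgrPdist_lt => e e0.
have a1 : 0 < 1 + `|a| by rewrite ltr_pwDl.
have e1 : 0 < e / (1 + `|a|) by rewrite divr_gt0.
have /hnorm_cvgP /(_ _ e1) := cp t; apply: filterS => s; rewrite ltr_pdivlMr// => h.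
rewrite sub0r normrN /graph_norm ger0_norm ?addr_ge0 ?hnorm_ge0//.
apply: le_lt_trans h; rewrite mulrDr mulr1 lerD2l; apply: le_trans (bA _) _.
by rewrite mulrC ler_wpM2l ?hnorm_ge0// ler_norm.
Qed.

Lemma test_zero A (a : R) phi : linear A -> (forall y, hnorm (A y) <= a * hnorm y) ->
  test_fun T [set: V] A phi <-> test_fun T [set: V] O phi.
Proof.
move=> lA bA; split=> tp; last exact: test_bounded bA tp.
apply: (@test_bounded _ _ _ _ 0) tp => [c x y|y]; first by rewrite scaler0 addr0.
by rewrite hnorm0 mul0r.
Qed.

Section Bounded.
Variables (A : V -> V) (a : R).
Hypothesis linA : linear A.
Hypothesis bndA : forall y, hnorm (A y) <= a * hnorm y.
Hypothesis symA : forall x y, rinner (A x) y = rinner x (A y).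

(** A bounded symmetric operator moves from the test function to the source, and [test_zero] says
    that both equations have the same test functions. Bounded operators are thereby compared within
    the single equation for [H = 0]. *)
Lemma weakR_bounded u g : L2 T u -> L2 T g ->
  weakR T [set: V] A u g <-> weakR T [set: V] O u (fun t => g t + A (u t)).
Proof.
move=> lu lg; have lAu := L2_op linA bndA lu.
have zs := zero_selfadjoint.
have E phi : test_fun T [set: V] O phi ->
   \int[mu]_(t in I) rinner (u t) (schrodinger A phi t) =
   \int[mu]_(t in I) rinner (u t) (schrodinger O phi t) - \int[mu]_(t in I) rinner (A (u t)) (phi t).
  move=> tp; have lp := test_L2 T_gt0 tp; have ls := schrodinger_L2 T_gt0 zs tp.
  have i1 := integrable_rinner mI II lu ls; have i2 := integrable_rinner mI II lAu lp.
  rewrite -RintegralB//; apply: eq_Rintegral => t _.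
  by rewrite /schrodinger symA !rinnerE; ring.
have F phi : test_fun T [set: V] O phi ->
   \int[mu]_(t in I) rinner (g t + A (u t)) (phi t) =
   \int[mu]_(t in I) rinner (g t) (phi t) + \int[mu]_(t in I) rinner (A (u t)) (phi t).
  move=> tp; have lp := test_L2 T_gt0 tp.
  have i1 := integrable_rinner mI II lg lp; have i2 := integrable_rinner mI II lAu lp.
  by rewrite -RintegralD//; apply: eq_Rintegral => t _; rewrite rinnerDl.
split=> h phi tp.
  have := h phi ((test_zero phi linA bndA).2 tp); rewrite E// F// => <-.
  by rewrite subrK.
have tp0 := (test_zero phi linA bndA).1 tp.
by have := h phi tp0; rewrite E// F// => ->; rewrite addrK.
Qed.

End Bounded.

(** The adjoint [A'] commutes with the time derivative and, when [H = 0], maps test functions to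
    test functions. *)
Lemma weakR_zero_op A A' (a a' : R) u g : linear A -> (forall y, hnorm (A y) <= a * hnorm y) ->
  linear A' -> (forall y, hnorm (A' y) <= a' * hnorm y) ->
  (forall x y, rinner (A x) y = rinner x (A' y)) ->
  weakR T [set: V] O u g -> weakR T [set: V] O (fun t => A (u t)) (fun t => A (g t)).
Proof.
move=> lA bA lA' bA' adj h phi tp; have [[cc _ gn] [_ dp cd]] := tp.
have d t := tderive_op lA' bA' (dp t).
have cp := test_continuous tp.
have cA : Cc T (fun t => A' (phi t)) by apply: Cc_comp => //; exact: linear_op0.
have tA : test_fun T [set: V] O (fun t => A' (phi t)).
  split; split=> //.
  - move=> t; apply/cvgrPdist_lt => e e0.
    have /hnorm_cvgP /(_ e e0) : A' (phi s) @[s --> t] --> A' (phi t) by exact: (bounded_cvg lA' bA' (cp t)).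
    apply: filterS => s.
    by rewrite sub0r normrN /graph_norm hnorm0 addr0 ger0_norm ?hnorm_ge0.
  - by move=> t; case: (d t).
  - have -> : tderive (fun t => A' (phi t)) = (fun t => A' (tderive phi t)).
      by apply/funext => t; case: (d t).
    by move=> t; apply: (bounded_cvg lA' bA'); exact: cd.
have := h _ tA.
have -> : \int[mu]_(t in I) rinner (A (u t)) (schrodinger O phi t) =
   \int[mu]_(t in I) rinner (u t) (schrodinger O (fun t => A' (phi t)) t).
  apply: eq_Rintegral => t _; rewrite adj /schrodinger !subr0 (linearP_i lA').
  by have [_ ->] := d t.
by move=> ->; apply: eq_Rintegral => t _; rewrite adj.
Qed.

(** Explicitly [u(t) = x - i int_0^t g]; the weak form is integration by parts against
    ['i *: phi]. *)
Lemma solvable_zero : solvable T [set: V] O.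
Proof.
move=> x g lg; have zs := zero_selfadjoint.
pose k t := - ('i *: g t); have lk : L2 T k by apply: L2N; exact: L2Z.
exists (fun t => x + primitive k t); split.
- exact: primitive_shift_within.
- by rewrite primitive0 addr0.
move=> phi tp; have [ti di] := test_i zs tp.
have lw : L2 T (fun t => x + primitive k t) by apply: L2_within => //; exact: primitive_shift_within.
have pw := @primitive_of_shift R V T T_gt0 k x lk.
have := primitive_test T_gt0 zs lw lk pw ti.
under eq_Rintegral do rewrite di; under eq_Rintegral do rewrite -[X in rinner _ X]subr0.
move=> ->; rewrite -mulN1r -RintegralZl//; last first.
  exact: (integrable_rinner mI II lk (test_L2 T_gt0 ti)).
by apply: eq_Rintegral => t _; rewrite /k rinnerNl rinner_ii; ring.
Qed.

Lemma solvable_bounded A (a : R) : 0 <= a -> linear A -> (forall y, hnorm (A y) <= a * hnorm y) ->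
  (forall x y, rinner (A x) y = rinner x (A y)) -> solvable T [set: V] A.
Proof.
move=> a0 lA bA sA x g lg.
have cA y : {within `[0, T], continuous (fun _ : R => A y)}.
  by apply: continuous_subspaceT => t; exact: cvg_cst.
have [u [uc u0 wu]] := @perturbed_solution R V T T_gt0 _ _ zero_selfadjoint sepV (fun=> A) a a0
  (fun _ _ _ => lA) (fun _ _ _ => bA) cA x g solvable_zero lg.
exists u; split=> //; apply/(weakR_bounded lA bA sA) => //.
exact: L2_within.
Qed.

(** * Passage to the limit in the Yosida approximations *)

Section Yosida.
Variables (D : set V) (H : V -> V).
Hypothesis selfH : selfadjoint D H.

Local Notation J n := (resolvent D H n.+1%:R).
Local Notation Y n := (yosida D H n.+1%:R).

Let s0 n : n.+1%:R != 0 :> R. Proof. by rewrite pnatr_eq0. Qed.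
Let ms0 n : - n.+1%:R != 0 :> R. Proof. by rewrite oppr_eq0. Qed.
Let nn n : `|n.+1%:R : R| = n.+1%:R. Proof. by rewrite ger0_norm. Qed.

Lemma Y_linear n : linear (Y n). Proof. exact: yosida_linear. Qed.
Lemma Y_bounded n y : hnorm (Y n y) <= n.+1%:R * hnorm y.
Proof. by have := yosida_le selfH y (s0 n); rewrite nn. Qed.
Lemma Y_sym n x y : rinner (Y n x) y = rinner x (Y n y).
Proof. exact: yosida_sym. Qed.
Lemma Y_selfadjoint n : selfadjoint [set: V] (Y n).
Proof. by apply: symmetric_selfadjoint; [exact: Y_linear|exact: Y_sym]. Qed.

Local Notation JJ n y := (J n (J n y)).

Lemma JJ_linear n : linear (fun y => JJ n y).
Proof. by move=> c x y; rewrite !(resolvent_linear selfH (s0 n)). Qed.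
Lemma JJ_le n y : hnorm (JJ n y) <= hnorm y.
Proof. by apply: le_trans (resolvent_le selfH _ (s0 n)) (resolvent_le selfH _ (s0 n)). Qed.
Lemma JJ_bounded n y : hnorm (JJ n y) <= 1 * hnorm y.
Proof. by rewrite mul1r JJ_le. Qed.

Lemma JJ_cvg x : JJ n x @[n --> \oo] --> x.
Proof.
apply/hnorm_cvgP => e e0; have e2 : 0 < e / 2 by rewrite divr_gt0.
have /hnorm_cvgP /(_ _ e2) := @J_cvg R V D H selfH x; apply: filterS => n h.
apply: le_lt_trans (hnorm_dist (J n x) _ _) _.
have := resolvent_le selfH (J n x - x) (s0 n).
by rewrite (linear_opB (resolvent_linear selfH (s0 n))); lra.
Qed.

Lemma JJ_zero_op n u g : weakR T [set: V] O u g ->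
  weakR T [set: V] O (fun t => JJ n (u t)) (fun t => JJ n (g t)).
Proof.
pose J' y := resolvent D H (- n.+1%:R) (resolvent D H (- n.+1%:R) y).
have l' : linear J' by move=> c x y; rewrite /J' !(resolvent_linear selfH (ms0 n)).
have b' y : hnorm (J' y) <= 1 * hnorm y.
  by rewrite mul1r; apply: le_trans (resolvent_le selfH _ (ms0 n)) (resolvent_le selfH _ (ms0 n)).
apply: (weakR_zero_op (@JJ_linear n) (@JJ_bounded n) l' b') => x y.
by rewrite !(resolvent_adj selfH).
Qed.

Lemma L2_JJ n u : L2 T u -> L2 T (fun t => JJ n (u t)).
Proof. exact: (L2_op (@JJ_linear n) (@JJ_bounded n)). Qed.

Lemma Rint_initial_le (h : R -> R) (t : R) : 0 <= t -> t <= T -> (forall r, I r -> 0 <= h r) ->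
  mu.-integrable I (EFin \o h) -> \int[mu]_(r in `]0, t[) h r <= \int[mu]_(r in I) h r.
Proof.
move=> t0 tT h0 ih; apply: Rint_subset => //.
exact: initial_sub.
Qed.

Theorem selfadjoint_solvable : solvable T D H.
Proof.
move=> x0 g lg.
have /choice[y hy] n : exists u, [/\ {within `[0, T], continuous u}, u 0 = x0 & weakR T [set: V] (Y n) u g].
  exact: (solvable_bounded _ (@Y_linear n) (@Y_bounded n) (@Y_sym n) x0 lg).
have cy n : {within `[0, T], continuous (y n)} by case: (hy n).
have ly n : L2 T (y n) by exact: L2_within.
have wy n : weakR T [set: V] (Y n) (y n) g by case: (hy n).
have lYy n m : L2 T (fun t => Y n (y m t)) by exact: (L2_op (@Y_linear n) (@Y_bounded n)).
pose C0 := hnorm x0 + 2 * \int[mu]_(t in I) hnorm (g t).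
have ihg := integrable_hnorm T_gt0 mI II lg.
have C00 : 0 <= C0.
  by rewrite addr_ge0 ?hnorm_ge0// mulr_ge0// Rintegral_ge0// => t _; exact: hnorm_ge0.
have yC n (t : R) : 0 <= t -> t <= T -> hnorm (y n t) <= C0.
  move=> t0 tT; apply: le_trans (energy_bound T_gt0 (Y_selfadjoint n) sepV (cy n) lg (wy n) t0 tT) _.
  have [_ -> _] := hy n; rewrite lerD2l ler_wpM2l//.
  by apply: Rint_initial_le => // r _; exact: hnorm_ge0.
have cB w1 w2 : {within `[0, T], continuous w1} -> {within `[0, T], continuous w2} ->
    {within `[0, T], continuous (fun t => w1 t - w2 t)}.
  move=> /subspace_continuousP h1 /subspace_continuousP h2; apply/subspace_continuousP => t tT.
  by apply: cvgB; [exact: h1|exact: h2].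
have cJJ n w : {within `[0, T], continuous w} -> {within `[0, T], continuous (fun t => JJ n (w t))}.
  move=> /subspace_continuousP h; apply/subspace_continuousP => t tT.
  exact: (bounded_cvg (@JJ_linear n) (@JJ_bounded n) (h t tT)).
have w0 m : weakR T [set: V] O (y m) (fun t => g t + Y m (y m t)).
  exact/(weakR_bounded (@Y_linear m) (@Y_bounded m) (@Y_sym m) (ly m) lg).
have YJ m n x : Y m (JJ n x) = JJ n (Y m x) by rewrite !(yosida_resolvent selfH).
have wJ n m : weakR T [set: V] O (fun t => JJ n (y m t)) (fun t => JJ n (g t) + Y m (JJ n (y m t))).
  move=> phi tp; rewrite (JJ_zero_op n (w0 m) tp); apply: eq_Rintegral => t _.
  by rewrite YJ (linear_opD (@JJ_linear n)).
(* A bound on the distance from [y m] to its regularisation that is independent of [m]: since [JJ n]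
   commutes with [Y m], the difference solves the same equation with data [x0 - JJ n x0] and
   [g - JJ n g]. *)
pose ep n := hnorm (x0 - JJ n x0) + 2 * \int[mu]_(t in I) hnorm (g t - JJ n (g t)).
have near1 n m (t : R) : 0 <= t -> t <= T -> hnorm (y m t - JJ n (y m t)) <= ep n.
  move=> t0 tT.
  have lJg := L2_JJ n lg; have lJy := L2_JJ n (ly m).
  have wd : weakR T [set: V] (Y m) (fun t => y m t - JJ n (y m t)) (fun t => g t - JJ n (g t)).
    apply: (weakRB T_gt0 (Y_selfadjoint m)) => //.
    exact/(weakR_bounded (@Y_linear m) (@Y_bounded m) (@Y_sym m) lJy lJg).
  apply: le_trans (energy_bound T_gt0 (Y_selfadjoint m) sepV (cB _ _ (cy m) (cJJ n _ (cy m))) (L2B lg lJg) wd t0 tT) _.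
  have [_ -> _] := hy m; rewrite /ep lerD2l ler_wpM2l//.
  apply: Rint_initial_le => //; first by move=> r _; exact: hnorm_ge0.
  exact: (integrable_hnorm T_gt0 mI II (L2B lg lJg)).
(* For fixed [n] the regularised difference starts from 0 and solves the equation for [Y m] with
   source [(Y m - Y k) JJ n (y k)], which [yosida_diff] makes small as [m] and [k] grow. *)
have near2 (n m k : nat) (t : R) : 0 <= t -> t <= T -> hnorm (JJ n (y m t) - JJ n (y k t)) <=
    2 * T * ((m.+1%:R^-1 + k.+1%:R^-1) * ((2 * n.+1%:R) ^+ 2 * C0)).
  move=> t0 tT.
  have lJg := L2_JJ n lg; have lm := L2_JJ n (ly m); have lk := L2_JJ n (ly k).
  have lYm j u : L2 T u -> L2 T (fun t => Y j (u t)) by exact: (L2_op (@Y_linear j) (@Y_bounded j)).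
  pose d t := Y m (JJ n (y k t)) - Y k (JJ n (y k t)).
  have ld : L2 T d by apply: L2B; exact: lYm.
  have wd : weakR T [set: V] (Y m) (fun t => JJ n (y m t) - JJ n (y k t)) d.
    apply/(weakR_bounded (@Y_linear m) (@Y_bounded m) (@Y_sym m)) => //; first exact: L2B.
    have := weakRB T_gt0 zero_selfadjoint lm lk (L2D lJg (lYm m _ lm)) (L2D lJg (lYm k _ lk)) (wJ n m) (wJ n k).
    congr (weakR _ _ _ _ _); apply/funext => r; rewrite /d (linear_opB (@Y_linear m)).
    by apply: rinner_ext => z; rewrite !rinnerE; ring.
  have := energy_bound T_gt0 (Y_selfadjoint m) sepV (cB _ _ (cJJ n _ (cy m)) (cJJ n _ (cy k))) ld wd t0 tT.
  have [_ -> _] := hy m; have [_ -> _] := hy k; rewrite subrr hnorm0 add0r => /le_trans; apply.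
  rewrite -mulrA ler_wpM2l//.
  set B := (_ + _) * _.
  have B0 : 0 <= B by rewrite mulr_ge0 ?addr_ge0 ?invr_ge0 ?mulr_ge0 ?sqr_ge0.
  apply: (@le_trans _ _ (\int[mu]_(r in slice 0 t) B)).
    rewrite -slice0; apply: le_Rintegral.
    - exact: measurable_slice.
    - apply: (integrable_hnorm T_gt0 _ _ ld); [exact: measurable_slice|exact: slice_sub].
    - apply: integrableS (integrable_cst_I T_gt0 B) => //; first exact: measurable_slice.
      exact: slice_sub.
    move=> r rs; have [r0 rT] := I_closed (@slice_sub R T 0 t tT r rs).
    apply: le_trans (yosida_diff selfH _ (s0 m) (s0 k) (s0 n)) _; rewrite !nn.
    by rewrite ler_wpM2l ?addr_ge0 ?invr_ge0// ler_wpM2l ?sqr_ge0// yC.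
  apply: le_trans (Rint_slice_cst B0 (lexx 0) t0) _.
  by rewrite subr0 mulrC ler_wpM2r.
have ep0 : ep n @[n --> \oo] --> (0 : R).
  have h1 : hnorm (x0 - JJ n x0) @[n --> \oo] --> (0 : R).
    have := @JJ_cvg x0 => /hnorm_cvg0P; apply: cvg_trans; apply: near_eq_cvg.
    by apply: nearW => n; rewrite hnormBC.
  have h2 : \int[mu]_(t in I) hnorm (g t - JJ n (g t)) @[n --> \oo] --> (0 : R).
    have z0 : \int[mu]_(r in I) (0 : R) = 0 by rewrite Rintegral_cst// mul0r.
    rewrite -[X in _ --> X]z0; apply: (Rint_dominated mI _ (integrable_scale 2 mI ihg)).
    - by move=> n; exact: (measurable_hnorm II (L2_sm (L2B lg (L2_JJ n lg)))).
    - move=> t It; have := @JJ_cvg (g t) => /hnorm_cvg0P; apply: cvg_trans; apply: near_eq_cvg.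
      by apply: nearW => n; rewrite hnormBC.
    - move=> n t It; rewrite ger0_norm ?hnorm_ge0//.
      by have := hnormB (g t) (JJ n (g t)); have := JJ_le n (g t); lra.
  have := cvgD h1 (cvgMl_tmp (a := 2) h2); rewrite mulr0 addr0; exact.
(* The order of choices matters: first [n], to make [ep n] small, then [m] and [k], to beat the
   factor [(2 (n + 1))^2] fixed by [n]. *)
have [e e0|l lc hl] := uniform_limit cy.
  have e4 : 0 < e / 4 by rewrite divr_gt0.
  have /cvgrPdist_lt /(_ _ e4)[n _ hn] := ep0.
  have {}hn : ep n < e / 4.
    by apply: le_lt_trans (ler_norm _) _; have := hn n (leqnn n); rewrite /= sub0r normrN.
  pose Q := (2 * T) * ((2 * n.+1%:R) ^+ 2 * C0).
  have Q0 : 0 <= Q by have T0 := ltW T_gt0; rewrite mulr_ge0 ?(mulr_ge0 (sqr_ge0 _))// mulr_ge0.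
  have Q1 : 0 < 4 * Q + 1 by lra.
  have [|N hN] := @invS_lt R (e / (4 * Q + 1)); first by rewrite divr_gt0.
  exists N => m k Nm Nk t t0 tT.
  have := near1 n m t t0 tT; have := near1 n k t t0 tT; have := near2 n m k t t0 tT.
  have := hnorm_dist (JJ n (y m t)) (y m t) (y k t).
  have := hnorm_dist (JJ n (y k t)) (JJ n (y m t)) (y k t); rewrite (hnormBC (JJ n (y k t)) (y k t)).
  have := hN m Nm; have := hN k Nk; rewrite !ltr_pdivlMr//.
  have -> : 2 * T * ((m.+1%:R^-1 + k.+1%:R^-1) * ((2 * n.+1%:R) ^+ 2 * C0))
    = (m.+1%:R^-1 + k.+1%:R^-1) * Q by rewrite /Q; ring.
  have p1 : 0 < m.+1%:R^-1 :> R by rewrite invr_gt0.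
  have p2 : 0 < k.+1%:R^-1 :> R by rewrite invr_gt0.
  move: p1 p2 Q0 {Q1 hN}; move: Q (m.+1%:R^-1) (k.+1%:R^-1) => Q p q p1 p2 Q0 h1 h2 h3 h4 h5 h6 h7.
  by have : (p + q) * Q <= e / 2 by [lra]; lra.
have yl (t : R) : 0 <= t -> t <= T -> y n t @[n --> \oo] --> l t.
  move=> tp tT; apply/hnorm_cvgP => e e0; have [|N hN] := hl (e / 2); first by rewrite divr_gt0.
  by exists N => // n /= Nn; have := hN n Nn t tp tT; lra.
exists l; split=> //.
  apply: (hilbert_cvg_unique (yl 0 (lexx 0) (ltW T_gt0))).
  by have -> : (fun n => y n 0) = (fun=> x0); [apply/funext => n; case: (hy n)|exact: cvg_cst].
move=> phi tp; have tpY n := test_bounded (@Y_linear n) (@Y_bounded n) tp.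
have Dp t : D (phi t) by case: tp => -[].
have lp := test_L2 T_gt0 tp; have lH := test_H_L2 T_gt0 selfH tp; have ld := test_deriv_L2 T_gt0 tp.
have lS n := schrodinger_L2 T_gt0 (Y_selfadjoint n) (tpY n).
(* On [D] the Yosida approximations satisfy [|Y n x| <= |H x|], so one integrable function dominates
   all the integrands. *)
have ig := integrable_scale C0 mI (integrable_sum mI (integrable_hnorm T_gt0 mI II ld) (integrable_hnorm T_gt0 mI II lH)).
have c1 : \int[mu]_(t in I) rinner (y n t) (schrodinger (Y n) phi t) @[n --> \oo] -->
    \int[mu]_(t in I) rinner (l t) (schrodinger H phi t).
  apply: (Rint_dominated mI _ ig).
  - by move=> n; exact: (measurable_rinner II (L2_sm (ly n)) (L2_sm (lS n))).
  - move=> t /I_closed[t0 tT]; apply: cvg_rinner; first exact: yl.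
    by apply: cvgB; [exact: cvg_cst|exact: (yosida_cvg selfH (Dp t))].
  - move=> n t /I_closed[t0 tT]; apply: le_trans (rinner_le _ _) _.
    apply: ler_pM; rewrite ?hnorm_ge0//; first exact: yC.
    apply: le_trans (hnormB _ _) _; rewrite hnormI lerD2l.
    exact: (yosida_le_H selfH (s0 n) (Dp t)).
have c2 : (fun n => \int[mu]_(t in I) rinner (y n t) (schrodinger (Y n) phi t))
   = (fun=> \int[mu]_(t in I) rinner (g t) (phi t)).
  by apply/funext => n; exact: wy.
rewrite c2 in c1; exact: (cvg_unique (@Rhausdorff R) c1 (@cvg_cst _ _ _ _ _)).
Qed.

End Yosida.
End Solvability.

(** * Uniform boundedness *)

Section UniformBoundedness.
Context {R : realType} {V : hilbertType R}.

(* One step of the gliding hump: of [c + z] and [c - z], one has an image at least as large as that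
   of [z], so no completeness of operator spaces nor Baire category is needed. *)
Lemma hump (A : V -> V) (a m r : R) (c x : V) : linear A -> (forall y, hnorm (A y) <= a * hnorm y) ->
  0 <= m -> 0 < r -> 2 * (m + 1) / r * hnorm x < hnorm (A x) ->
  exists q : V * R, 0 < q.2 /\ forall y, hnorm (y - q.1) <= q.2 ->
    hnorm (y - c) <= r /\ m <= hnorm (A y).
Proof.
move=> lA bA m0 r0 hx.
have x0 : 0 < hnorm x.
  rewrite lt_neqAle hnorm_ge0 andbT eq_sym; apply/eqP => /hnorm_eq0 x0.
  by move: hx; rewrite x0 (linear_op0 lA) hnorm0 mulr0 ltxx.
(* [z] has norm [r / 2], which keeps [c + z] and [c - z] within [r] of [c] with [r / 2] to spare; at
   that scale the hypothesis on [x] reads [m + 1 <= hnorm (A z)]. *)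
pose z := (r / (2 * hnorm x))%:C%C *: x.
have nz : hnorm z = r / 2.
  rewrite hnormZ ger0_norm; last by rewrite ltW// divr_gt0// mulr_gt0.
  by field; rewrite gt_eqF.
have Az : m + 1 <= hnorm (A z).
  rewrite (linear_opZ lA) hnormZ ger0_norm; last by rewrite ltW// divr_gt0// mulr_gt0.
  have -> : m + 1 = r / (2 * hnorm x) * (2 * (m + 1) / r * hnorm x).
    by field; rewrite !gt_eqF.
  by rewrite ler_wpM2l ?[_ < _]ltW// ltW// divr_gt0// mulr_gt0.
have [p [pc Ap]] : exists p, hnorm (p - c) = r / 2 /\ m + 1 <= hnorm (A p).
  have : 2 * hnorm (A z) <= hnorm (A (c + z)) + hnorm (A (c - z)).
    apply: le_trans (hnormB _ _); rewrite -linear_opB//.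
    have -> : c + z - (c - z) = (2 : R)%:C%C *: z.
      by apply: rinner_ext => w; rewrite rinnerZl !rinnerE; ring.
    by rewrite (linear_opZ lA) hnormZ ger0_norm.
  case: (leP (m + 1) (hnorm (A (c + z)))) => h1 h2.
    by exists (c + z); rewrite addrC addKr.
  exists (c - z); rewrite addrC addKr hnormN; split=> //; lra.
have a1 : 0 < `|a| + 1 by rewrite ltr_wpDl.
(* Within distance [1 / (|a| + 1)] the image moves by at most 1, which uses up the surplus in
   [m + 1]. *)
exists (p, Num.min (r / 2) (`|a| + 1)^-1) => /=; split.
  by rewrite lt_min invr_gt0 a1 divr_gt0.
move=> y; rewrite le_min => /andP[y1 y2]; split.
  by have := hnorm_dist p y c; lra.
have : hnorm (A p) <= hnorm (A y) + hnorm (A (y - p)).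
  rewrite -(hnormN (A (y - p))) -(linear_opN lA).
  by apply: le_trans (hnormD _ _); rewrite -(linear_opD lA) opprB addrC subrK.
have : hnorm (A (y - p)) <= 1.
  apply: le_trans (bA _) _; have <- : (`|a| + 1) * (`|a| + 1)^-1 = 1 by rewrite mulfV// gt_eqF.
  apply: le_trans (_ : (`|a| + 1) * hnorm (y - p) <= _); last by rewrite ler_wpM2l ?[_ <= _]y2 ?ltW.
  by rewrite ler_wpM2r ?hnorm_ge0// (le_trans (ler_norm a))// lerDl.
lra.
Qed.

(** Iterating [hump] gives nested balls whose radii tend to 0, some [A s] having norm at least [n]
    everywhere on the ball of index [n + 1]. Their common point violates the pointwise bound. *)
Theorem uniform_boundedness (S : Type) (A : S -> V -> V) : (forall s, linear (A s)) ->
  (forall s, exists a : R, forall x, hnorm (A s x) <= a * hnorm x) ->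
  (forall x, exists a : R, forall s, hnorm (A s x) <= a) ->
  exists2 a : R, 0 <= a & forall s x, hnorm (A s x) <= a * hnorm x.
Proof.
move=> lA bA pA; apply: contrapT => hA.
have unb (a : R) : 0 <= a -> exists s x, a * hnorm x < hnorm (A s x).
  move=> a0; apply: contrapT => h; apply: hA; exists a => // s x; rewrite leNgt.
  by apply/negP => hx; apply: h; exists s, x.
have step (k : (V * R) * nat) : exists q : V * R, 0 < k.1.2 ->
    [/\ 0 < q.2, q.2 <= k.2.+1%:R^-1 & exists s, forall y, hnorm (y - q.1) <= q.2 ->
    hnorm (y - k.1.1) <= k.1.2 /\ k.2%:R <= hnorm (A s y)].
  case: k => [[c r] n] /=; have [r0|] := ltP 0 r; last by exists (0, 0).
  have [|s [x hx]] := unb (2 * (n%:R + 1) / r).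
    by rewrite divr_ge0 ?mulr_ge0 ?addr_ge0 ?ler0n// ltW.
  have [a ba] := bA s; have [q [q0 hq]] := hump c (lA s) ba (ler0n _ n) r0 hx.
  exists (q.1, Num.min q.2 n.+1%:R^-1) => /= _; split.
  - by rewrite lt_min q0 invr_gt0 ltr0n.
  - by rewrite ge_min lexx orbT.
  - by exists s => y; rewrite le_min => /andP[yq _]; exact: hq.
have [F hF] := choice step.
pose fix seqn (n : nat) : V * R := if n is n'.+1 then F (seqn n', n') else (0, 1).
have s0 n : 0 < (seqn n).2 by elim: n => [|n IH]//; have [] := hF (seqn n, n) IH.
have sS n : exists s, forall y, hnorm (y - (seqn n.+1).1) <= (seqn n.+1).2 ->
    hnorm (y - (seqn n).1) <= (seqn n).2 /\ n%:R <= hnorm (A s y).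
  by have [] := hF (seqn n, n) (s0 n).
have nest n m y : hnorm (y - (seqn (n + m)%N).1) <= (seqn (n + m)%N).2 ->
    hnorm (y - (seqn n).1) <= (seqn n).2.
  elim: m => [|m IH]; first by rewrite addn0.
  by rewrite addnS => h; apply: IH; have [s /(_ y h)[]] := sS (n + m)%N.
have cn n m : (n <= m)%N -> hnorm ((seqn m).1 - (seqn n).1) <= (seqn n).2.
  move=> nm; apply: (nest n (m - n)%N); rewrite subnKC// subrr hnorm0; exact/ltW.
have [e e0|l hl] := @hnorm_cauchy R V (fun n => (seqn n).1).
  have [|N hN] := @invS_lt R (e / 2); first by rewrite divr_gt0.
  exists N.+1 => m n Nm Nn; have := hN _ (leqnn N).
  have [_ h _] := hF (seqn N, N) (s0 N).
  have := cn _ _ Nm; have := cn _ _ Nn; have := hnorm_dist (seqn N.+1).1 (seqn m).1 (seqn n).1.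
  have {}h : (seqn N.+1).2 <= N.+1%:R^-1 := h.
  rewrite (hnormBC (seqn N.+1).1) => h1 h2 h3 h4; have := le_lt_trans h h4; move: (seqn N.+1).2 h2 h3 => q h2 h3 h5.
  by apply: le_lt_trans h1 _; rewrite [e]splitr ltrD// (le_lt_trans _ h5).
have ln n : hnorm (l - (seqn n).1) <= (seqn n).2.
  apply: (cvgr_ub (cvg_hnorm (cvgB hl (@cvg_cst _ (seqn n).1 _ _ _)))).
  by exists n => // m /=; exact: cn.
have [a ha] := pA l; have := truncnS_gt a; have [s /(_ l (ln _))[_]] := sS (Num.truncn a).+1.
by move=> h1 h2; have := lt_le_trans h2 (le_trans h1 (ha s)); rewrite ltxx.
Qed.

End UniformBoundedness.

(** * The perturbed equation *)

Section PerturbedEquation.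
Local Open Scope complex_scope.
Context {R : realType} {V : hilbertType R}.
Variable T : R.
Hypothesis T_gt0 : 0 < T.
Local Notation mu := (@lebesgue_measure R).
Local Notation I := (`]0, T[%classic : set R).
Implicit Types (phi u v w k g : R -> V) (x : V).

Let mI : measurable I := @measurable_I R T.
Let II : I `<=` I := @subset_refl _ _.

Lemma L2norm_sq u : L2norm T u ^+ 2 = \int[mu]_(t in I) hnorm (u t) ^+ 2.
Proof.
have -> : \int[mu]_(t in I) hnorm (u t) ^+ 2 = complex.Re (L2inner T u u).
  by apply: eq_Rintegral => t _; rewrite hnorm_sq.
rewrite /L2norm sqr_sqrtr//; apply: Rintegral_ge0 => t _.
by rewrite -[complex.Re _]/(rinner _ _) -hnorm_sq sqr_ge0.
Qed.

Lemma Rint_sq_eq0 u : L2 T u -> \int[mu]_(t in I) hnorm (u t) ^+ 2 = 0 -> L2eq T u (fun=> 0).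
Proof.
move=> lu h; have iu := L2_integrable lu.
have z : (\int[mu]_(t in I) `|(hnorm (u t) ^+ 2)%:E| = 0)%E.
  have : (\int[mu]_(t in I) (hnorm (u t) ^+ 2)%:E)%E \is a fin_num by exact: (integrable_fin_num _ iu).
  have -> : (\int[mu]_(t in I) `|(hnorm (u t) ^+ 2)%:E| = \int[mu]_(t in I) (hnorm (u t) ^+ 2)%:E)%E.
    by apply: eq_integral => t _; rewrite gee0_abs// lee_fin sqr_ge0.
  by move: h; rewrite /Rintegral; case: (\int[_]_(_ in _) _)%E => //= r ->.
have [/(_ z) az _] := ae_eq_integral_abs mu mI (measurable_int _ iu).
apply: ae_imp az => t ht /ht /= [] /eqP; rewrite sqrf_eq0 => /eqP; exact: hnorm_eq0.
Qed.

Lemma initial_value_uniq u x y : initial_value T u x -> initial_value T u y -> x = y.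
Proof.
move=> [w1 [c1 e1 <-]] [w2 [c2 e2 <-]].
apply: (within_ae_uniq T_gt0 c1 c2 _ (lexx 0) (ltW T_gt0)).
by apply: ae_imp (ae_and e1 e2) => t [h1 h2] It; rewrite h1// h2.
Qed.

Lemma at0P u x : initial_value T u x -> at0 T u = x.
Proof. by move=> h; apply: (initial_value_uniq _ h); exact: xgetI h. Qed.

Variables (D : set V) (H : V -> V).
Hypothesis selfH : selfadjoint D H.
Hypothesis sepV : separable_hilbert V.

Lemma schrodinger_opP u : XH T D H u ->
  L2 T (schrodinger_op T D H u) /\ weakR T D H u (schrodinger_op T D H u).
Proof.
move=> [_ [g lg wg]]; have : [set k | L2 T k /\ weak_schrodinger T D H u k] g by [].
by move=> /(xgetI (fun=> 0)) [l /(weakRP T selfH)].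
Qed.

Lemma XH_initial_value u : XH T D H u -> initial_value T u (at0 T u).
Proof.
move=> [lu [g lg /(weakRP T selfH) wg]]; have [w [wc wu _]] := weak_regularity T_gt0 selfH sepV lu lg wg.
by apply: (@xgetI _ 0 (initial_value T u) (w 0)); exists w.
Qed.

Variables (B : R -> V -> V) (M : R).
Hypothesis M_ge0 : 0 <= M.
Hypothesis linB : forall t : R, 0 <= t -> t <= T -> linear (B t).
Hypothesis bndB : forall t : R, 0 <= t -> t <= T -> forall x, hnorm (B t x) <= M * hnorm x.
Hypothesis contB : forall x, {within `[0, T], continuous (fun t => B t x)}.
Hypothesis symB : forall t : R, 0 <= t -> t <= T -> forall x y, rinner (B t x) y = rinner x (B t y).
Variables (u0 : V) (f : R -> V).
Hypothesis fL2 : L2 T f.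

Let L2_B u : L2 T u -> L2 T (fun t => B t (u t)).
Proof. exact: (L2_family T_gt0 M_ge0 linB bndB contB). Qed.

Let Bi (t : R) x : I t -> B t ('i *: x) = 'i *: B t x.
Proof. by move=> /I_closed[t0 tT]; rewrite (linear_opZ (linB t0 tT)). Qed.

Lemma Rint_perturbed u phi : L2 T u -> test_fun T D H phi ->
  \int[mu]_(t in I) rinner (u t) (schrodinger H phi t - B t (phi t)) =
  \int[mu]_(t in I) rinner (u t) (schrodinger H phi t) - \int[mu]_(t in I) rinner (B t (u t)) (phi t).
Proof.
move=> lu tp; have ls := schrodinger_L2 T_gt0 selfH tp; have lp := test_L2 T_gt0 tp.
have i1 := integrable_rinner mI II lu ls; have i2 := integrable_rinner mI II (L2_B lu) lp.
rewrite -RintegralB//; apply: eq_Rintegral => t /set_mem /I_closed[t0 tT].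
by rewrite symB// rinnerDr rinnerNr.
Qed.

Lemma Rint_source u phi : L2 T u -> test_fun T D H phi ->
  \int[mu]_(t in I) rinner (f t + B t (u t)) (phi t) =
  \int[mu]_(t in I) rinner (f t) (phi t) + \int[mu]_(t in I) rinner (B t (u t)) (phi t).
Proof.
move=> lu tp; have lp := test_L2 T_gt0 tp.
have i1 := integrable_rinner mI II fL2 lp; have i2 := integrable_rinner mI II (L2_B lu) lp.
by rewrite -RintegralD//; apply: eq_Rintegral => t _; rewrite rinnerDl.
Qed.

(** Symmetry of [B t] moves it from the test function to the source; the imaginary part is again
    obtained from ['i *: phi], since [B t] commutes with ['i]. *)
Lemma weak_perturbedP u : L2 T u ->
  (forall phi, test_fun T D H phi ->
     L2inner T u (fun t => schrodinger H phi t - B t (phi t)) = L2inner T f phi) <->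
  weakR T D H u (fun t => f t + B t (u t)).
Proof.
move=> lu; split=> [h phi tp|h phi tp].
  have [+ _] := h phi tp; rewrite -/(rinner _ _) => /= e.
  rewrite Rint_source// -[X in X + _]e; move: (Rint_perturbed lu tp) => ->.
  by rewrite subrK.
have re psi : test_fun T D H psi ->
    \int[mu]_(t in I) rinner (u t) (schrodinger H psi t - B t (psi t)) =
    \int[mu]_(t in I) rinner (f t) (psi t).
  by move=> tq; rewrite Rint_perturbed// h// Rint_source// addrK.
rewrite /L2inner; congr Complex; first exact: re.
have [ti di] := test_i selfH tp.
under eq_Rintegral do rewrite Im_inner.
under [RHS]eq_Rintegral do rewrite Im_inner.
rewrite -re//; apply: eq_Rintegral => t /set_mem It; congr rinner.
rewrite /schrodinger di (sa_HZ selfH) ?Bi ?scalerBr//.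
by case: tp => -[].
Qed.

Lemma weak_solutionP u : L2 T u -> weak_solution T D H B u0 f u <->
  weakR T D H u (fun t => f t + B t (u t)) /\ initial_value T u u0.
Proof.
by move=> lu; split=> [[_ /(weak_perturbedP lu) ? ?]|[? ?]]; split=> //; exact/weak_perturbedP.
Qed.

Lemma weak_solution_XH u : weak_solution T D H B u0 f u -> XH T D H u.
Proof.
move=> h; have [lu _ _] := h; split=> //; exists (fun t => f t + B t (u t)).
  by apply: L2D => //; exact: L2_B.
by apply/(weakRP T selfH); move/(weak_solutionP lu) : h => [].
Qed.

Lemma weak_solution_exists : exists u, weak_solution T D H B u0 f u.
Proof.
have [u [uc u_0 wu]] := perturbed_solution T_gt0 selfH sepV M_ge0 linB bndB contB u0
  (selfadjoint_solvable T_gt0 sepV selfH) fL2.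
have lu : L2 T u by exact: L2_within.
by exists u; apply/weak_solutionP => //; split=> //; exists u; split=> //; exact: ae_all.
Qed.

Lemma weak_solution_uniq u v : weak_solution T D H B u0 f u -> weak_solution T D H B u0 f v ->
  L2eq T u v.
Proof.
move=> hu hv; have [lu _ _] := hu; have [lv _ _] := hv.
move/(weak_solutionP lu) : hu => [wu [u' [u'c u'u u'0]]].
move/(weak_solutionP lv) : hv => [wv [v' [v'c v'v v'0]]].
have lBu := L2_B lu; have lBv := L2_B lv.
pose d t := u t - v t; have ld : L2 T d by exact: L2B.
have wd := weakRB T_gt0 selfH lu lv (L2D fL2 lBu) (L2D fL2 lBv) wu wv.
have [w [wc wdd en]] := weak_regularity T_gt0 selfH sepV ld (L2B (L2D fL2 lBu) (L2D fL2 lBv)) wd.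
(* [w] comes from the regularity theorem and [u' - v'] from the initial conditions; both are
   continuous representatives of [d], so they agree at 0. *)
have w0 : w 0 = 0.
  apply: (@initial_value_uniq d); first by exists w.
  exists (fun t => u' t - v' t); split.
  - move/subspace_continuousP : u'c => h1; move/subspace_continuousP : v'c => h2.
    by apply/subspace_continuousP => t tT; apply: cvgB; [exact: h1|exact: h2].
  - by apply: ae_imp (ae_and u'u v'v) => t [h1 h2] It; rewrite h1// h2.
  - by rewrite u'0 v'0 subrr.
apply: ae_imp wdd => t wt It; have [t0 tT] := I_closed It.
apply/eqP; rewrite -subr_eq0 -/(d t) -wt//; apply/eqP/hnorm_eq0/eqP.
rewrite -sqrf_eq0; have := en 0 t (lexx 0) t0 tT; rewrite w0 hnorm0 expr0n subr0 => ->.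
rewrite (_ : \int[_]_(_ in _) _ = 0) ?mulr0 ?oppr0//.
rewrite -[RHS](_ : \int[mu]_(r in slice 0 t) 0 = 0); last by rewrite Rintegral_cst ?mul0r//; exact: measurable_slice.
apply: eq_Rintegral => r /set_mem rs; have Ir := @slice_sub R T 0 t tT r rs; have [r0 rT] := I_closed Ir.
have -> : f r + B r (u r) - (f r + B r (v r)) = B r (d r).
  by rewrite (linear_opB (linB r0 rT)) opprD addrACA subrr add0r.
have := symB r0 rT ('i *: d r) (d r); rewrite (linear_opZ (linB r0 rT)) => h.
have := rinner_il (d r) (B r (d r)); rewrite -h rinnerC.
have := rinner_il (B r (d r)) (d r); move: h; lra.
Qed.

Lemma L2_residual u : XH T D H u -> L2 T (fun t => schrodinger_op T D H u t - B t (u t) - f t).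
Proof. by move=> Xu; have [lg _] := schrodinger_opP Xu; case: Xu => lu _; do 2 apply: L2B => //; exact: L2_B. Qed.

Lemma energyE u : energy T D H B u0 f u = hnorm (at0 T u - u0) ^+ 2 +
  T * \int[mu]_(t in I) hnorm (schrodinger_op T D H u t - B t (u t) - f t) ^+ 2.
Proof. by rewrite /energy L2norm_sq. Qed.

Lemma energy_ge0 u : 0 <= energy T D H B u0 f u.
Proof. by apply: addr_ge0; first exact: sqr_ge0; apply: mulr_ge0; [exact: ltW|exact: sqr_ge0]. Qed.

(** [schrodinger_op] is an arbitrary choice among the admissible [g]; [weakR_uniq] identifies it
    almost everywhere with [f + B u], so the residual vanishes. *)
Lemma energy_weak_solution u : weak_solution T D H B u0 f u -> energy T D H B u0 f u = 0.
Proof.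
move=> hu; have Xu := weak_solution_XH hu; have [lu _ /at0P u_0] := hu.
have [lg wg] := schrodinger_opP Xu; move/(weak_solutionP lu) : hu => [wu _].
have ge := weakR_uniq T_gt0 sepV selfH lg (L2D fL2 (L2_B lu)) wg wu.
rewrite energyE u_0 subrr hnorm0 expr0n add0r.
rewrite (_ : \int[_]_(_ in _) _ = 0) ?mulr0//.
rewrite -[RHS](_ : \int[mu]_(r in I) 0 = 0); last by rewrite Rintegral_cst ?mul0r.
apply: ae_Rintegral => //.
  by apply: measurable_funX; exact: (measurable_hnorm II (L2_sm (L2_residual Xu))).
by apply: ae_imp ge => t h It; rewrite h// addrK subrr hnorm0 expr0n.
Qed.

(** Both terms of the energy are nonnegative and [T] is positive, so both vanish. [XH_initial_value]
    ensures that [at0] is a genuine initial value and not the default 0. *)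
Lemma weak_solution_energy u : XH T D H u -> energy T D H B u0 f u <= 0 ->
  weak_solution T D H B u0 f u.
Proof.
move=> Xu; rewrite energyE => e0; have [lu _] := Xu; have [lg wg] := schrodinger_opP Xu.
have lr := L2_residual Xu.
set a := hnorm _ in e0; set b := Rintegral _ _ _ in e0.
have b0 : 0 <= b by apply: Rintegral_ge0 => t _; exact: sqr_ge0.
have a0 := sqr_ge0 a; have T0 := T_gt0.
have Tb : 0 <= T * b by rewrite mulr_ge0// ltW.
have /eqP : a ^+ 2 = 0 by lra.
rewrite sqrf_eq0 => /eqP /hnorm_eq0/eqP; rewrite subr_eq0 => /eqP u_0.
have /eqP : T * b = 0 by lra.
rewrite mulf_eq0 (gt_eqF T_gt0)/= => /eqP /(Rint_sq_eq0 lr) rz.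
apply/weak_solutionP => //; split; last by rewrite -u_0; exact: XH_initial_value.
move=> phi tp; rewrite wg//; have lp := test_L2 T_gt0 tp.
apply: ae_Rintegral => //.
- exact: (measurable_rinner II (L2_sm lg) (L2_sm lp)).
- exact: (measurable_rinner II (L2_sm (L2D fL2 (L2_B lu))) (L2_sm lp)).
by apply: ae_imp rz => t h /h /eqP; rewrite subr_eq0 subr_eq => /eqP ->.
Qed.

End PerturbedEquation.

Theorem mainTheorem5 (R : realType) (V : hilbertType R)
    (sepV : separable_hilbert V)
    (D : set V) (H : V -> V) (selfH : selfadjoint D H)
    (T : R) (T_gt0 : 0 < T)
    (B : R -> V -> V)
    (boundedB : forall t, t \in `[0, T] -> bounded_operator (B t))
    (selfB : forall t, t \in `[0, T] -> selfadjoint [set: V] (B t))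
    (contB : forall x : V, {within `[0, T], continuous (fun t => B t x)})
    (u0 : V) (f : R -> V) (fL2 : L2 T f) :
  exists ustar : R -> V,
    [/\ weak_solution T D H B u0 f ustar
          /\ (forall u, weak_solution T D H B u0 f u -> L2eq T u ustar),
        XH T D H ustar,
        minimizer (XH T D H) (energy T D H B u0 f) ustar &
        forall u, minimizer (XH T D H) (energy T D H B u0 f) u ->
          L2eq T u ustar].
Proof.
have inT (t : R) : 0 <= t -> t <= T -> t \in `[0, T] by move=> t0 tT; rewrite in_itv/= t0.
have linB (t : R) : 0 <= t -> t <= T -> linear (B t).
  by move=> t0 tT; have [] := boundedB _ (inT t t0 tT).
have symB (t : R) : 0 <= t -> t <= T -> forall x y, rinner (B t x) y = rinner x (B t y).
  by move=> t0 tT x y; apply: (sa_sym (selfB _ (inT t t0 tT))).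
(* Each orbit [t |-> B t x] is continuous on a compact interval, hence bounded. Indexing by the
   subtype restricts the family to [[0, T]], where the hypotheses on [B] hold. *)
have [M M0 hM] : exists2 M : R, 0 <= M &
    forall (s : {t : R | t \in `[0, T]}) x, hnorm (B (sval s) x) <= M * hnorm x.
  apply: uniform_boundedness => [s|s|x].
  - by have [] := boundedB _ (svalP s).
  - by have [] := boundedB _ (svalP s).
  - by have [c _ hc] := within_bounded T_gt0 (contB x); exists (hnorm (B c x)) => s; exact/hc/(svalP s).
have bndB (t : R) : 0 <= t -> t <= T -> forall x, hnorm (B t x) <= M * hnorm x.
  by move=> t0 tT x; exact: hM (exist _ t (inT t t0 tT)) x.
have [ustar hs] := weak_solution_exists T_gt0 selfH sepV M0 linB bndB contB symB u0 fL2.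
have uniq u : weak_solution T D H B u0 f u -> L2eq T u ustar.
  by move=> hu; exact: (weak_solution_uniq T_gt0 selfH sepV M0 linB bndB contB symB fL2 hu hs).
have Xs := weak_solution_XH T_gt0 selfH M0 linB bndB contB symB fL2 hs.
have E0 := energy_weak_solution T_gt0 selfH sepV M0 linB bndB contB symB fL2 hs.
exists ustar; split=> //; first by split=> // v _; rewrite E0 energy_ge0.
(* A minimizer has energy at most that of [ustar], which is 0; it is then itself a weak solution. *)
move=> u [Xu /(_ _ Xs)]; rewrite E0 => Eu; apply: uniq.
exact: (weak_solution_energy T_gt0 selfH sepV M0 linB bndB contB symB fL2 Xu Eu).
Qed.
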